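(* Let $A$ be an apartment of $\mathcal I$, let $\mathfrak s$ be a sector-germ of $\mathcal I$ and let $n=d_{\mathfrak s}(A)$. Then there exist $P_1,\ldots,P_k\in\mathcal P_{A,n}$, with $k\le 2^n$, such that $A=\bigcup_{i=1}^kP_i$ and such that for each $i\in\{1,\ldots,k\}$, $P_i$ and $\mathfrak s$ are contained in some apartment $A_i$ for which there exists an isomorphism of apartments $f_i:A_i\to A$ fixing $P_i$ (pointwise).
   Context: **Vectorial data.** $I$ is a finite set and $C=(c_{i,j})_{i,j\in I}$ is a Kac--Moody matrix: $c_{i,j}\in\mathbb Z$, $c_{i,i}=2$, $c_{i,j}\le 0$ for $i\neq j$, and $c_{i,j}=0\iff c_{j,i}=0$. $X,Y$ are dual free $\mathbb Z$-modules of finite rank with $\mathbb Z$-linearly independent families $(\alpha_i)_{i\in I}$ in $X$ and $(\alpha_i^\vee)_{i\in I}$ in $Y$ such that $\alpha_j(\alpha_i^\vee)=c_{i,j}$. $\mathbb A=Y\otimes\mathbb R$, with its usual topology; elements of $X$ are linear forms on $\mathbb A$. $r_i(v)=v-\alpha_i(v)\alpha_i^\vee$, and $W^v=\langle r_i\mid i\in I\rangle\subset \mathrm{GL}(\mathbb A)$ (Weyl group), acting on $\mathbb A^*$ by $(w.\alpha)(x)=\alpha(w^{-1}x)$. $\Phi=\{w.\alpha_i\}$ is the set of real roots; for $\alpha=w.\alpha_i\in\Phi$, $\alpha^\vee=w.\alpha_i^\vee$. $Q^\vee=\bigoplus_i\mathbb Z\alpha_i^\vee$ and $W^a=Q^\vee\rtimes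 W^v$. $\Delta\subset\bigoplus_i\mathbb Z\alpha_i\subset\mathbb A^*$ is the set of all (real and imaginary) roots of the Kac--Moody algebra of $C$. For $\alpha\in\mathbb A^*$, $k\in\mathbb R$: $D(\alpha,k)=\{\alpha(x)+k\ge0\}$, $D^\circ(\alpha,k)=\{\alpha(x)+k>0\}$, $M(\alpha,k)=\{\alpha(x)+k=0\}$, and $D(\alpha,+\infty)=D^\circ(\alpha,+\infty)=\mathbb A$. Walls (resp. half-apartments) are the $M(\alpha,k)$ (resp. $D(\alpha,k)$), $\alpha\in\Phi$, $k\in\mathbb Z$. $C^v_f=\{v\mid\alpha_i(v)>0\ \forall i\}$; for $J\subset I$, $F^v(J)=\{v\mid \alpha_i(v)=0\ (i\in J),\ \alpha_i(v)>0\ (i\notin J)\}$. Positive (resp. negative) vectorial faces are the $w.F^v(J)$ (resp. $-w.F^v(J)$), $w\in W^v$; vectorial chambers are the $\pm w.C^v_f$. Tits cone: $\mathcal T=\bigcup_{w}w.\overline{C^v_f}$. A vectorial face is spherical if it meets $\pm\mathring{\mathcal T}$. $x\le y$ means $y-x\in\mathcal T$. A ray or segment through $x\ne y$ from $x$ is preordered if $x\le y$ or $y\le x$, generic if $y-x\in\pm\mathring{\mathcal T}$. **Filters.** A filter lies in a set $Z$ if $Z$ is an element of it; a set (e.g. an apartment) contains a filter if it contains an element of it; a map fixes a filter if it fixes pointwise some element of it. The support of a filter is the smallest affine subspace containing it. $\mathcal F\Cup\mathcal F'=\{E\cup E'\mid E\in\mathcal F,E'\in\mathcal F'\}$. The enclosure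 $\mathrm{cl}(\mathcal F)$ of a filter on $\mathbb A$ is the filter of sets $E$ containing some $\bigcap_{\alpha\in\Delta}D(\alpha,k_\alpha)\in\mathcal F$ with $k_\alpha\in\mathbb Z\cup\{+\infty\}$ (a set is treated as its principal filter). A sector-face is $f=x+F^v$ ($F^v$ a vectorial face); its germ at infinity is the filter of sets containing $x+u+F^v$ for some $u\in\overline{F^v}$. If $F^v$ is a vectorial chamber, $f$ is a sector and its germ is a sector-germ, with the sign of $F^v$. A sector-panel is a sector-face contained in a wall and spanning it as an affine space. The face $F(x,F^v)$ is the filter of sets $E$ for which there are $k_\alpha,k'_\alpha\in\mathbb Z\cup\{+\infty\}$ $(\alpha\in\Delta)$ and a neighbourhood $\Omega$ of $x$ with $E\supset\bigcap_{\alpha}(D(\alpha,k_\alpha)\cap D^\circ(\alpha,k'_\alpha))\supset\Omega\cap(x+F^v)$. A chamber (resp. panel) is a face with support $\mathbb A$ (resp. a wall). A chimney is $\mathfrak r(F,F^v)=\mathrm{cl}(F+F^v)$, $F$ a face, $F^v$ a vectorial face; it is splayed if $F^v$ is spherical, solid if the pointwise stabilizer in $W^v$ of the direction of its support is finite. Its germ is the filter of sets belonging to some $\mathfrak r(F+u,F^v)$, $u\in\overline{F^v}$. **Apartments.** $\mathrm{Aut}(\mathbb A)$ is the group of affine bijections of $\mathbb A$ stabilizing $\{(M(\alpha,k),\alpha^\vee)\mid\alpha\in\Phi,k\in\mathbb Z\}$. An apartment of type $\mathbb A$ is a set $A$ with a nonempty set $\mathrm{Isom}^w(\mathbb A,A)$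 of bijections $\mathbb A\to A$ forming one orbit $f_0\circ W^a$. A bijection $\phi:A\to A'$ is a Weyl isomorphism (resp. an isomorphism, which here always means vectorially Weyl isomorphism) if $f'^{-1}\circ\phi\circ f\in W^a$ (resp. $\in(W^v\ltimes\mathbb A)\cap\mathrm{Aut}(\mathbb A)$) for $f\in\mathrm{Isom}^w(\mathbb A,A)$, $f'\in\mathrm{Isom}^w(\mathbb A,A')$. All above notions, the affine structure and the affine topology are transported to every apartment. **Masure.** A masure of type $\mathbb A$ is a set $\mathcal I$ covered by a family of subsets called apartments such that: (MA1) each apartment has a structure of apartment of type $\mathbb A$. (MA2) If $F$ is a point, a germ of a preordered interval, a generic ray or a solid chimney in an apartment $A$, and $A'$ is another apartment containing $F$, then $A\cap A'$ contains $\mathrm{cl}_A(F)$ and there is a Weyl isomorphism $A\to A'$ fixing $\mathrm{cl}_A(F)$. (MA3) If $\mathfrak R$ is the germ of a splayed chimney and $F$ is a face or a germ of a solid chimney, some apartment contains $\mathfrak R$ and $F$. (MA4) If apartments $A,A'$ contain $\mathfrak R$ and $F$ as in (MA3), there is a Weyl isomorphism $A\to A'$ fixing $\mathrm{cl}_A(\mathfrak R\Cup F)$. (MAO) If $x,y\in A\cap A'$ and $x\le_A y$ then $[x,y]_A=[x,y]_{A'}$. Standing assumptions: $\mathcal I$ is such a masure; each panel lies in the closure of finitely many, and more than $2$, chambers; a group $G$ acts strongly transitively on $\mathcal I$ (it permutes apartments, each $g:A\to g.A$ is an isomorphism of apartments, and all isomorphisms in the axioms are induced by elements of $G$); $\mathbb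 A$ is identified with a fixed apartment of $\mathcal I$, and the stabilizer of $\mathbb A$ in $G$ induces on $\mathbb A$ the group $W^v\ltimes Y$. Sector-germs of $\mathcal I$ are sector-germs of its apartments (a sector-germ contained in an apartment $B$ is a sector-germ of $B$, of the same sign). **Galleries and the sets $\mathcal P_{A,n}$.** Two sector-germs of the same sign in an apartment, germs of vectorial chambers $C_1^v,C_2^v$, are adjacent if $\overline{C_1^v}\cap\overline{C_2^v}$ contains a sector-panel. Any two sector-germs $\mathfrak s,\mathfrak s'$ of $\mathcal I$ of the same sign lie in a common apartment; $d(\mathfrak s,\mathfrak s')$ is the length of a minimal gallery from $\mathfrak s$ to $\mathfrak s'$ in such an apartment, i.e. the least $m\ge 0$ such that there are sector-germs $\mathfrak s=\mathfrak q_0,\mathfrak q_1,\ldots,\mathfrak q_m=\mathfrak s'$ of that apartment with $\mathfrak q_{j}$ and $\mathfrak q_{j+1}$ adjacent for all $j$ (independent of the apartment). For an apartment $A$, $d_{\mathfrak s}(A)$ is the minimum of $d(\mathfrak s,\mathfrak s')$ over sector-germs $\mathfrak s'$ of $A$ of the same sign as $\mathfrak s$; thus $d_{\mathfrak s}(A)=0$ iff $A$ contains $\mathfrak s$. $\mathcal D_A$ is the set of half-apartments of $A$; $\mathcal P_{A,0}=\{A\}$ and $\mathcal P_{A,n}=\{\bigcap_{i=1}^nD_i\mid(D_i)\in(\mathcal D_A)^n\}$ for $n\ge1$. *)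

(* Defs.v *)
From HB Require Import structures.
From mathcomp Require Import all_boot all_order all_algebra.
From mathcomp Require Import complex.
From mathcomp Require Import boolp classical_sets functions cardinality filter.
From mathcomp Require Import reals ereal topology normedtype.

Set Implicit Arguments.
Unset Strict Implicit.
Unset Printing Implicit Defensive.

Import Order.TTheory GRing.Theory Num.Theory.
Import numFieldNormedType.Exports.

Local Open Scope classical_set_scope.
Local Open Scope ring_scope.

Definition least (S : set nat) (n : nat) : Prop :=
  S n /\ forall m, S m -> (n <= m)%N.

(** * Kac-Moody algebras *)

Record lie_algebra (K : fieldType) := LieAlgebra {
  lie_car :> lmodType K;
  lie_bracket : lie_car -> lie_car -> lie_car;
  lie_linearl : forall a x y z,
    lie_bracket (a *: x + y) z = a *: lie_bracket x z + lie_bracket y z;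
  lie_linearr : forall a x y z,
    lie_bracket z (a *: x + y) = a *: lie_bracket z x + lie_bracket z y;
  lie_alt : forall x, lie_bracket x x = 0;
  lie_jacobi : forall x y z,
    lie_bracket x (lie_bracket y z) + lie_bracket y (lie_bracket z x)
    + lie_bracket z (lie_bracket x y) = 0 }.

Definition lie_subspace (K : fieldType) (g : lie_algebra K) (S : set g) : Prop :=
  S 0 /\ forall (a : K) x y, S x -> S y -> S (a *: x + y).

Definition lie_subalgebra (K : fieldType) (g : lie_algebra K) (S : set g)
    : Prop :=
  lie_subspace S /\ forall x y, S x -> S y -> S (lie_bracket x y).

Definition lie_ideal (K : fieldType) (g : lie_algebra K) (S : set g) : Prop :=
  lie_subspace S /\ forall x y, S y -> S (lie_bracket x y).

Definition kac_moody_matrix (I : finType) (c : I -> I -> int) : Prop :=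
  [/\ forall i, c i i = 2,
      forall i j, i != j -> c i j <= 0 &
      forall i j, c i j = 0 <-> c j i = 0].

(* The Lie algebra g(C) of Kac: a minimal realization (h, Pi, Pi^vee) of C,
   Chevalley generators, and no nonzero ideal meeting h trivially. By Kac,
   Infinite dimensional Lie algebras, Prop. 1.4, these properties determine
   g(C) up to isomorphism. Here h is K^p and [km_cartan] is its embedding. *)
Record kac_moody_algebra (K : fieldType) (I : finType) (c : I -> I -> int) :=
  KacMoodyAlgebra {
  km_lie :> lie_algebra K;
  km_dim : nat;
  km_cartan : {linear 'cV[K]_km_dim -> km_lie};
  km_root : I -> 'rV[K]_km_dim;
  km_coroot : I -> 'cV[K]_km_dim;
  km_e : I -> km_lie;
  km_f : I -> km_lie;
  km_cartan_inj : injective km_cartan;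
  km_dimE : (km_dim + \rank (\matrix_(i < #|I|, j < #|I|)
      ((c (enum_val i) (enum_val j))%:~R : K)) = 2 * #|I|)%N;
  km_root_free : forall n : I -> K,
    \sum_i n i *: km_root i = 0 -> forall i, n i = 0;
  km_coroot_free : forall n : I -> K,
    \sum_i n i *: km_coroot i = 0 -> forall i, n i = 0;
  km_pairing : forall i j, (km_root j *m km_coroot i) 0 0 = (c i j)%:~R;
  km_ef : forall i j, lie_bracket (km_e i) (km_f j) =
    if i == j then km_cartan (km_coroot i) else 0;
  km_hh : forall h h', lie_bracket (km_cartan h) (km_cartan h') = 0;
  km_he : forall h i,
    lie_bracket (km_cartan h) (km_e i) = (km_root i *m h) 0 0 *: km_e i;
  km_hf : forall h i,
    lie_bracket (km_cartan h) (km_f i) = - ((km_root i *m h) 0 0 *: km_f i);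
  km_generated : forall S : set km_lie, lie_subalgebra S ->
    (forall h, S (km_cartan h)) -> (forall i, S (km_e i)) ->
    (forall i, S (km_f i)) -> S = setT;
  km_ideal : forall J : set km_lie, lie_ideal J ->
    (forall h, J (km_cartan h) -> h = 0) -> J = [set 0] }.

(* The roots, by their coordinates in the basis of simple roots. *)
Definition km_roots (K : fieldType) (I : finType) (c : I -> I -> int)
    (g : kac_moody_algebra K c) : set (I -> int) :=
  [set n | (exists i, n i != 0) /\
    exists2 x : g, x != 0 & forall h, lie_bracket (km_cartan g h) x =
      (\sum_i (n i)%:~R * (km_root g i *m h) 0 0) *: x].

(** * Vectorial data *)

(* X and Y are Z^d, as rows and columns, in duality through the matrix
   product; A is the space of columns R^d and A^* the space of rows. *)
Record vectorial_data (R : realType) := VectorialData {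
  vd_index : finType;
  vd_cartan : vd_index -> vd_index -> int;
  vd_cartanP : kac_moody_matrix vd_cartan;
  vd_dim : nat;
  vd_root : vd_index -> 'rV[int]_vd_dim;
  vd_coroot : vd_index -> 'cV[int]_vd_dim;
  vd_root_free : forall n : vd_index -> int,
    \sum_i n i *: vd_root i = 0 -> forall i, n i = 0;
  vd_coroot_free : forall n : vd_index -> int,
    \sum_i n i *: vd_coroot i = 0 -> forall i, n i = 0;
  vd_pairing : forall i j, (vd_root j *m vd_coroot i) 0 0 = vd_cartan i j;
  vd_algebra : kac_moody_algebra R[i] vd_cartan }.

Arguments vd_root {R} v i.
Arguments vd_coroot {R} v i.

Unset Implicit Arguments.

Section Model.
Context {R : realType} (V : vectorial_data R).

Local Notation I := (vd_index V).
Local Notation d := (vd_dim V).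
Local Notation AA := 'cV[R]_(vd_dim V).
Local Notation AAdual := 'rV[R]_(vd_dim V).

Definition evalf (a : AAdual) (x : AA) : R := (a *m x) 0 0.

Definition simple_root (i : I) : AAdual := map_mx intr (vd_root V i).
Definition simple_coroot (i : I) : AA := map_mx intr (vd_coroot V i).

Definition simple_refl (i : I) : 'M[R]_d :=
  1%:M - simple_coroot i *m simple_root i.

Inductive weyl : 'M[R]_d -> Prop :=
  | weyl_one : weyl 1%:M
  | weyl_mul u v : weyl u -> weyl v -> weyl (u *m v)
  | weyl_inv u : weyl u -> weyl (invmx u)
  | weyl_refl i : weyl (simple_refl i).

Definition dual_act (w : 'M[R]_d) (a : AAdual) : AAdual := a *m invmx w.

Definition real_root_coroot (a : AAdual) (av : AA) : Prop :=
  exists w i, [/\ weyl w, a = dual_act w (simple_root i)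
                & av = w *m simple_coroot i].

Definition real_root : set AAdual := [set a | exists av, real_root_coroot a av].

Definition all_root : set AAdual :=
  [set \sum_i (n i)%:~R *: simple_root i | n in km_roots (vd_algebra V)].

Definition coroot_lattice : set AA :=
  [set x | exists n : I -> int, x = \sum_i (n i)%:~R *: simple_coroot i].

Definition cochar_lattice : set AA :=
  [set x | exists y : 'cV[int]_d, x = map_mx intr y].

Definition semidirect_weyl (L : set AA) : set (AA -> AA) :=
  [set phi | exists w t, [/\ weyl w, L t & phi = fun x => w *m x + t]].

Definition affine_weyl : set (AA -> AA) := semidirect_weyl coroot_lattice.

Definition halfspace (a : AAdual) (k : \bar R) : set AA :=
  [set x | (0 <= (evalf a x)%:E + k)%E].
Definition open_halfspace (a : AAdual) (k : \bar R) : set AA :=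
  [set x | (0 < (evalf a x)%:E + k)%E].
Definition hyperplane (a : AAdual) (k : R) : set AA :=
  [set x | evalf a x + k = 0].

Definition wall (H : set AA) : Prop :=
  exists a, exists k : int, real_root a /\ H = hyperplane a k%:~R.
Definition half_apartment (H : set AA) : Prop :=
  exists a, exists k : int, real_root a /\ H = halfspace a (k%:~R)%:E.

Definition wall_coroot (H : set AA) (av : AA) : Prop :=
  exists a, exists k : int,
    real_root_coroot a av /\ H = hyperplane a k%:~R.

Definition affine_aut : set (AA -> AA) :=
  [set phi | exists m t, [/\ m \in unitmx, phi = (fun x => m *m x + t)
    & forall H av, wall_coroot H av <-> wall_coroot (phi @` H) (m *m av)]].

Definition vectorially_weyl_aut : set (AA -> AA) :=
  semidirect_weyl setT `&` affine_aut.

(** ** Vectorial faces and the Tits cone *)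

(* A sign is a boolean, [false] for positive and [true] for negative. *)

Definition std_face (J : {set I}) : set AA :=
  [set v | (forall i, i \in J -> evalf (simple_root i) v = 0) /\
           (forall i, i \notin J -> 0 < evalf (simple_root i) v)].
Definition std_chamber : set AA :=
  [set v | forall i, 0 < evalf (simple_root i) v].

Definition signed_image (b : bool) (w : 'M[R]_d) (S : set AA) : set AA :=
  [set (-1) ^+ b *: (w *m v) | v in S].

Definition vect_face (Fv : set AA) : Prop :=
  exists b w J, weyl w /\ Fv = signed_image b w (std_face J).
Definition vect_chamber (b : bool) (Cv : set AA) : Prop :=
  exists w, weyl w /\ Cv = signed_image b w std_chamber.

Definition tits_cone : set AA :=
  [set x | exists w v, [/\ weyl w, closure std_chamber v & x = w *m v]].
Definition tits_int_pm : set AA :=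
  [set v | interior tits_cone v \/ interior tits_cone (- v)].

Definition spherical (Fv : set AA) : Prop := Fv `&` tits_int_pm !=set0.

Definition tits_le (x y : AA) : Prop := tits_cone (y - x).

Definition segment (x y : AA) : set AA :=
  [set x + t *: (y - x) | t in [set t : R | 0 <= t <= 1]].
Definition ray (x y : AA) : set AA :=
  [set x + t *: (y - x) | t in [set t : R | 0 <= t]].

(** ** Filters *)

Definition contains {U : Type} (Z : set U) (F : set_system U) : Prop :=
  exists2 E, F E & E `<=` Z.

Definition fixes {U : Type} (phi : U -> U) (F : set_system U) : Prop :=
  exists2 E, F E & forall x, E x -> phi x = x.

Definition filter_cup {U : Type} (F F' : set_system U) : set_system U :=
  [set E `|` E' | E in F & E' in F'].

Definition affine_subspace (S : set AA) : Prop :=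
  S !=set0 /\ forall x y (t : R), S x -> S y -> S (x + t *: (y - x)).

Definition is_support (F : set_system AA) (S : set AA) : Prop :=
  [/\ affine_subspace S, contains S F &
      forall S', affine_subspace S' -> contains S' F -> S `<=` S'].

Definition zinf : set (\bar R) :=
  [set k | k = +oo%E \/ exists z : int, k = (z%:~R)%:E].

Definition enclosure (F : set_system AA) : set_system AA :=
  [set E | exists k : AAdual -> \bar R,
    [/\ forall a, all_root a -> zinf (k a),
        F (\bigcap_(a in all_root) halfspace a (k a)) &
        \bigcap_(a in all_root) halfspace a (k a) `<=` E]].

Definition sum_set (E E' : set AA) : set AA :=
  [set x + y | x in E & y in E'].

Definition filter_sum (F : set_system AA) (S : set AA) : set_system AA :=
  [set E | exists2 E0, F E0 & sum_set E0 S `<=` E].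

Definition sector_face (x : AA) (Fv : set AA) : set AA := sum_set [set x] Fv.

Definition sector_face_germ (x : AA) (Fv : set AA) : set_system AA :=
  [set E | exists2 u, closure Fv u & sector_face (x + u) Fv `<=` E].

Definition sector_panel (P : set AA) : Prop :=
  exists x Fv H, [/\ vect_face Fv, P = sector_face x Fv, wall H
                   & is_support (globally P) H].

Definition face_at (x : AA) (Fv : set AA) : set_system AA :=
  [set E | exists k k' : AAdual -> \bar R, exists Omega : set AA,
    let B := \bigcap_(a in all_root)
               (halfspace a (k a) `&` open_halfspace a (k' a)) in
    [/\ forall a, all_root a -> zinf (k a) /\ zinf (k' a),
        nbhs x Omega, Omega `&` sector_face x Fv `<=` B & B `<=` E]].

Definition face (F : set_system AA) : Prop :=
  exists x Fv, vect_face Fv /\ F = face_at x Fv.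
Definition chamber (F : set_system AA) : Prop :=
  face F /\ is_support F setT.
Definition panel (F : set_system AA) : Prop :=
  face F /\ exists2 H, wall H & is_support F H.

Definition chimney (F : set_system AA) (Fv : set AA) : set_system AA :=
  enclosure (filter_sum F Fv).

Definition chimney_germ (F : set_system AA) (Fv : set AA) : set_system AA :=
  [set E | exists2 u, closure Fv u & chimney (filter_sum F [set u]) Fv E].

Definition solid (r : set_system AA) : Prop :=
  exists2 S, is_support r S & finite_set
    [set w | weyl w /\ forall x y, S x -> S y -> w *m (y - x) = y - x].

Definition solid_chimney (r : set_system AA) : Prop :=
  exists F Fv, [/\ face F, vect_face Fv, r = chimney F Fv & solid r].

Definition splayed_chimney_germ (r : set_system AA) : Prop :=
  exists F Fv, [/\ face F, vect_face Fv, spherical Fv & r = chimney_germ F Fv].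

Definition solid_chimney_germ (r : set_system AA) : Prop :=
  exists F Fv, [/\ face F, vect_face Fv, solid (chimney F Fv)
                 & r = chimney_germ F Fv].

(* [within S (nbhs x)] is the germ of S at x; an interval issued from x is
   either the segment [x, y] or the half-open interval ]x, y]. *)
Definition preordered_interval_germ (F : set_system AA) : Prop :=
  exists x y, [/\ x <> y, tits_le x y \/ tits_le y x &
    F = within (segment x y) (nbhs x) \/
    F = within (segment x y `\ x) (nbhs x)].

Definition generic_ray (r : set AA) : Prop :=
  exists x y, [/\ x <> y, tits_int_pm (y - x) & r = ray x y].

Definition ma2_filter (F : set_system AA) : Prop :=
  [\/ exists x, F = globally [set x], preordered_interval_germ F,
      exists2 r, generic_ray r & F = globally r | solid_chimney F].

End Model.

Set Implicit Arguments.

(** * Masures *)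

(* An element of Isom^w(A, S) is represented by an injective map into the
   ambient type T with range S. A filter on S is handled through the filter
   on T that it generates, and a map between two apartments is represented by
   a map T -> T whose values outside of the source are irrelevant. *)
Section Masure.
Context {R : realType} (V : vectorial_data R) (T : Type).

Local Notation AA := 'cV[R]_(vd_dim V).

Definition apartment_structure (A : set T) (S : set (AA -> T)) : Prop :=
  S !=set0 /\ forall f, S f ->
    [/\ injective f, range f = A & S = [set f \o w | w in affine_weyl V]].

Definition pull (f : AA -> T) (F : set_system T) : set_system AA :=
  [set E | F (f @` E)].

Definition encl_in (f : AA -> T) (F : set_system T) : set_system T :=
  fmap f (enclosure V (pull f F)).

Record premasure := Premasure {
  apt : set (set T);
  charts : set T -> set (AA -> T) }.

Section MasureTheory.
Variable M : premasure.

(* Such a map is automatically a bijection from A onto A'. *)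
Definition map_of_type (W : set (AA -> AA)) (A A' : set T) (phi : T -> T)
    : Prop :=
  forall f f', charts M A f -> charts M A' f' ->
    exists2 w, W w & forall x, phi (f x) = f' (w x).

Definition weyl_isomorphism := map_of_type (affine_weyl V).
Definition apt_isomorphism := map_of_type (vectorially_weyl_aut V).

Definition in_masure (P : set_system AA -> Prop) (F : set_system T) : Prop :=
  exists A f F0, [/\ apt M A, charts M A f, P F0 & F = fmap f F0].

Definition ma3_pair (Rg F : set_system T) : Prop :=
  in_masure (splayed_chimney_germ V) Rg /\
  (in_masure (face V) F \/ in_masure (solid_chimney_germ V) F).

Definition MA1 : Prop := forall A, apt M A -> apartment_structure A (charts M A).

(* In MA2 and MA4, [Phi] is the set of maps among which the isomorphism is to
   be found: all maps in the definition of a masure, the maps induced by the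
   group in that of a strongly transitive action. *)
Definition MA2 (Phi : set (T -> T)) : Prop :=
  forall A f F A', apt M A -> charts M A f -> ma2_filter V F -> apt M A' ->
    contains A' (fmap f F) ->
    contains (A `&` A') (encl_in f (fmap f F)) /\
    exists phi, [/\ Phi phi, weyl_isomorphism A A' phi
                  & fixes phi (encl_in f (fmap f F))].

Definition MA3 : Prop := forall Rg F, ma3_pair Rg F ->
  exists A, [/\ apt M A, contains A Rg & contains A F].

Definition MA4 (Phi : set (T -> T)) : Prop :=
  forall Rg F A A', ma3_pair Rg F -> apt M A -> apt M A' ->
    contains A Rg -> contains A F -> contains A' Rg -> contains A' F ->
    forall f, charts M A f ->
    exists phi, [/\ Phi phi, weyl_isomorphism A A' phi
                  & fixes phi (encl_in f (filter_cup Rg F))].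

Definition MAO : Prop := forall A A' f f' x y x' y',
  apt M A -> apt M A' -> charts M A f -> charts M A' f' ->
  f x = f' x' -> f y = f' y' -> tits_le V x y ->
  f @` segment V x y = f' @` segment V x' y'.

Definition is_masure : Prop :=
  [/\ \bigcup_(A in apt M) A = setT, MA1, MA2 setT, MA3 & MA4 setT /\ MAO].

(* The closure of a filter is generated by the closures of its elements, and
   is computed in an apartment containing the chamber. *)
Definition in_closure_of_chamber (P C : set_system T) : Prop :=
  exists A f C0, [/\ apt M A, charts M A f, chamber V C0, C = fmap f C0
    & forall E, C0 E -> contains (f @` closure E) P].

Definition thick_finite : Prop := forall P, in_masure (panel V) P ->
  exists2 n, (2 < n)%N & ([set C | in_closure_of_chamber P C] #= `I_n)%card.

Definition strongly_transitive (G : groupType) (act : G -> T -> T) : Prop :=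
  [/\ forall x, act 1%g x = x,
      forall g h x, act (g * h)%g x = act g (act h x),
      forall g A, apt M A -> apt M (act g @` A),
      forall g A, apt M A -> apt_isomorphism A (act g @` A) (act g)
    & MA2 (range act) /\ MA4 (range act)].

Definition induced_on (G : groupType) (act : G -> T -> T) (A : set T)
    (f : AA -> T) : set (AA -> AA) :=
  [set phi | exists2 g, act g @` A = A & forall x, act g (f x) = f (phi x)].

(** ** Sector-germs *)

Definition sector_germ_of (A : set T) (b : bool) (s : set_system T) : Prop :=
  exists f x Cv, [/\ charts M A f, vect_chamber V b Cv
                   & s = fmap f (sector_face_germ V x Cv)].

Definition sector_germ (b : bool) (s : set_system T) : Prop :=
  exists2 A, apt M A & sector_germ_of A b s.

Definition adjacent (A : set T) (b : bool) (s s' : set_system T) : Prop :=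
  exists f x x' Cv Cv',
    [/\ charts M A f, vect_chamber V b Cv /\ vect_chamber V b Cv',
        s = fmap f (sector_face_germ V x Cv),
        s' = fmap f (sector_face_germ V x' Cv')
      & exists2 P, sector_panel V P & P `<=` closure Cv `&` closure Cv'].

Definition gallery (A : set T) (b : bool) (m : nat) (s s' : set_system T)
    : Prop :=
  exists q : nat -> set_system T,
    [/\ q 0%N = s, q m = s',
        forall j, (j <= m)%N -> sector_germ_of A b (q j)
      & forall j, (j < m)%N -> adjacent A b (q j) (q j.+1)].

(* [germ_dist b s s' m] means d(s, s') = m, for s and s' of sign b. *)
Definition germ_dist (b : bool) (s s' : set_system T) (m : nat) : Prop :=
  exists A, [/\ apt M A, sector_germ_of A b s, sector_germ_of A b s'
              & least [set m | gallery A b m s s'] m].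

(* [apt_dist b s A n] means d_s(A) = n, for s of sign b. *)
Definition apt_dist (b : bool) (s : set_system T) (A : set T) (n : nat) : Prop :=
  least [set m | exists2 s', sector_germ_of A b s' & germ_dist b s s' m] n.

Definition half_apartment_of (A : set T) (D : set T) : Prop :=
  exists f H, [/\ charts M A f, half_apartment V H & D = f @` H].

Definition half_apartment_inter (A : set T) (n : nat) : set (set T) :=
  if n is 0%N then [set A] else
  [set P | exists D : 'I_n -> set T,
    (forall i, half_apartment_of A (D i)) /\ P = \bigcap_i D i].

End MasureTheory.
End Masure.

(* Main.v *)
Require Import Defs.
From mathcomp Require Import all_boot all_order all_algebra.
From mathcomp Require Import boolp classical_sets functions cardinality filter.
From mathcomp Require Import reals ereal topology normedtype.
From mathcomp Require Import complex ring lra zify.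

(* Induction on the distance n. On a minimal gallery from s to a sector-germ s'
   of A, the last sector-germ t before s' is adjacent to s' and not contained
   in A, so it suffices to write A as the union of two half-apartments, each of
   which lies in an apartment containing t.

   Let E be an apartment containing t and s'. In suitable charts e of E and f of
   A, s' is the germ of C = {a_j > 0 for all j}, t is the germ of r_i C, and e = f
   on a sector. The strips k <= a_i <= k + 1 in the direction of the i-th facet
   of C are solid and splayed chimneys, so A behaves, in that direction, as a line
   in a tree with levels a_i; it leaves E at a least level k, and the two
   half-apartments are {a_i >= k} and {a_i <= k}. To put one of them in an
   apartment with t, one moves from level k towards t along E, one strip at a
   time: (MA3) gives an apartment containing the next strip and the germ of the
   sector of A opposite to C (resp. r_i C), and (MA4) identifies it with the
   previous apartment on the half-space already reached; the only other
   possibility, a reflection along the wall just reached, would fold E.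

   Two facts on the vectorial data enter: an element of the Weyl group fixing a
   facet of the fundamental chamber pointwise is 1 or r_i (Tits), and the roots of
   the Kac-Moody algebra have coefficients of constant sign, the only ones
   proportional to alpha_i being alpha_i and - alpha_i, so that the enclosure of
   a facet-directed chamber is the full strip. *)

Set Implicit Arguments.
Unset Strict Implicit.
Unset Printing Implicit Defensive.

Import Order.TTheory GRing.Theory Num.Theory.
Import numFieldNormedType.Exports.

Local Open Scope classical_set_scope.
Local Open Scope ring_scope.

(** * Linear forms and dual bases *)

(** Counting: an apartment N containing t satisfies d_s(N) < d_s(A), and an isomorphism from N to A
    that fixes their common half-apartment D carries half-apartments to half-apartments. A piece P
    of N thus yields the piece D [&] P of A, at the cost of one more half-apartment, and the two
    choices of D double the number of pieces; hence [2 ^ n]. The distance may drop by more than one,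
    so the induction is strong and missing half-apartments are filled by repeating D.

    The obstacle is rigidity. (MA4) provides a chart that agrees with a given one only on an
    enclosure, and two charts of one apartment differ by an element of W^a. Fixing a strip at
    infinity forces this element to be 1, but fixing a wall at infinity still allows a reflection,
    so each gluing along a wall must decide between the two.

    The two halves are not symmetric. The upper half starts from A itself, which agrees with E above
    the level k. For the lower half A has already left E, and the reflection does occur: the path
    towards t follows E reflected in the wall of level k. *)

Section LinearForms.
Context {R : realType} (V : vectorial_data R).
Local Notation AA := 'cV[R]_(vd_dim V).
Implicit Types (a : 'rV[R]_(vd_dim V)) (x y : AA).

Lemma evalfD a x y : evalf V a (x + y) = evalf V a x + evalf V a y.
Proof. by rewrite /evalf mulmxDr mxE. Qed.

Lemma evalfN a x : evalf V a (- x) = - evalf V a x.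
Proof. by rewrite /evalf mulmxN mxE. Qed.

Lemma evalfB a x y : evalf V a (x - y) = evalf V a x - evalf V a y.
Proof. by rewrite evalfD evalfN. Qed.

Lemma evalfZ a c x : evalf V a (c *: x) = c * evalf V a x.
Proof. by rewrite /evalf -scalemxAr mxE. Qed.

Lemma evalf0 a : evalf V a 0 = 0.
Proof. by rewrite /evalf mulmx0 mxE. Qed.

Lemma evalf_sum a (J : Type) (s : seq J) (P : pred J) (F : J -> AA) :
  evalf V a (\sum_(j <- s | P j) F j) = \sum_(j <- s | P j) evalf V a (F j).
Proof. by elim/big_rec2: _ => [|j y x _ <-]; rewrite ?evalf0 ?evalfD. Qed.

Lemma evalfDl a b x : evalf V (a + b) x = evalf V a x + evalf V b x.
Proof. by rewrite /evalf mulmxDl mxE. Qed.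

Lemma evalfNl a x : evalf V (- a) x = - evalf V a x.
Proof. by rewrite /evalf mulNmx mxE. Qed.

Lemma evalfZl a c x : evalf V (c *: a) x = c * evalf V a x.
Proof. by rewrite /evalf -scalemxAl mxE. Qed.

Lemma evalf0l x : evalf V 0 x = 0.
Proof. by rewrite /evalf mul0mx mxE. Qed.

Lemma evalf_suml (J : Type) (s : seq J) (P : pred J) F x :
  evalf V (\sum_(j <- s | P j) F j) x = \sum_(j <- s | P j) evalf V (F j) x.
Proof. by elim/big_rec2: _ => [|j y z _ <-]; rewrite ?evalf0l ?evalfDl. Qed.

Lemma evalf_mul a (m : 'M[R]_(vd_dim V)) x : evalf V a (m *m x) = evalf V (a *m m) x.
Proof. by rewrite /evalf mulmxA. Qed.

Lemma evalf_continuous a : continuous (evalf V a).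
Proof.
have -> : evalf V a = (fun x : AA => \sum_j a 0 j * x j 0).
  by apply/funext => x; rewrite /evalf mxE.
move=> x; have addc : continuous (fun z : R * R => z.1 + z.2) by exact: (@add_continuous R^o).
apply: (@cvg_big R^o _ +%R 0 xpredT addc AA (nbhs x) (index_enum 'I_(vd_dim V))
  (fun j (y : AA) => a 0 j * y j 0) (fun j => a 0 j * x j 0) (nbhs_filter x)) => j _.
by apply: cvgMl_tmp; exact: (@coord_continuous R).
Qed.

End LinearForms.

Section IntegralVectors.

Lemma clear_denominators (r : nat) (u : 'rV[rat]_r) :
  exists2 m : int, m != 0 & exists n : 'I_r -> int, forall j, m%:~R * u 0 j = (n j)%:~R.
Proof.
exists (\prod_j denq (u 0 j)).
  by rewrite prodf_seq_neq0; apply/allP => j _; exact/implyP/(fun _ => denq_neq0 _).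
exists (fun j => \prod_(k | k != j) denq (u 0 k) * numq (u 0 j)) => j.
by rewrite (bigD1 j) //= !rmorphM /= numqE; ring.
Qed.

(** Freeness is given over the integers, and denominators can be cleared in rational relations but
    not in real ones. So independence is first proved over the rationals, and the rational right
    inverse is mapped to the reals afterwards. *)
Lemma int_free_rat (r d : nat) (A : 'M[int]_(r, d)) :
  (forall n : 'rV[int]_r, n *m A = 0 -> n = 0) ->
  row_free (map_mx intr A : 'M[rat]_(r, d)).
Proof.
move=> freeA; rewrite -kermx_eq0; apply/eqP/row_matrixP => i; rewrite row0.
set u := row i _; have [m m0 [n nE]] := clear_denominators u.
have nu : map_mx intr (\row_j n j) = m%:~R *: u :> 'rV[rat]_r.
  by apply/rowP => j; rewrite !mxE -nE /u !mxE.
have uA : u *m map_mx intr A = 0 by rewrite /u -row_mul mulmx_ker row0.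
have n0 : \row_j n j = 0 :> 'rV[int]_r.
  have : map_mx intr ((\row_j n j) *m A) = 0 :> 'rV[rat]_d.
    by rewrite map_mxM nu -scalemxAl uA scaler0.
  move=> nA; apply: freeA; apply/rowP => j; move/rowP/(_ j): nA.
  by rewrite !mxE => /eqP; rewrite intr_eq0 => /eqP.
move: nu; rewrite n0 map_mx0 => /esym/eqP.
by rewrite scaler_eq0 intr_eq0 (negPf m0) => /eqP.
Qed.

End IntegralVectors.

Section DualBasis.
Context {R : realType} (V : vectorial_data R).
Local Notation I := (vd_index V).
Local Notation AA := 'cV[R]_(vd_dim V).

Lemma dual_basis_ex : exists om : I -> AA,
  forall i j, evalf V (simple_root V j) (om i) = (i == j)%:R.
Proof.
pose A : 'M[int]_(#|I|, vd_dim V) := \matrix_(k < #|I|) vd_root V (enum_val k).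
have /row_freeP[B AB] : row_free (map_mx intr A : 'M[rat]_(_, _)).
  apply: int_free_rat => n nA; apply/rowP => k; rewrite mxE.
  have := @vd_root_free _ V (fun i => n 0 (enum_rank i)).
  move=> /(_ _ (enum_val k)); rewrite enum_valK; apply.
  move: nA; rewrite mulmx_sum_row => nA; rewrite -[RHS]nA.
  rewrite (reindex (@enum_val I I)) /=; last first.
    by apply: onW_bij; exact: enum_val_bij.
  by apply: eq_bigr => k' _; rewrite enum_valK rowK.
exists (fun i => col (enum_rank i) (map_mx ratr B)) => i j.
have AB' : map_mx intr A *m map_mx ratr B = 1%:M :> 'M[R]_#|I|.
  rewrite -[RHS](map_mx1 (ratr : rat -> R)) -AB map_mxM; congr (_ *m _).
  apply/matrixP => k l; rewrite !mxE; apply/esym.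
  exact: (ratr_int R).
have -> : evalf V (simple_root V j) (col (enum_rank i) (map_mx ratr B))
   = (map_mx intr A *m map_mx ratr B : 'M[R]_#|I|) (enum_rank j) (enum_rank i).
  rewrite /evalf !mxE; apply: eq_bigr => k _.
  by rewrite !mxE enum_rankK.
by rewrite AB' mxE eq_sym (inj_eq enum_rank_inj).
Qed.

(** Fundamental coweights. They are unique only when the simple roots span the dual of [AA]; all
    later arguments depend only on their pairings with the simple roots. *)
Definition fund (i : I) : AA := projT1 (cid dual_basis_ex) i.

Lemma fundE i j : evalf V (simple_root V j) (fund i) = (i == j)%:R.
Proof. exact: (projT2 (cid dual_basis_ex)). Qed.

Lemma evalf_fund (n : I -> R) i :
  evalf V (\sum_j n j *: simple_root V j) (fund i) = n i.
Proof.
rewrite evalf_suml (bigD1 i) //= evalfZl fundE eqxx mulr1 big1 ?addr0// => j ji.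
by rewrite evalfZl fundE eq_sym (negPf ji) mulr0.
Qed.

Lemma simple_root_fund (t : I -> R) j :
  evalf V (simple_root V j) (\sum_i t i *: fund i) = t j.
Proof.
rewrite evalf_sum (bigD1 j) //= evalfZ fundE eqxx mulr1 big1 ?addr0// => i ij.
by rewrite evalfZ fundE (negPf ij) mulr0.
Qed.

Lemma simple_root_coroot i j :
  evalf V (simple_root V j) (simple_coroot V i) = (vd_cartan (v := V) i j)%:~R.
Proof. by rewrite /evalf /simple_root /simple_coroot -map_mxM mxE vd_pairing. Qed.

End DualBasis.

(** * Roots of Kac-Moody algebras *)

Section LieSpan.
Context {K : fieldType} (g : lie_algebra K).
Implicit Types (x y z : g) (P Q : g -> Prop).
Local Notation "[ x , y ]L" := (lie_bracket x y) (at level 0).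

Lemma lieDl x y z : [x + y, z]L = [x, z]L + [y, z]L.
Proof. by have := lie_linearl 1 x y z; rewrite !scale1r. Qed.

Lemma lieDr x y z : [z, x + y]L = [z, x]L + [z, y]L.
Proof. by have := lie_linearr 1 x y z; rewrite !scale1r. Qed.

Lemma lie0l z : [0, z]L = 0.
Proof. by apply: (addrI [0, z]L); rewrite -lieDl !addr0. Qed.

Lemma lie0r z : [z, 0]L = 0.
Proof. by apply: (addrI [z, 0]L); rewrite -lieDr !addr0. Qed.

Lemma lieZl a x z : [a *: x, z]L = a *: [x, z]L.
Proof. by have := lie_linearl a x 0 z; rewrite addr0 lie0l addr0. Qed.

Lemma lieZr a x z : [z, a *: x]L = a *: [z, x]L.
Proof. by have := lie_linearr a x 0 z; rewrite addr0 lie0r addr0. Qed.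

Lemma lieC x y : [x, y]L = - [y, x]L.
Proof.
apply/eqP; rewrite -addr_eq0; have := lie_alt (x + y).
by rewrite lieDl !lieDr !lie_alt add0r addr0 => ->.
Qed.

Lemma lie_derivation x y z : [x, [y, z]L]L = [[x, y]L, z]L + [y, [x, z]L]L.
Proof.
have /eqP := lie_jacobi x y z; rewrite -addrA addr_eq0 => /eqP ->.
by rewrite opprD addrC -lieC (lieC z x) -[- [x, z]L]scaleN1r lieZr scaleN1r opprK.
Qed.

Inductive lie_span P : g -> Prop :=
  | lie_span0 : lie_span P 0
  | lie_spanS a x y : P x -> lie_span P y -> lie_span P (a *: x + y).

Lemma lie_span_in P x : P x -> lie_span P x.
Proof.
by move=> Px; rewrite -[x]addr0 -[x]scale1r; apply: lie_spanS => //; exact: lie_span0.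
Qed.

Lemma lie_span_lin P a x y : lie_span P x -> lie_span P y -> lie_span P (a *: x + y).
Proof.
move=> + Py; elim=> [|b z t Pz _ IH]; first by rewrite scaler0 add0r.
by rewrite scalerDr scalerA -addrA; apply: lie_spanS.
Qed.

Lemma lie_span_scale P a x : lie_span P x -> lie_span P (a *: x).
Proof. by move=> Px; rewrite -[_ *: x]addr0; apply: lie_span_lin => //; exact: lie_span0. Qed.

Lemma lie_span_add P x y : lie_span P x -> lie_span P y -> lie_span P (x + y).
Proof. by move=> Px Py; rewrite -[x]scale1r; exact: lie_span_lin. Qed.

Lemma lie_span_bracket P Q x y : (forall z, P z -> lie_span Q [x, z]L) ->
  lie_span P y -> lie_span Q [x, y]L.
Proof.
move=> PQ; elim=> [|a z t Pz _ IH]; first by rewrite lie0r; exact: lie_span0.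
by rewrite lie_linearr; apply: lie_span_lin => //; exact: PQ.
Qed.

Lemma lie_span_sub P Q x : (forall z, P z -> Q z) -> lie_span P x -> lie_span Q x.
Proof.
move=> PQ; elim=> [|a z t Pz _ IH]; first exact: lie_span0.
by apply: lie_spanS => //; exact: PQ.
Qed.

Section Monomials.
Variables (I : finType) (p : nat) (h : 'cV[K]_p -> g) (al : I -> 'rV[K]_p).

Definition weight_vector (n : I -> int) x : Prop :=
  forall v, [h v, x]L = (\sum_i (n i)%:~R * (al i *m v) 0 0) *: x.

(** Iterated brackets [e_i, [e_j, ...]] recorded with their weight. The integer [s] will be 1 for
    the generators e_i and -1 for the f_i, so that both nilpotent halves are treated at once. *)
Inductive monomial (e : I -> g) (s : int) : (I -> int) -> g -> Prop :=
  | monomial_gen i : monomial e s (fun j => s * (j == i)%:R) (e i)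
  | monomial_bracket i n x : monomial e s n x ->
      monomial e s (fun j => n j + s * (j == i)%:R) [e i, x]L.

Lemma monomial_weight e (s : int) n x :
  (forall v i, [h v, e i]L = (s%:~R * (al i *m v) 0 0) *: e i) ->
  monomial e s n x -> weight_vector n x.
Proof.
move=> he; have sumE i (v : 'cV_p) : \sum_j (s * (j == i)%:R)%:~R * (al j *m v) 0 0
    = s%:~R * (al i *m v) 0 0 :> K.
  rewrite (bigD1 i) //= eqxx mulr1 big1 ?addr0// => j /negPf->.
  by rewrite mulr0 mul0r.
elim=> [i|i m y my IHm] v; first by rewrite sumE he.
rewrite lie_derivation he lieZl IHm lieZr -scalerDl; congr (_ *: _).
rewrite -(sumE i v) -big_split; apply: eq_bigr => j _ /=.
by rewrite intrD mulrDl addrC.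
Qed.

(** A monomial of length at least two whose weight is a multiple of alpha_i uses only the letter i,
    and vanishes because its innermost bracket is [e_i, e_i] = 0. *)
Lemma monomial_sign e (s : int) n x : s * s = 1 -> monomial e s n x ->
  (forall j, 0 <= s * n j) /\
  forall i, (forall j, j != i -> n j = 0) -> n i = s /\ x = e i \/ x = 0.
Proof.
move=> ss; have s0 : s != 0 by apply: contra_eq_neq ss => ->.
elim=> [k|k m y _ [m0 mi]].
  split=> [j|i supp]; first by rewrite mulrA ss mul1r ler0n.
  have [ki|ki] := altP (k =P i); first by left; rewrite ki eqxx mulr1.
  by have /eqP := supp _ ki; rewrite /= eqxx mulr1 (negPf s0).
split=> [j|i supp]; first by rewrite mulrDr mulrA ss mul1r addr_ge0 ?ler0n.
right; have [ki|ki] := altP (k =P i); last first.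
  have := congr1 (GRing.mul s) (supp _ ki); rewrite /= mulr0 eqxx mulr1 mulrDr ss => /eqP.
  by rewrite gt_eqF // ltr_wpDl.
have supp' j : j != i -> m j = 0.
  by move=> ji; have := supp j ji; rewrite /= ki (negPf ji) mulr0 addr0.
by case: (mi i supp') => [[_ ->]|->]; rewrite ?lie0r// ki lie_alt.
Qed.

Definition monomial_or_torus (e : I -> g) (s : int) x : Prop :=
  (exists n, monomial e s n x) \/ exists v, x = h v.

(** ad e_k is a derivation: it moves past a letter f_i at the price of a torus element, which acts
    on the rest of the monomial by a scalar. The torus itself appears when e_k meets the last
    letter. *)
Lemma opposite_bracket (e f : I -> g) (s : int) k y :
  (forall v i, [h v, f i]L = (s%:~R * (al i *m v) 0 0) *: f i) ->
  (forall i j, exists2 v, [e i, f j]L = h v & True) ->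
  (exists n, monomial f s n y) -> lie_span (monomial_or_torus f s) [e k, y]L.
Proof.
move=> hf ef [n]; elim=> [i|i m z mz IHz].
  by have [v -> _] := ef k i; apply: lie_span_in; right; exists v.
rewrite lie_derivation; apply: lie_span_add.
  have [v -> _] := ef k i; rewrite (monomial_weight hf mz).
  by apply/lie_span_scale/lie_span_in; left; exists m.
apply: lie_span_bracket IHz => t [[n' nt]|[v ->]].
  by apply: lie_span_in; left; eexists; apply: monomial_bracket nt.
rewrite lieC hf -scaleNr; apply/lie_span_scale/lie_span_in; left.
by eexists; exact: monomial_gen.
Qed.

Lemma weight_vector_sum (n : I -> int) (l : seq g) :
  (forall y, y \in l -> exists2 m, weight_vector m y &
    exists v : 'cV[K]_p,
      \sum_i (m i)%:~R * (al i *m v) 0 0 <> \sum_i (n i)%:~R * (al i *m v) 0 0) ->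
  weight_vector n (\sum_(y <- l) y) -> \sum_(y <- l) y = 0.
Proof.
move: {2}(size l) (leqnn (size l)) => k; elim: k l => [|k IHk] [|y l] //=;
  rewrite ?big_nil// ltnS => lk wl wn.
have [m wy [v mn]] := wl y (mem_head _ _).
pose mv := \sum_i (m i)%:~R * (al i *m v) 0 0.
pose nv := \sum_i (n i)%:~R * (al i *m v) 0 0.
(* The operator ad (h v) - mv kills the head [y] and preserves the other weights, so induction
   applies to the shorter list; on the whole sum it is multiplication by nv - mv, which is
   nonzero. *)
pose l' := [seq [h v, z]L - mv *: z | z <- l].
have El : \sum_(z <- l') z = (nv - mv) *: \sum_(z <- y :: l) z.
  rewrite scalerBl -wn big_cons lieDr scalerDr wy -/mv opprD addrACA subrr add0r.
  rewrite /l' big_map sumrB scaler_sumr; congr (_ - _).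
  by elim: (l) => [|z s IHs]; rewrite ?big_nil ?lie0r// !big_cons lieDr IHs.
have : \sum_(z <- l') z = 0.
  apply: IHk; first by rewrite size_map.
    move=> _ /mapP[z zl ->]; have [|mz wz [u uz]] := wl z.
      by rewrite inE zl orbT.
    exists mz; last by exists u.
    by move=> t; rewrite wz -scalerBl lieZr wz scalerA mulrC -scalerA.
  by move=> t; rewrite El lieZr wn scalerA mulrC -scalerA.
rewrite El => /eqP; rewrite scaler_eq0 => /orP[|/eqP//].
by rewrite subr_eq0 => /eqP nm; case: mn.
Qed.

End Monomials.
End LieSpan.

(** * Triangular decomposition and signs of roots *)

Section KacMoodyRoots.
Context {K : fieldType} {I : finType} (c : I -> I -> int) (g : kac_moody_algebra K c).
Hypothesis charK : forall m : int, (m%:~R == 0 :> K) = (m == 0).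
Local Notation "[ x , y ]L" := (lie_bracket x y) (at level 0).
Local Notation h := (km_cartan g).
Local Notation wt := (weight_vector h (km_root g)).
Local Notation posm := (monomial (@km_e _ _ _ g) 1).
Local Notation negm := (monomial (@km_f _ _ _ g) (-1)).

Definition triangular_part (x : g) : Prop :=
  [\/ exists n, posm n x, exists n, negm n x | exists v, x = h v].

Lemma km_he_sign v i : [h v, km_e g i]L = ((1 : int)%:~R * (km_root g i *m v) 0 0) *: km_e g i.
Proof. by rewrite mul1r km_he. Qed.

Lemma km_hf_sign v i : [h v, km_f g i]L = ((-1 : int)%:~R * (km_root g i *m v) 0 0) *: km_f g i.
Proof. by rewrite mulN1r scaleNr km_hf. Qed.

Lemma triangular_bracket_e k y : lie_span triangular_part y ->
  lie_span triangular_part [km_e g k, y]L.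
Proof.
apply: lie_span_bracket => z [[n mz]|mz|[v ->]].
- by apply: lie_span_in; apply: Or31; eexists; apply: monomial_bracket mz.
- have ef i j : exists2 v, [km_e g i, km_f g j]L = h v & True.
    by rewrite km_ef; case: eqP => _; [exists (km_coroot g i)|exists 0; rewrite ?linear0].
  apply: lie_span_sub (opposite_bracket (h := h) (al := km_root g) k km_hf_sign ef mz).
  by move=> t [?|?]; [apply: Or32|apply: Or33].
- rewrite lieC km_he -scaleNr; apply/lie_span_scale/lie_span_in/Or31.
  by eexists; exact: monomial_gen.
Qed.

Lemma triangular_bracket_f k y : lie_span triangular_part y ->
  lie_span triangular_part [km_f g k, y]L.
Proof.
apply: lie_span_bracket => z [mz|[n mz]|[v ->]].
- have fe i j : exists2 v, [km_f g i, km_e g j]L = h v & True.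
    rewrite lieC km_ef; case: eqP => _; last by exists 0; rewrite ?oppr0 ?linear0.
    by exists (- km_coroot g j); rewrite ?linearN.
  apply: lie_span_sub (opposite_bracket (h := h) (al := km_root g) k km_he_sign fe mz).
  by move=> t [?|?]; [apply: Or31|apply: Or33].
- by apply: lie_span_in; apply: Or32; eexists; apply: monomial_bracket mz.
- rewrite lieC km_hf opprK; apply/lie_span_scale/lie_span_in/Or32.
  by eexists; exact: monomial_gen.
Qed.

Lemma triangular_bracket_h v y : lie_span triangular_part y ->
  lie_span triangular_part [h v, y]L.
Proof.
apply: lie_span_bracket => z [[n mz]|[n mz]|[u ->]].
- rewrite (monomial_weight km_he_sign mz).
  by apply/lie_span_scale/lie_span_in/Or31; exists n.
- rewrite (monomial_weight km_hf_sign mz).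
  by apply/lie_span_scale/lie_span_in/Or32; exists n.
- by rewrite km_hh; exact: lie_span0.
Qed.

(** By the Jacobi identity, the elements whose bracket maps the span into itself form a subalgebra;
    it contains the generators, hence is everything. So the span is a subalgebra, and it contains
    the generators too. *)
Lemma triangular_decomposition (x : g) : lie_span triangular_part x.
Proof.
have span_sub : lie_subspace (lie_span triangular_part).
  by split=> [|a y z]; [exact: lie_span0|exact: lie_span_lin].
have normal : [set y : g | forall z, lie_span triangular_part z ->
    lie_span triangular_part [y, z]L] = setT.
  apply: km_generated.
  - split; first split=> [|a y z /= Sy Sz t St].
    + by move=> z _; rewrite lie0l; exact: lie_span0.
    + by rewrite lie_linearl; apply: lie_span_lin; [exact: Sy|exact: Sz].
    + move=> y z /= Sy Sz t St.
      have -> : [[y, z]L, t]L = (-1) *: [z, [y, t]L]L + [y, [z, t]L]L.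
        by rewrite (lie_derivation y z t) scaleN1r addrC addrK.
      by apply: lie_span_lin; [apply/Sz/Sy|apply/Sy/Sz].
  - by move=> v z; exact: triangular_bracket_h.
  - by move=> k z; exact: triangular_bracket_e.
  - by move=> k z; exact: triangular_bracket_f.
suff -> : lie_span triangular_part = setT by [].
apply: km_generated.
- split=> // y z Sy Sz.
  by have : [set y : g | forall z, lie_span triangular_part z ->
    lie_span triangular_part [y, z]L] y by [rewrite normal]; exact.
- by move=> v; apply/lie_span_in/Or33; exists v.
- by move=> i; apply/lie_span_in/Or31; eexists; exact: monomial_gen.
- by move=> i; apply/lie_span_in/Or32; eexists; exact: monomial_gen.
Qed.

Lemma km_weight_inj (m n : I -> int) :
  (forall v : 'cV[K]_(km_dim g),
    \sum_i (m i)%:~R * (km_root g i *m v) 0 0 =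
    \sum_i (n i)%:~R * (km_root g i *m v) 0 0 :> K) ->
  m =1 n.
Proof.
move=> mn i; apply/eqP; rewrite -subr_eq0 -charK; apply/eqP.
apply: (km_root_free (k := g) (n := fun i => (m i - n i)%:~R)).
apply/rowP => j; have := mn (delta_mx j 0); rewrite !mxE summxE => /eqP.
rewrite -subr_eq0 -sumrB => /eqP E; rewrite -[RHS]E; apply: eq_bigr => k _.
by rewrite -colE !mxE intrB mulrBl.
Qed.

(** A root vector is a sum of monomials and torus elements, all of them weight vectors. If none of
    the nonzero terms had weight n, the root vector would vanish by [weight_vector_sum]; so n is the
    weight of a nonzero monomial and inherits its sign. *)
Lemma km_root_sign (n : I -> int) : km_roots g n ->
  exists2 s : int, s = 1 \/ s = -1 &
    (forall j, 0 <= s * n j) /\ forall i, (forall j, j != i -> n j = 0) -> n i = s.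
Proof.
move=> [[i0 ni0] [x x0 wx]]; apply: contrapT => bad.
move/eqP: x0; apply.
have [l [xl wl]] : exists l : seq g, x = \sum_(y <- l) y /\
    forall y, y \in l -> exists2 m, wt m y & exists v : 'cV[K]_(km_dim g),
    \sum_i (m i)%:~R * (km_root g i *m v) 0 0 <> \sum_i (n i)%:~R * (km_root g i *m v) 0 0 :> K.
  elim: (triangular_decomposition x) => [|a y z ty _ [l [-> wl]]].
    by exists [::]; rewrite big_nil.
  have [->|y0] := eqVneq y 0; first by exists l; rewrite scaler0 add0r.
  exists (a *: y :: l); rewrite big_cons; split=> // t.
  rewrite inE => /orP[/eqP->|]; last exact: wl.
  have wtZ m : wt m y -> wt m (a *: y).
    by move=> wm v; rewrite lieZr wm scalerA mulrC -scalerA.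
  have sep m : ~ m =1 n -> exists v : 'cV[K]_(km_dim g),
      \sum_i (m i)%:~R * (km_root g i *m v) 0 0 <>
      \sum_i (n i)%:~R * (km_root g i *m v) 0 0 :> K.
    by move=> mn; apply/existsNP => E; apply/mn/km_weight_inj.
  have signed (e : I -> g) s m : s = 1 \/ s = -1 -> monomial e s m y -> ~ m =1 n.
    move=> s1 my mn; apply: bad; exists s => //.
    have ss : s * s = 1 by case: s1 => ->.
    have [m0 mi] := monomial_sign ss my.
    split=> [j|i supp]; first by rewrite -mn.
    have [|[<- _]|y00] := mi i; last by rewrite y00 eqxx in y0.
      by move=> j /supp; rewrite mn.
    by rewrite mn.
  case: ty => [[m my]|[m my]|[v yv]].
  - exists m; first exact/wtZ/(monomial_weight km_he_sign my).
    by apply/sep/(signed _ _ _ _ my); left.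
  - exists m; first exact/wtZ/(monomial_weight km_hf_sign my).
    by apply/sep/(signed _ _ _ _ my); right.
  (* Torus elements have weight 0, which differs from [n] at [i0]. *)
  - exists (fun=> 0).
      apply: wtZ => u; rewrite yv km_hh big1 ?scale0r// => i _.
      by rewrite mul0r.
    by apply: sep => /(_ i0) E; rewrite -E eqxx in ni0.
by rewrite xl; apply: weight_vector_sum wl _ => v; rewrite -xl wx.
Qed.

Lemma km_simple_root s i : s = 1 \/ s = -1 -> km_roots g (fun j => s * (j == i)%:R).
Proof.
move=> s1; split.
  by exists i; rewrite eqxx mulr1; case: s1 => ->.
have co0 : km_coroot g i != 0.
  apply/eqP => coi0; have := km_coroot_free (k := g) (n := fun j => (j == i)%:R).
  rewrite (bigD1 i) //= big1 => [|j /negPf->]; last by rewrite scale0r.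
  rewrite coi0 scaler0 addr0 => /(_ erefl i) /eqP.
  by rewrite eqxx oner_eq0.
have ef0 : [km_e g i, km_f g i]L != 0.
  rewrite km_ef eqxx; apply: contra co0 => /eqP hi.
  by apply/eqP/(km_cartan_inj (k := g)); rewrite hi linear0.
case: s1 => ->; [exists (km_e g i)|exists (km_f g i)].
- by apply: contra ef0 => /eqP->; rewrite lie0l.
- exact: (monomial_weight km_he_sign (monomial_gen _ _ _)).
- by apply: contra ef0 => /eqP->; rewrite lie0r.
- exact: (monomial_weight km_hf_sign (monomial_gen _ _ _)).
Qed.

End KacMoodyRoots.

(** * The Weyl group *)

Section CoxeterWords.
Context {R : realType} (V : vectorial_data R).
Local Notation I := (vd_index V).
Local Notation AA := 'cV[R]_(vd_dim V).
Local Notation ro := (simple_root V).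
Local Notation co := (simple_coroot V).
Local Notation r := (simple_refl V).
Local Notation c := (vd_cartan (v := V)).

Lemma root_refl i j : ro j *m r i = ro j - (c i j)%:~R *: ro i.
Proof.
rewrite /simple_refl mulmxBr mulmx1 mulmxA; congr (_ - _).
by rewrite [ro j *m co i]mx11_scalar mul_scalar_mx -[_ 0 0]/(evalf V _ _) simple_root_coroot.
Qed.

Lemma cartan_diag i : c i i = 2.
Proof. by case: (vd_cartanP V). Qed.

Lemma cartan_le0 i j : i != j -> c i j <= 0.
Proof. by case: (vd_cartanP V) => _ h _; exact: h. Qed.

Lemma root_refl_self i : ro i *m r i = - ro i.
Proof. by rewrite root_refl cartan_diag scaler_nat mulr2n opprD addrA subrr sub0r. Qed.

Lemma refl_mul_self i : r i *m r i = 1%:M.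
Proof.
rewrite {1}/simple_refl mulmxBl mul1mx -mulmxA root_refl_self mulmxN opprK.
by rewrite /simple_refl subrK.
Qed.

Lemma refl_unit i : r i \in unitmx.
Proof. by have [] := mulmx1_unit (refl_mul_self i). Qed.

Lemma invmx_refl i : invmx (r i) = r i.
Proof. by rewrite -[RHS](mulKmx (refl_unit i)) refl_mul_self mulmx1. Qed.

Lemma evalf_refl i j (x : AA) :
  evalf V (ro j) (r i *m x) = evalf V (ro j) x - (c i j)%:~R * evalf V (ro i) x.
Proof. by rewrite evalf_mul root_refl evalfDl evalfNl evalfZl. Qed.

Lemma refl_mul i (x : AA) : r i *m x = x - evalf V (ro i) x *: co i.
Proof.
rewrite /simple_refl mulmxBl mul1mx -mulmxA; congr (_ - _).
by rewrite [ro i *m x]mx11_scalar mul_mx_scalar.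
Qed.

Definition word_mx (s : seq I) : 'M[R]_(vd_dim V) :=
  foldr (fun i m => r i *m m) 1%:M s.

Lemma word_mx_cat s t : word_mx (s ++ t) = word_mx s *m word_mx t.
Proof. by elim: s => [|i s IHs] /=; rewrite ?mul1mx// IHs mulmxA. Qed.

Lemma word_mx_rcons s i : word_mx (rcons s i) = word_mx s *m r i.
Proof. by rewrite -cats1 word_mx_cat /= mulmx1. Qed.

Lemma word_mx_rev s : word_mx s *m word_mx (rev s) = 1%:M.
Proof.
elim: s => [|i s IHs]; first by rewrite mul1mx.
by rewrite rev_cons word_mx_rcons /= mulmxA -(mulmxA (r i)) IHs mulmx1 refl_mul_self.
Qed.

Lemma word_mx_unit s : word_mx s \in unitmx.
Proof. by have [] := mulmx1_unit (word_mx_rev s). Qed.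

Lemma weyl_word w : weyl V w -> exists s, w = word_mx s.
Proof.
elim=> [|u v _ [s ->] _ [t ->]|u _ [s ->]|i]; first by exists [::].
- by exists (s ++ t); rewrite word_mx_cat.
- exists (rev s); rewrite -[RHS](mulKmx (word_mx_unit s)).
  by rewrite word_mx_rev mulmx1.
- by exists [:: i]; rewrite /= mulmx1.
Qed.

Lemma weyl_unit w : weyl V w -> w \in unitmx.
Proof. by move=> /weyl_word[s ->]; exact: word_mx_unit. Qed.

Definition reduced (s : seq I) : Prop :=
  forall s', word_mx s' = word_mx s -> (size s <= size s')%N.

Lemma reduced_behead i s : reduced (i :: s) -> reduced s.
Proof.
by move=> red s' s's; have := red (i :: s'); rewrite /= s's ltnS; exact.
Qed.

Lemma reduced_exists s : exists2 t, word_mx t = word_mx s & reduced t.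
Proof.
pose P n := `[< exists2 t, word_mx t = word_mx s & size t = n >].
have exP : exists n, P n by exists (size s); apply/asboolP; exists s.
case: (ex_minnP exP) => n /asboolP[t ts tn] minn; exists t => // t' t't.
by rewrite tn; apply: minn; apply/asboolP; exists t' => //; rewrite t't.
Qed.

Fixpoint alt (i j : I) (n : nat) : seq I :=
  if n is m.+1 then i :: alt j i m else [::].

Lemma size_alt i j n : size (alt i j n) = n.
Proof. by elim: n i j => //= n IHn i j; rewrite IHn. Qed.

Lemma alt_prefix i j m n : (m <= n)%N -> exists t, alt i j n = alt i j m ++ t.
Proof.
elim: m i j n => [|m IHm] i j n; first by exists (alt i j n).
by case: n => // n mn; have [t /= ->] := IHm j i n mn; exists t.
Qed.

(** Two equal neighbouring letters would cancel, so the letters alternate. The default value of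
    [head] admits the empty word. *)
Lemma reduced_alt i j s : all (pred2 i j) s -> reduced s -> head j s = j ->
  s = alt j i (size s).
Proof.
elim: s i j => //= k s IHs i j /andP[_ ijs] red kj; rewrite {}kj in red *.
congr (_ :: _); apply: IHs.
- by apply: sub_all ijs => l /= /orP[]->; rewrite ?orbT.
- exact: reduced_behead red.
case: s ijs red => //= l s /andP[/orP[/eqP->//|/eqP-> _] red].
have := red s; rewrite /= mulmxA refl_mul_self mul1mx => /(_ erefl).
by rewrite leqNgt ltnS leqnSn.
Qed.

Section RankTwo.
Variables (i j : I).
Local Notation cij := ((c i j)%:~R : R).
Local Notation cji := ((c j i)%:~R : R).

(* The matrices 1 + [co i, co j] K [ro i; ro j], with K a 2 x 2 matrix; they
   contain the group generated by the two reflections. *)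
Definition rank2_mx (k11 k12 k21 k22 : R) : 'M[R]_(vd_dim V) :=
  1%:M + (co i *m (k11 *: ro i + k12 *: ro j)
        + co j *m (k21 *: ro i + k22 *: ro j)).

Lemma rank2_mx0 : rank2_mx 0 0 0 0 = 1%:M.
Proof. by rewrite /rank2_mx !scale0r !addr0 !mulmx0 !addr0. Qed.

Lemma root_rank2 l k11 k12 k21 k22 : ro l *m rank2_mx k11 k12 k21 k22 =
  ro l + ((c i l)%:~R * k11 + (c j l)%:~R * k21) *: ro i
       + ((c i l)%:~R * k12 + (c j l)%:~R * k22) *: ro j.
Proof.
rewrite /rank2_mx !mulmxDr mulmx1 !mulmxA.
rewrite [ro l *m co i]mx11_scalar [ro l *m co j]mx11_scalar.
rewrite -![_ 0 0]/(evalf V _ _) !simple_root_coroot !mul_scalar_mx.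
rewrite !scalerA -!addrA; congr (_ + _).
by rewrite !scalerDl -!addrA; congr (_ + _); rewrite addrCA.
Qed.

Lemma refl1_rank2 k11 k12 k21 k22 : r i *m rank2_mx k11 k12 k21 k22 =
  rank2_mx (- k11 - 1 - cji * k21) (- k12 - cji * k22) k21 k22.
Proof.
rewrite {1}/simple_refl mulmxBl mul1mx -mulmxA root_rank2 cartan_diag.
set Z := (X in co i *m X); rewrite /rank2_mx.
have -> : (- k11 - 1 - cji * k21) *: ro i + (- k12 - cji * k22) *: ro j
   = k11 *: ro i + k12 *: ro j - Z.
  by apply/rowP => z; rewrite /Z !mxE; ring.
by rewrite mulmxBr -!addrA; do 2 congr (_ + _); rewrite addrC.
Qed.

Lemma refl2_rank2 k11 k12 k21 k22 : r j *m rank2_mx k11 k12 k21 k22 =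
  rank2_mx k11 k12 (- k21 - cij * k11) (- k22 - 1 - cij * k12).
Proof.
rewrite {1}/simple_refl mulmxBl mul1mx -mulmxA root_rank2 cartan_diag.
set Z := (X in co j *m X); rewrite /rank2_mx.
have -> : (- k21 - cij * k11) *: ro i + (- k22 - 1 - cij * k12) *: ro j
   = k21 *: ro i + k22 *: ro j - Z.
  by apply/rowP => z; rewrite /Z !mxE; ring.
by rewrite mulmxBr -!addrA.
Qed.

Lemma root1_comb x y :
  (x *: ro i + y *: ro j) *m r i = (- x - cij * y) *: ro i + y *: ro j.
Proof.
rewrite mulmxDl -!scalemxAl root_refl_self root_refl.
by apply/rowP => z; rewrite !mxE; ring.
Qed.

End RankTwo.

Lemma root2_comb i j x y : (x *: ro i + y *: ro j) *m r j =
  x *: ro i + (- y - (c j i)%:~R * x) *: ro j.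
Proof. by rewrite addrC root1_comb addrC. Qed.

Lemma alt_nonneg i j n x y : 4 <= (c i j)%:~R * (c j i)%:~R :> R ->
  (c i j)%:~R <= 0 :> R -> (c j i)%:~R <= 0 :> R ->
  0 <= x -> 0 <= y -> 2 * y <= - (c j i)%:~R * x ->
  exists x' y', [/\ 0 <= x', 0 <= y' &
    (x *: ro i + y *: ro j) *m word_mx (alt j i n) = x' *: ro i + y' *: ro j].
Proof.
elim: n i j x y => [|n IHn] i j x y p4 cij cji x0 y0 xy.
  by exists x, y; rewrite mulmx1.
rewrite /= mulmxA root2_comb [_ *: ro i + _]addrC.
have [||||||y' [x' [y'0 x'0 E]]] := IHn j i (- y - (c j i)%:~R * x) x.
- by rewrite mulrC.
- by [].
- by [].
- by nra.
- by [].
- have h1 : 0 <= - (c i j)%:~R * (- (c j i)%:~R * x - 2 * y) by apply: mulr_ge0; lra.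
  have h2 : 0 <= x * ((c i j)%:~R * (c j i)%:~R - 4) by apply: mulr_ge0; lra.
  by nra.
by exists x', y'; rewrite E addrC.
Qed.

Lemma eq_rank2_mx (i j : I) k11 k12 k21 k22 l11 l12 l21 l22 :
  k11 = l11 -> k12 = l12 -> k21 = l21 -> k22 = l22 ->
  rank2_mx i j k11 k12 k21 k22 = rank2_mx i j l11 l12 l21 l22.
Proof. by move=> -> -> -> ->. Qed.

(** The finite types A1 x A1, A2, B2 and G2, with m = 2, 3, 4, 6 the order of r_i r_j. In the
    coordinates of [rank2_mx] the braid relation becomes four numerical identities. *)
Lemma braid_small i j m (A B : nat) : c i j = - A%:Z -> c j i = - B%:Z ->
  (A, B, m) \in [:: (0, 0, 2); (1, 1, 3); (1, 2, 4); (2, 1, 4); (1, 3, 6); (3, 1, 6)]%N ->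
  word_mx (alt i j m) = word_mx (alt j i m).
Proof.
move=> cij cji.
by rewrite !inE => /or4P[|||/or3P[]] /eqP[EA EB ->];
  move: cij cji; rewrite EA EB => cij cji;
  rewrite /= -(rank2_mx0 i j) !(refl1_rank2, refl2_rank2) cij cji;
  rewrite !rmorphN /= !mulNr !opprK; apply: eq_rank2_mx; ring.
Qed.

Lemma alt_small_nonneg i j m n (A B : nat) : c i j = - A%:Z -> c j i = - B%:Z ->
  (A, B, m) \in [:: (0, 0, 2); (1, 1, 3); (1, 2, 4); (2, 1, 4); (1, 3, 6); (3, 1, 6)]%N ->
  (n < m)%N ->
  exists x y, [/\ 0 <= x, 0 <= y &
    ro i *m word_mx (alt j i n) = x *: ro i + y *: ro j].
Proof.
move=> cij cji AB nm.
have E : ro i = 1 *: ro i + 0 *: ro j by rewrite scale1r scale0r addr0.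
rewrite [X in X *m _]E.
move: AB nm; rewrite !inE => /or4P[|||/or3P[]] /eqP[EA EB ->];
  move: cij cji; rewrite EA EB => cij cji;
  case: n => [|[|[|[|[|[|n]]]]]] // _; rewrite /= ?mulmxA ?mulmx1;
  do ?[rewrite root2_comb ?cij ?cji | rewrite root1_comb ?cij ?cji];
  (do 2 eexists; split; last reflexivity); lra.
Qed.

Lemma rank2_cases i j : i != j ->
  4 <= (c i j)%:~R * (c j i)%:~R :> R \/
  exists A B m, [/\ c i j = - A%:Z, c j i = - B%:Z & (A, B, m) \in
    [:: (0, 0, 2); (1, 1, 3); (1, 2, 4); (2, 1, 4); (1, 3, 6); (3, 1, 6)]%N].
Proof.
move=> ij; have cij := cartan_le0 ij; have cji : c j i <= 0.
  by apply: cartan_le0; rewrite eq_sym.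
have [_ _ /(_ i j) c0] := vd_cartanP V.
have [A EA] : exists A : nat, c i j = - A%:Z by exists `|c i j|%N; lia.
have [B EB] : exists B : nat, c j i = - B%:Z by exists `|c j i|%N; lia.
have AB0 : A = 0%N <-> B = 0%N by lia.
have [p4|p4] := leqP 4 (A * B).
  left; rewrite EA EB !rmorphN /= mulrNN -intrM -(ler_nat R) in p4 *.
  by rewrite natrM in p4; rewrite intrM.
right; exists A, B.
have A3 : (A < 4)%N by nia.
have B3 : (B < 4)%N by nia.
case: A B EA EB AB0 p4 A3 B3 => [|[|[|[|A]]]] [|[|[|[|B]]]] //= -> -> AB0 p4 _ _; try lia.
- by exists 2%N.
- by exists 3%N.
- by exists 4%N.
- by exists 6%N.
- by exists 4%N.
- by exists 6%N.
Qed.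

Lemma dihedral_nonneg i j n : i != j ->
  (forall s, word_mx s = r i *m word_mx (alt j i n) -> (n <= size s)%N) ->
  exists x y, [/\ 0 <= x, 0 <= y &
    ro i *m word_mx (alt j i n) = x *: ro i + y *: ro j].
Proof.
move=> ij minn; case: (rank2_cases ij) => [p4|[A [B [m [cij cji ABm]]]]].
  have cij : (c i j)%:~R <= 0 :> R by rewrite lerz0 cartan_le0.
  have cji : (c j i)%:~R <= 0 :> R by rewrite lerz0 cartan_le0// eq_sym.
  have xy : 2 * 0 <= - (c j i)%:~R * 1 :> R by rewrite mulr0 mulr1 oppr_ge0.
  have [x [y]] := alt_nonneg n p4 cij cji ler01 (lexx 0) xy.
  by rewrite scale1r scale0r addr0 => ?; exists x, y.
have [nm|mn] := ltnP n m; first exact: alt_small_nonneg cij cji ABm nm.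
have [t Et] := alt_prefix j i mn.
have m0 : (0 < m)%N.
  by move: ABm; rewrite !inE => /or4P[|||/or3P[]] /eqP[_ _ ->].
(* Here n >= m: the braid relation makes the first m letters begin with i, which cancels against r_i
   and leaves a word of length n - 1, contradicting minimality. *)
have := minn (alt j i m.-1 ++ t); rewrite size_cat size_alt => h.
suff : (n <= m.-1 + size t)%N.
  have -> : n = (m + size t)%N by rewrite -(size_alt j i n) Et size_cat size_alt.
  by rewrite -{1}(prednK m0) addSn ltnn.
apply: h; rewrite Et !word_mx_cat -(braid_small cij cji ABm) -{2}(prednK m0) /=.
by rewrite !mulmxA refl_mul_self mul1mx.
Qed.

End CoxeterWords.

Section CoxeterSigns.
Context {R : realType} (V : vectorial_data R).
Local Notation I := (vd_index V).
Local Notation AA := 'cV[R]_(vd_dim V).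
Local Notation ro := (simple_root V).
Local Notation r := (simple_refl V).

Definition nonneg_comb (a : 'rV[R]_(vd_dim V)) : Prop :=
  exists2 n : I -> R, (forall j, 0 <= n j) & a = \sum_j n j *: ro j.

Lemma nonneg_comb_lin x y a b : 0 <= x -> 0 <= y ->
  nonneg_comb a -> nonneg_comb b -> nonneg_comb (x *: a + y *: b).
Proof.
move=> x0 y0 [m m0 ->] [n n0 ->]; exists (fun j => x * m j + y * n j).
  by move=> j; rewrite addr_ge0 ?mulr_ge0.
rewrite !scaler_sumr -big_split; apply: eq_bigr => j _.
by rewrite !scalerA scalerDl.
Qed.

Lemma nonneg_comb_root i : nonneg_comb (ro i).
Proof.
exists (fun j => (j == i)%:R) => [j|]; first exact: ler0n.
rewrite (bigD1 i) //= eqxx scale1r big1 ?addr0// => j /negPf->.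
by rewrite scale0r.
Qed.

(* The argument of Tits: split off the longest prefix lying in the rank two
   parabolic subgroup generated by r_i and a left descent r_j. *)
Lemma reduced_nonneg s i : reduced s ->
  (forall s', word_mx s' = r i *m word_mx s -> (size s <= size s')%N) ->
  nonneg_comb (ro i *m word_mx s).
Proof.
elim: {s}(size s).+1 {-2}s (ltnSn (size s)) i => // n IHn s sn i red mini.
case: s sn red mini => [|j s] sn red mini.
  by rewrite mulmx1; exact: nonneg_comb_root.
have ij : i != j.
  apply/negP => /eqP ij; have := mini s.
  by rewrite ij /= mulmxA refl_mul_self mul1mx => /(_ erefl); rewrite ltnn.
pose P k := `[< exists x v, [/\ all (pred2 i j) x,
  word_mx x *m word_mx v = word_mx (j :: s), (size x + size v = (size s).+1)%N
  & size v = k] >].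
have exP : exists k, P k.
  exists (size s); apply/asboolP; exists [:: j], s.
  by rewrite /= eqxx orbT mulmx1.
case: (ex_minnP exP) => k /asboolP[x [v [xij xv xvs vk]]] mink.
have ks : (k <= size s)%N.
  apply: mink; apply/asboolP; exists [:: j], s.
  by rewrite /= eqxx orbT mulmx1.
have redv : reduced v.
  move=> v' v'v; have := red (x ++ v').
  by rewrite word_mx_cat v'v xv => /(_ erefl); rewrite size_cat /= -xvs leq_add2l.
(* A letter i or j that shortens v from the left could be moved into x, contradicting the minimality
   of the length of v. *)
have minv l : pred2 i j l -> forall s', word_mx s' = r l *m word_mx v ->
    (size v <= size s')%N.
  move=> lij s' s'v; rewrite leqNgt; apply/negP => s's.
  have E : word_mx (rcons x l ++ s') = word_mx (j :: s).
    by rewrite word_mx_cat word_mx_rcons -mulmxA s'v (mulmxA (r l)) refl_mul_self mul1mx.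
  have := red _ E; rewrite size_cat size_rcons /= -xvs addSnnS leq_add2l => h.
  suff : (k <= size s')%N by rewrite -vk leqNgt s's.
  apply: mink; apply/asboolP; exists (rcons x l), s'.
  rewrite all_rcons lij xij -word_mx_cat E size_rcons; split => //.
  by rewrite addSnnS -xvs; congr (_ + _)%N; apply/eqP; rewrite eqn_leq s's h.
have /IHn vpos : (size v < n)%N by rewrite vk; apply: leq_ltn_trans ks _.
have redx : reduced x.
  move=> x' x'x; have := red (x' ++ v).
  by rewrite word_mx_cat x'x xv => /(_ erefl); rewrite size_cat /= -xvs leq_add2r.
have minx x' : word_mx x' = r i *m word_mx x -> (size x <= size x')%N.
  move=> x'x; have := mini (x' ++ v).
  rewrite word_mx_cat x'x -mulmxA xv => /(_ erefl).
  by rewrite size_cat /= -xvs leq_add2r.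
have xalt : x = alt j i (size x).
  apply: reduced_alt => //.
  case: x xij redx minx {xv xvs} => //= l x /andP[/orP[/eqP->|/eqP->//] _] _.
  by move=> /(_ x); rewrite mulmxA refl_mul_self mul1mx => /(_ erefl); rewrite ltnn.
have [|y [z [y0 z0 E]]] := @dihedral_nonneg _ V i j (size x) ij.
  by move=> s'; rewrite -xalt; exact: minx.
rewrite -xv mulmxA xalt E mulmxDl -!scalemxAl; apply: nonneg_comb_lin => //.
  by apply: vpos => //; apply: minv; rewrite /= eqxx.
by apply: vpos => //; apply: minv; rewrite /= eqxx orbT.
Qed.

(** The row [ro i *m w] is the root w^-1.alpha_i, and i is the first letter of a reduced word of
    w. *)
Lemma weyl_descent w : weyl V w -> w <> 1%:M ->
  exists i, nonneg_comb (- (ro i *m w)).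
Proof.
move=> /weyl_word[s0 ->]; have [s <- red] := reduced_exists s0.
case: s red => // i s red _; exists i.
rewrite /= mulmxA root_refl_self mulNmx opprK.
apply: reduced_nonneg; first exact: reduced_behead red.
by move=> s' s's; have := red s'; rewrite s's => /(_ erefl) /ltnW.
Qed.

Lemma evalf_nonneg_comb a (x : AA) : nonneg_comb a ->
  (forall j, 0 <= evalf V (ro j) x) -> 0 <= evalf V a x.
Proof.
move=> [n n0 ->] x0; rewrite evalf_suml sumr_ge0// => j _.
by rewrite evalfZl mulr_ge0.
Qed.

(** If alpha_j w is nonpositive on dominant vectors, then alpha_j vanishes on [S], so j = i: only i
    can be a descent of w. The same holds for r_i w, as r_i fixes [S]. If both differ from 1, then
    alpha_i w and its opposite are nonnegative combinations of simple roots, so alpha_i w = 0, which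
    is absurd. *)
Lemma weyl_fix_facet i w (S : set AA) : weyl V w ->
  (forall p, S p -> evalf V (ro i) p = 0) ->
  (forall p j, S p -> 0 <= evalf V (ro j) p) ->
  (forall p, S p -> exists2 q, p = w *m q & forall j, 0 <= evalf V (ro j) q) ->
  (forall j, j != i -> exists2 p, S p & evalf V (ro j) p != 0) ->
  w = 1%:M \/ w = r i.
Proof.
move=> Ww Si S0 Sw Sj.
have descent u : weyl V u -> (forall p q, S p -> p = w *m q -> p = u *m q) ->
    u <> 1%:M -> nonneg_comb (- (ro i *m u)).
  move=> Wu uw /(weyl_descent Wu)[j nj]; suff /eqP -> : i == j by [].
  rewrite eq_sym; apply/negPn/negP => /Sj[p Sp]; apply/negP; rewrite negbK.
  have [q pq q0] := Sw p Sp.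
  rewrite eq_le S0 // andbT (uw _ _ Sp pq) evalf_mul.
  by have := evalf_nonneg_comb nj q0; rewrite evalfNl oppr_ge0.
have [->|/eqP w1] := eqVneq w 1%:M; first by left.
have [rw1|/eqP rw1] := eqVneq (r i *m w) 1%:M.
  by right; rewrite -[RHS]mulmx1 -rw1 mulmxA refl_mul_self mul1mx.
have h1 := descent w Ww (fun _ _ _ => id) w1.
have h2 : nonneg_comb (ro i *m w).
  suff : nonneg_comb (- (ro i *m (r i *m w))).
    by rewrite mulmxA root_refl_self mulNmx opprK.
  apply: descent => //; first by apply: weyl_mul => //; exact: weyl_refl.
  by move=> p q Sp pq; rewrite -mulmxA -pq refl_mul Si// scale0r subr0.
exfalso; have rw0 : ro i *m w = 0.
  case: h1 => m m0 mE; case: h2 => n n0 nE; rewrite nE big1// => j _.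
  suff -> : n j = 0 by rewrite scale0r.
  have := evalf_fund n j; rewrite -nE => nj.
  have := evalf_fund m j; rewrite -mE evalfNl nj => mj.
  by apply/eqP; rewrite eq_le n0 -oppr_ge0 mj m0.
have := fundE i i; rewrite eqxx -(mulmxK (weyl_unit Ww) (ro i)) rw0 mul0mx evalf0l.
by move/eqP; rewrite eq_sym oner_eq0.
Qed.

End CoxeterSigns.

(** * Vectorial faces and enclosures *)

Section SignedForms.
Context {R : realType} (V : vectorial_data R).
Local Notation I := (vd_index V).
Local Notation AA := 'cV[R]_(vd_dim V).
Local Notation ro := (simple_root V).
Local Notation co := (simple_coroot V).
Local Notation r := (simple_refl V).
Local Notation c := (vd_cartan (v := V)).
Implicit Types (x y z v u : AA) (b : bool) (i j : I).

Lemma all_root_sign a : all_root V a -> exists n : I -> int,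
  exists2 s : int, s = 1 \/ s = -1 &
  [/\ a = \sum_i (n i)%:~R *: ro i, forall j, 0 <= s * n j
    & forall i, (forall j, j != i -> n j = 0) -> n i = s].
Proof.
move=> [n /km_root_sign nP <-]; exists n.
have [|s s1 [n0 ni]] := nP; last by exists s.
by move=> m; rewrite intr_eq0.
Qed.

(** The sign is absorbed into the simple forms, so that positive and negative sector-germs share all
    later arguments. *)
Definition signed_root b i : 'rV[R]_(vd_dim V) := (-1) ^+ b *: ro i.
Definition sform b i y : R := (-1) ^+ b * evalf V (ro i) y.

Lemma sformE b i y : sform b i y = evalf V (signed_root b i) y.
Proof. by rewrite evalfZl. Qed.

Lemma signed_root_all b i : all_root V (signed_root b i).
Proof.
exists (fun j => (-1) ^+ b * (j == i)%:R).
  by apply: km_simple_root; case: b; [right|left].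
rewrite (bigD1 i) //= eqxx big1 => [|j /negPf->].
  by rewrite addr0 mulr1 rmorphXn /= rmorphN1.
by rewrite mulr0 scale0r.
Qed.

Lemma simple_root_real i : real_root_coroot V (ro i) (co i).
Proof.
exists 1%:M, i; split; first exact: weyl_one.
  by rewrite /dual_act invmx1 mulmx1.
by rewrite mul1mx.
Qed.

Lemma real_rootN a : real_root V a -> real_root V (- a).
Proof.
move=> [_ [w [i [Ww -> _]]]]; exists (w *m r i *m co i), (w *m r i), i; split=> //.
  by apply: weyl_mul => //; exact: weyl_refl.
rewrite /dual_act; have -> : invmx (w *m r i) = r i *m invmx w.
  have wu := weyl_unit Ww; have ru := refl_unit i.
  have wru : w *m r i \in unitmx by rewrite unitmx_mul wu.
  apply: (canRL (mulmxK wu)); rewrite -[LHS](mulmxK ru) -(mulmxA _ w) mulVmx//.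
  by rewrite mul1mx invmx_refl.
by rewrite mulmxA root_refl_self mulNmx.
Qed.

Lemma signed_root_real b i : real_root V (signed_root b i).
Proof.
rewrite /signed_root; have h : real_root V (ro i) by exists (co i); exact: simple_root_real.
by case: b; rewrite ?expr1 ?scaleN1r ?expr0 ?scale1r //; exact: real_rootN.
Qed.

Lemma sformD b i x y : sform b i (x + y) = sform b i x + sform b i y.
Proof. by rewrite /sform evalfD mulrDr. Qed.

Lemma sformN b i x : sform b i (- x) = - sform b i x.
Proof. by rewrite /sform evalfN mulrN. Qed.

Lemma sformB b i x y : sform b i (x - y) = sform b i x - sform b i y.
Proof. by rewrite sformD sformN. Qed.

Lemma sformZ b i a x : sform b i (a *: x) = a * sform b i x.
Proof. by rewrite /sform evalfZ mulrCA. Qed.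

Lemma sform_negb b i x : sform (~~ b) i x = - sform b i x.
Proof. by rewrite /sform; case: b; rewrite /= ?expr0 ?expr1 ?mul1r ?mulN1r ?opprK. Qed.

Lemma sform_refl b i j x : sform b j (r i *m x) = sform b j x - (c i j)%:~R * sform b i x.
Proof. by rewrite /sform evalf_refl mulrBr mulrCA. Qed.

Lemma sform_refl_self b i x : sform b i (r i *m x) = - sform b i x.
Proof. by rewrite sform_refl cartan_diag; ring. Qed.

Lemma evalf_closure a (S : set AA) (l : R) : (forall x, S x -> l <= evalf V a x) ->
  forall x, closure S x -> l <= evalf V a x.
Proof.
move=> Sl x Sx; rewrite leNgt; apply/negP => xl.
have : nbhs x [set y | evalf V a y < l].
  apply: (@evalf_continuous R V a x [set t | t < l]).
  by apply: open_nbhs_nbhs; split => //; exact: open_lt.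
by move=> /Sx[y [/Sl + /=]]; rewrite leNgt => /negP.
Qed.

Lemma nbhs_line x v (Om : set AA) : nbhs x Om ->
  exists2 e : R, 0 < e & forall t, `|t| < e -> Om (x + t *: v).
Proof.
move=> xOm; have lc : (fun t : R => x + t *: v) @ (0 : R) --> x + (0 : R) *: v.
  by apply: cvgD; [exact: cvg_cst|exact: scalel_continuous].
move: (lc Om); rewrite scale0r addr0 => /(_ xOm).
move=> /nbhs_ballP[e e0 eOm]; exists e => // t te; apply: eOm.
by rewrite /ball /= sub0r normrN.
Qed.

Lemma finite_upper_bound (f : I -> R) : exists m : R, forall j, f j <= m.
Proof.
exists (\sum_j `|f j|) => j; rewrite (bigD1 j) //=.
by rewrite (le_trans (ler_norm _))// lerDl sumr_ge0.
Qed.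

Lemma int_above (x : R) : exists m : int, x <= m%:~R.
Proof. by exists (Num.ceil x); exact: ceil_ge. Qed.

Definition signed_cone b (J : {set I}) : set AA :=
  signed_image V b 1%:M (std_face V J).

Lemma signed_coneE b J v : signed_cone b J v <->
  (forall i, i \in J -> sform b i v = 0) /\ (forall i, i \notin J -> 0 < sform b i v).
Proof.
have bb (x : R) : (-1) ^+ b * ((-1) ^+ b * x) = x by rewrite mulrA -expr2 sqrr_sign mul1r.
split=> [[y [y0 yp] <-]|[v0 vp]].
  rewrite mul1mx; split=> i iJ; rewrite sformZ /sform mulrA -expr2 sqrr_sign mul1r.
    exact: y0.
  exact: yp.
exists ((-1) ^+ b *: v); last by rewrite mul1mx scalerA -expr2 sqrr_sign scale1r.
by split=> i iJ; rewrite evalfZ; [exact: v0|exact: vp].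
Qed.

Lemma signed_cone_face b J : vect_face V (signed_cone b J).
Proof. by exists b, 1%:M, J; split=> //; exact: weyl_one. Qed.

Definition cone_point b (J : {set I}) : AA :=
  (-1) ^+ b *: \sum_(i | i \notin J) fund i.

Lemma sform_point b J i : sform b i (cone_point b J) = (i \notin J)%:R.
Proof.
rewrite sformZ /sform mulrA -expr2 sqrr_sign mul1r.
have -> : \sum_(j | j \notin J) fund j = \sum_j (j \notin J)%:R *: fund j.
  by rewrite big_mkcond; apply: eq_bigr => j _; case: ifP; rewrite ?scale1r ?scale0r.
exact: simple_root_fund.
Qed.

Lemma cone_point_in b J : signed_cone b J (cone_point b J).
Proof.
by apply/signed_coneE; split=> i iJ; rewrite sform_point ?iJ // (negPf iJ).
Qed.

Lemma signed_coneZ b J v t : signed_cone b J v -> 0 < t -> signed_cone b J (t *: v).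
Proof.
move=> /signed_coneE[v0 vp] t0; apply/signed_coneE; split=> i iJ; rewrite sformZ.
  by rewrite v0// mulr0.
by rewrite mulr_gt0// vp.
Qed.

Lemma nbhs_form_gt a x (l : R) : l < evalf V a x -> nbhs x [set y | l < evalf V a y].
Proof.
move=> lx; apply: (@evalf_continuous R V a x [set t | l < t]).
by apply: open_nbhs_nbhs; split => //; exact: open_gt.
Qed.

Lemma closure_std_chamber x : (forall j, 0 <= evalf V (ro j) x) ->
  closure (std_chamber V) x.
Proof.
move=> x0 B xB; have [e e0 eB] := nbhs_line (cone_point false finset.set0) xB.
exists (x + (e / 2) *: cone_point false finset.set0); split; last first.
  by apply: eB; rewrite gtr0_norm; lra.
move=> j; rewrite evalfD evalfZ.
have := sform_point false finset.set0 j; rewrite /sform expr0 mul1r finset.in_set0 => ->.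
by rewrite mulr1; apply: ltr_wpDl (x0 j) _; lra.
Qed.

(** For y near this point, every alpha_j with j different from i is positive both at y and at r_i y,
    because c_ij <= 0. According to the sign of alpha_i(y), either y or r_i y is therefore
    dominant. *)
Lemma cone_point_interior (J : {set I}) i : J \subset [set i]%SET ->
  interior (tits_cone V) (cone_point false J).
Proof.
move=> Ji; set p := cone_point _ _.
have pj j : evalf V (ro j) p = (j \notin J)%:R.
  by rewrite -[LHS]mul1r -(sform_point false).
have near0 : nbhs p [set y | forall j, j != i -> 0 < evalf V (ro j) y].
  apply: (@filter_forall _ I (fun j => [set y | j != i -> 0 < evalf V (ro j) y])
    (nbhs p) (nbhs_filter p)) => j.
  have [->|ji] := altP (j =P i); first exact: nearW.
  apply: filterS (fun y hy _ => hy) (_ : nbhs p [set y | 0 < evalf V (ro j) y]).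
  apply: nbhs_form_gt; rewrite pj ltr0n lt0b.
  by apply: contra ji => /(fintype.subsetP Ji); rewrite inE.
have near1 : nbhs p [set y | forall j, j != i -> 0 < evalf V (ro j *m r i) y].
  apply: (@filter_forall _ I (fun j => [set y | j != i -> 0 < evalf V (ro j *m r i) y])
    (nbhs p) (nbhs_filter p)) => j.
  have [->|ji] := altP (j =P i); first exact: nearW.
  apply: filterS (fun y hy _ => hy) (_ : nbhs p [set y | 0 < evalf V (ro j *m r i) y]).
  apply: nbhs_form_gt; rewrite root_refl evalfDl evalfNl evalfZl !pj.
  have -> : j \notin J by apply: contra ji => /(fintype.subsetP Ji); rewrite inE.
  rewrite subr_gt0 (le_lt_trans _ ltr01)// mulr_le0_ge0 ?ler0n// lerz0.
  by apply: cartan_le0; rewrite eq_sym.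
rewrite /interior; apply: filterS2 near0 near1 => y y0 y1.
have [yi|yi] := leP 0 (evalf V (ro i) y).
  exists 1%:M, y; split; first exact: weyl_one; last by rewrite mul1mx.
  by apply: closure_std_chamber => j; have [->//|/y0/ltW] := eqVneq j i.
exists (r i), (r i *m y); split; first exact: weyl_refl; last first.
  by rewrite mulmxA refl_mul_self mul1mx.
apply: closure_std_chamber => j; have [->|/y1] := eqVneq j i.
  by rewrite evalf_refl cartan_diag; lra.
by rewrite evalf_mul => /ltW.
Qed.

Lemma signed_cone_spherical b (J : {set I}) i : J \subset [set i]%SET ->
  spherical V (signed_cone b J).
Proof.
move=> Ji; exists (cone_point b J); split; first exact: cone_point_in.
have := cone_point_interior Ji; rewrite /cone_point /tits_int_pm /=.
by case: b; rewrite ?expr1 ?expr0 ?scale1r ?scaleN1r ?opprK; [right|left].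
Qed.

End SignedForms.

(** * Convexity of the sets that generate enclosures *)

Section Enclosures.
Context {R : realType} (V : vectorial_data R).
Local Notation I := (vd_index V).
Local Notation AA := 'cV[R]_(vd_dim V).
Implicit Types (x y z v u : AA) (b : bool) (i j : I) (J : {set I}).

Definition enclosed (Q : set AA) : Prop := exists k : 'rV[R]_(vd_dim V) -> \bar R,
  (forall a, all_root V a -> zinf (k a)) /\
  Q = \bigcap_(a in all_root V) halfspace V a (k a).

Lemma halfspace_infty a : halfspace V a +oo%E = setT.
Proof. by apply/seteqP; split => // x _; rewrite /halfspace /= addey ?leey. Qed.

Lemma halfspace_fin a (k : R) x : halfspace V a k%:E x <-> 0 <= evalf V a x + k.
Proof. by rewrite /halfspace /= -EFinD lee_fin. Qed.

Lemma enclosed_half a (m : int) : all_root V a ->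
  enclosed [set y | m%:~R <= evalf V a y].
Proof.
move=> aD; exists (fun a' => if a' == a then (- m)%:~R%:E else +oo%E); split.
  by move=> a' _; case: ifP => _; [right; exists (- m)|left].
apply/seteqP; split=> [y /= my a' _|y /(_ a aD)] /=.
  case: eqVneq => [->|_]; last by rewrite halfspace_infty.
  by apply/halfspace_fin; rewrite intrN subr_ge0.
by rewrite eqxx => /halfspace_fin; rewrite intrN subr_ge0.
Qed.

Lemma enclosedI Q Q' : enclosed Q -> enclosed Q' -> enclosed (Q `&` Q').
Proof.
move=> [k [kz ->]] [k' [kz' ->]]; exists (fun a => Order.min (k a) (k' a)); split.
  by move=> a aD; rewrite minElt; case: ifP => _; [exact: kz|exact: kz'].
have minP a : halfspace V a (Order.min (k a) (k' a)) =
    halfspace V a (k a) `&` halfspace V a (k' a).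
  apply/seteqP; rewrite /halfspace; split=> y /=.
    move=> h; split; apply: le_trans h _; rewrite leeD2l// ge_min lexx ?orbT//.
  by case=> h h'; rewrite minElt; case: ifP.
apply/seteqP; split=> y.
  by move=> [y1 y2] a aD; rewrite minP; split; [exact: y1|exact: y2].
by move=> h; split=> a aD; have := h a aD; rewrite minP => -[].
Qed.

Lemma enclosedT : enclosed setT.
Proof.
exists (fun=> +oo%E); split; first by left.
by apply/seteqP; split=> // y _ a _; rewrite halfspace_infty.
Qed.

Lemma enclosed_forms b (P : pred I) (m : int) :
  enclosed [set y | forall j, P j -> m%:~R <= sform b j y].
Proof.
suff h (s : seq I) : enclosed [set y | forall j, j \in s -> P j -> m%:~R <= sform b j y].
  have := h (index_enum I); congr (enclosed _); apply/seteqP; split=> y /= yj j Pj.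
    by apply: yj => //; rewrite mem_index_enum.
  by exact: yj.
elim: s => [|i s IHs].
  by have := enclosedT; congr enclosed; apply/seteqP; split.
have [Pi|nPi] := boolP (P i); last first.
  move: IHs; congr enclosed; apply/seteqP; split=> y /= h j.
    by rewrite inE => /orP[/eqP-> /(negP nPi)//|]; exact: h.
  by move=> js; apply: h; rewrite inE js orbT.
have := enclosedI (enclosed_half m (signed_root_all b i)) IHs; congr enclosed.
apply/seteqP; split=> y /=; rewrite -sformE.
  by move=> [yi ys] j; rewrite inE => /orP[/eqP->//|]; exact: ys.
move=> h; split; first by apply: h => //; exact: mem_head.
by move=> j js; apply: h; rewrite inE js orbT.
Qed.

Lemma enclosed_finite Q y b J a (m : R) :
  (forall v, signed_cone b J v -> Q (y + v)) ->
  (forall x, Q x -> 0 <= evalf V a x + m) ->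
  forall v, (forall i, i \in J -> sform b i v = 0) ->
    (forall i, i \notin J -> 0 <= sform b i v) -> 0 <= evalf V a v.
Proof.
move=> yQ Qa; have pos v : signed_cone b J v -> 0 <= evalf V a v.
  move=> vJ; rewrite leNgt; apply/negP => av.
  pose t := (`|evalf V a y + m| + 1) / - evalf V a v.
  have t0 : 0 < t by rewrite divr_gt0// ?oppr_gt0// ltr_wpDl.
  have := Qa _ (yQ _ (signed_coneZ vJ t0)).
  rewrite evalfD evalfZ /t -mulrA; apply/negP; rewrite -ltNge.
  have -> : (- evalf V a v)^-1 * evalf V a v = -1.
    by rewrite invrN mulNr mulVf ?lt_eqF.
  by rewrite mulrN1; have := ler_norm (evalf V a y + m); lra.
move=> v v0 vp; rewrite leNgt; apply/negP => av.
have p0 := pos _ (cone_point_in b J).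
(* A boundary vector of the cone is pushed inside by a small multiple of [cone_point]; the summand 1
   keeps the denominator positive when [a] vanishes at that point. *)
pose t := - evalf V a v / (2 * (evalf V a (cone_point b J) + 1)).
have t0 : 0 < t by rewrite divr_gt0 ?oppr_gt0// mulr_gt0//; lra.
have : signed_cone b J (v + t *: cone_point b J).
  apply/signed_coneE; split=> i iJ; rewrite sformD sformZ sform_point iJ.
    by rewrite v0// mulr0 addr0.
  by rewrite mulr1 ltr_wpDl// vp.
move=> /pos; rewrite evalfD evalfZ /t; apply/negP; rewrite -ltNge.
set p := evalf V a (cone_point b J) in p0 *; set w := evalf V a v in av *.
have p1 : 0 < p + 1 by lra.
have -> : w + - w / (2 * (p + 1)) * p = w * (p + 2) / (2 * (p + 1)) by field; lra.
by rewrite ltr_pdivrMr ?mul0r; nra.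
Qed.

(** The recession directions of an intersection of half-spaces do not depend on the base point: one
    translate of the open cone inside [Q] gives the closed cone at every point of [Q]. Later
    enclosures are bounded from below through this fact. *)
Lemma enclosed_recession Q y z b J : enclosed Q ->
  (forall v, signed_cone b J v -> Q (y + v)) -> Q z ->
  forall v, (forall i, i \in J -> sform b i v = 0) ->
    (forall i, i \notin J -> 0 <= sform b i v) -> Q (z + v).
Proof.
move=> [k [kz QE]] yQ Qz v v0 vp; rewrite QE => a aD.
have Qa x : Q x -> halfspace V a (k a) x by rewrite QE; exact.
case: (kz a aD) => [->|[m km]]; first by rewrite halfspace_infty.
have Qm x : Q x -> 0 <= evalf V a x + m%:~R.
  by move=> /Qa; rewrite km => /halfspace_fin.
rewrite km; apply/halfspace_fin; rewrite evalfD addrAC.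
by rewrite addr_ge0 ?Qm ?(enclosed_finite yQ Qm).
Qed.

(** Enclosed sets are closed along lines. This recovers the lower wall of a strip, since the open
    chamber based at a point of that wall only supplies points strictly above it. *)
Lemma enclosed_limit Q z v : enclosed Q ->
  (exists2 e : R, 0 < e & forall t : R, 0 < t -> t < e -> Q (z + t *: v)) -> Q z.
Proof.
move=> [k [kz QE]] [e e0 eQ]; rewrite QE => a aD.
case: (kz a aD) => [->|[m km]]; first by rewrite halfspace_infty.
have Qm x : Q x -> 0 <= evalf V a x + m%:~R.
  by rewrite QE => /(_ a aD); rewrite km => /halfspace_fin.
rewrite km; apply/halfspace_fin; rewrite leNgt; apply/negP => zm {QE kz km}.
set l := evalf V a z + m%:~R in zm; pose n : R := `|evalf V a v|.
have n0 : 0 <= n by exact: normr_ge0.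
pose s : R := - l / (n + 1).
have s0 : 0 < s by rewrite divr_gt0; lra.
pose t : R := Num.min (e / 2) s.
have t0 : 0 < t by rewrite lt_min s0 andbT; lra.
have te : t < e by rewrite gt_min; apply/orP; left; lra.
have := Qm _ (eQ t t0 te); rewrite evalfD evalfZ; apply/negP; rewrite -ltNge.
have ts : t * (n + 1) <= - l.
  have : t <= s by rewrite ge_min lexx orbT.
  by move=> /(ler_wpM2r (_ : 0 <= n + 1)) h; apply: le_trans (h _) _; [lra|rewrite /s divfK; lra].
have tn : t * evalf V a v <= t * n by rewrite ler_wpM2l ?ler_norm// ltW.
by move: ts tn; rewrite mulrDr mulr1 /l; lra.
Qed.

End Enclosures.

(** * Chimneys in the direction of a facet *)

Section Chimneys.
Context {R : realType} (V : vectorial_data R).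
Local Notation I := (vd_index V).
Local Notation AA := 'cV[R]_(vd_dim V).
Implicit Types (x y z v u : AA) (b : bool) (i j : I) (J : {set I}).

(* Germs at infinity, for the sign b: of the chamber {sform b j > 0}, and, in
   the direction of its i-th facet, of the strip and of the wall of level k.
   They do not depend on base points, since [deep] sets are cofinal. *)
Definition deep b i (l : R) : set AA := [set y | forall j, j != i -> l <= sform b j y].

Definition sector_filter b : set_system AA :=
  [set E | exists l : R, forall y, (forall j, l <= sform b j y) -> E y].

Definition strip_filter b i (k : int) : set_system AA :=
  [set E | exists l : R, forall y, k%:~R <= sform b i y <= (k + 1)%:~R -> deep b i l y -> E y].

Definition wall_filter b i (k : int) : set_system AA :=
  [set E | exists l : R, forall y, sform b i y = k%:~R -> deep b i l y -> E y].

Lemma signed_cone_closure b J u : closure (signed_cone b J) u ->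
  (forall j, j \in J -> sform b j u = 0) /\ forall j, 0 <= sform b j u.
Proof.
move=> cu; have u0 j : 0 <= sform b j u.
  rewrite sformE; apply: evalf_closure cu => v /signed_coneE[v0 vp].
  by rewrite -sformE; have [/v0->|/vp/ltW] := boolP (j \in J).
split=> // j jJ; apply/eqP; rewrite eq_le u0 andbT -oppr_ge0 sformE -evalfNl.
apply: evalf_closure cu => v /signed_coneE[v0 vp].
by rewrite evalfNl -sformE v0// oppr0.
Qed.

Lemma face_at_enclosed x Fv Q Om : enclosed Q -> nbhs x Om ->
  (forall v, Fv v -> Om (x + v) -> Q (x + v)) -> face_at V x Fv Q.
Proof.
move=> [k [kz ->]] xOm FQ; exists k, (fun=> +oo%E), Om; split=> //.
- by move=> a aD; split; [exact: kz|left].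
- move=> y [Omy [_ -> [v Fvv vy]]] a aD; rewrite -vy in Omy *; split.
    exact: FQ.
  by rewrite /open_halfspace /= addey ?ltey.
- by move=> y yB a aD; have [] := yB a aD.
Qed.

Lemma chimney_germ_intro x J J' b E Q E0 Om u :
  signed_cone b J' u -> enclosed Q -> Q `<=` E -> enclosed E0 -> nbhs x Om ->
  (forall v, signed_cone b J v -> Om (x + v) -> E0 (x + v)) ->
  (forall e v, E0 e -> signed_cone b J' v -> Q (e + u + v)) ->
  chimney_germ V (face_at V x (signed_cone b J)) (signed_cone b J') E.
Proof.
move=> uJ' [k [kz QE]] QsE encE0 xOm E0in E0Q; exists u.
  exact: subset_closure.
exists k; rewrite -QE; split=> //.
exists (sum_set V E0 [set u]).
  by exists E0 => //; exact: face_at_enclosed xOm E0in.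
by move=> _ [_ [e E0e [_ -> <-]] [v vJ' <-]]; exact: E0Q.
Qed.

Lemma chimney_germ_elim x J J' b E :
  chimney_germ V (face_at V x (signed_cone b J)) (signed_cone b J') E ->
  exists Q u, [/\ enclosed Q, Q `<=` E, closure (signed_cone b J') u &
    exists2 e : R, 0 < e & forall t v, 0 < t -> t < e -> signed_cone b J' v ->
      Q (x + t *: cone_point b J + u + v)].
Proof.
move=> [u cu [k [kz [E1 [E0 [l [l' [Om [_ xOm OmB BE0]]]]] sE0] sQ] QE]].
exists (\bigcap_(a in all_root V) halfspace V a (k a)), u; split=> //.
  by exists k.
have [e e0 eOm] := nbhs_line (cone_point b J) xOm.
exists e => // t v t0 te vJ'; apply: sQ; exists (x + t *: cone_point b J + u).
  apply: sE0; exists (x + t *: cone_point b J); last by exists u.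
  apply/BE0/OmB; split; first by apply: eOm; rewrite gtr0_norm.
  exists x => //; exists (t *: cone_point b J) => //.
  by apply: signed_coneZ => //; exact: cone_point_in.
by exists v.
Qed.

Definition level_point b i (k : int) : AA := k%:~R *: cone_point b [set~ i]%SET.

Lemma sform_level_self b i k : sform b i (level_point b i k) = k%:~R.
Proof. by rewrite sformZ sform_point !inE eqxx mulr1. Qed.

Lemma sform_level b i j k : j != i -> sform b j (level_point b i k) = 0.
Proof. by move=> ji; rewrite sformZ sform_point !inE ji mulr0. Qed.

Lemma chimney_sector b :
  chimney_germ V (face_at V 0 (signed_cone b finset.set0)) (signed_cone b finset.set0)
  = sector_filter b.
Proof.
apply/seteqP; split=> E.
  move=> /chimney_germ_elim[Q [u [encQ QE _ [e e0 eQ]]]].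
  pose p : AA := cone_point b finset.set0.
  have e2 : 0 < e / 2 < e by lra.
  case/andP: e2 => e20 e2e.
  have yQ v : signed_cone b finset.set0 v -> Q (0 + (e / 2) *: p + u + v).
    by move=> v0; apply: eQ.
  have zQ := yQ p (cone_point_in _ _).
  have [m zm] := finite_upper_bound (fun j => sform b j (0 + (e / 2) *: p + u + p)).
  exists m => y ym; apply: QE; rewrite -[y](subrKC (0 + (e / 2) *: p + u + p)).
  apply: (enclosed_recession encQ yQ zQ) => j.
    by rewrite finset.in_set0.
  by move=> _; rewrite sformB subr_ge0 (le_trans (zm j)).
move=> [l lE]; have [m lm] := int_above l.
have [n mn] := int_above `|m%:~R + 1 : R|.
apply: (@chimney_germ_intro _ _ _ _ _ [set y | forall j, predT j -> m%:~R <= sform b j y]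
  [set y | forall j, predT j -> (0 : int)%:~R <= sform b j y] setT
  ((n%:~R + 1) *: cone_point b finset.set0)) => //.
- apply: signed_coneZ; first exact: cone_point_in.
  by rewrite ltr_wpDl// (le_trans _ mn).
- exact: (enclosed_forms b predT).
- by move=> y my; apply: lE => j; apply: le_trans lm _; exact: my.
- exact: (enclosed_forms b predT).
- exact: filterT.
- move=> v /signed_coneE[_ vp] _ j _; rewrite add0r ltW// vp//.
  by rewrite finset.in_set0.
- move=> e v ep /signed_coneE[_ vp] j _; rewrite !sformD sformZ sform_point.
  rewrite finset.in_set0 mulr1; have := ep j isT; have := vp j; rewrite finset.in_set0 => /(_ isT).
  by have := ler_norm (m%:~R + 1 : R); rewrite mulr0z; lra.
Qed.

Lemma enclosed_strip b i (k k' m : int) :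
  enclosed ([set y | k%:~R <= sform b i y <= k'%:~R] `&` deep b i m%:~R).
Proof.
apply: enclosedI; last exact: (enclosed_forms b (fun j => j != i)).
have := enclosedI (enclosed_forms b (pred1 i) k) (enclosed_forms (~~ b) (pred1 i) (- k')).
congr enclosed; apply/seteqP; split=> y /=.
  move=> [/(_ i (eqxx i)) h1 /(_ i (eqxx i))]; rewrite sform_negb intrN lerN2 => h2.
  by rewrite h1.
move=> /andP[h1 h2]; split=> j /eqP -> //.
by rewrite sform_negb intrN lerN2.
Qed.

Lemma chimney_strip_intro b i (k k' : int) J E (l : R) : J \subset [set i]%SET ->
  (forall y, k%:~R <= sform b i y <= k'%:~R -> deep b i l y -> E y) ->
  k < k' \/ k = k' /\ i \in J ->
  chimney_germ V (face_at V (level_point b i k) (signed_cone b J)) (signed_cone b [set i]%SET) E.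
Proof.
move=> Ji lE kk'; have [m lm] := int_above l; have [n mn] := int_above `|m%:~R : R|.
set K := [set y | k%:~R <= sform b i y <= k'%:~R].
have iJ j : j != i -> j \notin J.
  by move=> ji; apply: contra ji => /(fintype.subsetP Ji); rewrite finset.in_set1.
(* When k < k', the upper bound holds strictly at the base point and defines a neighbourhood; when k
   = k' the face lies in the wall and the whole space serves. The multiple n + 1 pushes the face
   beyond depth m. *)
apply: (@chimney_germ_intro _ _ _ _ _ (K `&` deep b i m%:~R)
  (K `&` deep b i (0 : int)%:~R)
  [set y | k = k' \/ - k'%:~R < evalf V (- signed_root b i) y]
  ((n%:~R + 1) *: cone_point b [set i]%SET)).
- apply: signed_coneZ; first exact: cone_point_in.
  by rewrite ltr_wpDl// (le_trans _ mn).
- exact: enclosed_strip.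
- by move=> y [Ky ym]; apply: lE => // j /ym; exact: le_trans.
- exact: enclosed_strip.
- case: kk' => [kk'|[-> _]].
    apply: filterS (_ : nbhs _ [set y | - k'%:~R < evalf V (- signed_root b i) y]).
      by move=> y; right.
    by apply: nbhs_form_gt; rewrite evalfNl -sformE sform_level_self ltrN2 ltr_int.
  by apply: filterS filterT => y _; left.
- move=> v /signed_coneE[v0 vp] /= near_v; split; last first.
    move=> j ji; rewrite sformD sform_level// mulr0z add0r ltW// vp//.
    exact: iJ.
  rewrite /K /= sformD sform_level_self lerDl.
  case: kk' near_v => [kk'|[-> iJ'] _]; last by rewrite v0// lexx addr0 lexx.
  have vi : 0 <= sform b i v by have [/v0->|/vp/ltW] := boolP (i \in J).
  rewrite vi => -[kk|]; first by rewrite kk ltxx in kk'.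
  by rewrite evalfNl -sformE sformD sform_level_self ltrN2 => /ltW.
- move=> e v [Ke e0] /signed_coneE[v0 vp]; split.
    by rewrite /K /= !sformD sformZ sform_point v0 ?inE ?eqxx// mulr0 !addr0.
  move=> j ji; rewrite !sformD sformZ sform_point inE ji mulr1.
  have := e0 j ji; have := vp j; rewrite finset.in_set1 ji => /(_ isT).
  by have := ler_norm (m%:~R : R); rewrite mulr0z; lra.
Qed.

Lemma chimney_wall b i k :
  chimney_germ V (face_at V (level_point b i k) (signed_cone b [set i]%SET))
    (signed_cone b [set i]%SET)
  = wall_filter b i k.
Proof.
apply/seteqP; split=> E; last first.
  move=> [l lE]; apply: (@chimney_strip_intro _ _ k k _ _ l) => //.
    by move=> y; rewrite -eq_le => /eqP/esym; exact: lE.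
  by right; split=> //; rewrite finset.in_set1.
move=> /chimney_germ_elim[Q [u [encQ QE /signed_cone_closure[u0 _] [e e0 eQ]]]].
have /andP[e20 e2e] : 0 < e / 2 < e by lra.
pose p : AA := cone_point b [set i]%SET.
pose z := level_point b i k + (e / 2) *: p + u + p.
have yQ v : signed_cone b [set i]%SET v -> Q (level_point b i k + (e / 2) *: p + u + v).
  by move=> v0; apply: eQ.
have zQ : Q z := yQ p (cone_point_in _ _).
have zi : sform b i z = k%:~R.
  by rewrite !sformD sform_level_self sformZ !sform_point u0 ?finset.in_set1 ?eqxx//= mulr0 !addr0.
have [m zm] := finite_upper_bound (fun j => sform b j z).
exists m => y yi ym; apply: QE; rewrite -[y](subrKC z).
apply: (enclosed_recession encQ yQ zQ) => j; rewrite finset.in_set1 => ji.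
  by rewrite (eqP ji) sformB yi zi subrr.
by rewrite sformB subr_ge0 (le_trans (zm j))// ym.
Qed.

(* The coefficients of a root positive on the facet are all of the same sign,
   and only the roots +-alpha_i can bound the strip, at integral levels. *)
Lemma chimney_strip b i k :
  chimney_germ V (face_at V (level_point b i k) (signed_cone b finset.set0))
    (signed_cone b [set i]%SET)
  = strip_filter b i k.
Proof.
apply/seteqP; split=> E; last first.
  move=> [l lE]; apply: (@chimney_strip_intro _ _ k (k + 1) _ _ l) => //.
    by rewrite finset.sub0set.
  by left; rewrite ltrDl.
move=> /chimney_germ_elim[Q [u [encQ QE /signed_cone_closure[u0 _] [e e0 eQ]]]].
pose p : AA := cone_point b [set i]%SET.
pose q : AA := cone_point b finset.set0.
pose z := level_point b i k + u + p.
have u_i : sform b i u = 0 by rewrite u0 ?finset.in_set1.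
have zi : sform b i z = k%:~R.
  by rewrite !sformD sform_level_self sform_point u_i finset.in_set1 eqxx/= !addr0.
have eQ' t v : 0 < t -> t < e -> signed_cone b [set i]%SET v ->
    Q (level_point b i k + u + v + t *: q).
  move=> t0 te vi; rewrite addrC addrA [t *: q + _]addrC -addrA addrACA.
  by have := eQ t v t0 te vi; rewrite -!addrA.
have zQ : Q z.
  apply: (enclosed_limit encQ (v := q)); exists e => // t t0 te.
  by apply: eQ' => //; exact: cone_point_in.
pose t := Num.min (e / 2) (2^-1).
have t0 : 0 < t by rewrite lt_min; apply/andP; split; lra.
have te : t < e by rewrite gt_min; apply/orP; left; lra.
have t1 : t < 1 by rewrite gt_min; apply/orP; right; lra.
have yQ v : signed_cone b [set i]%SET v -> Q (level_point b i k + t *: q + u + v).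
  by move=> v0; apply: eQ.
have ztQ : Q (z + t *: q) by apply: eQ' => //; exact: cone_point_in.
have [m zm] := finite_upper_bound (fun j => sform b j z).
exists m => y /andP[yk yk1] ym; apply: QE.
case: (encQ) => l [lz QE]; move: yQ zQ ztQ; rewrite {}QE => yQ zQ ztQ a aD.
have [->|[h hl]] := lz a aD; first by rewrite halfspace_infty.
have Qa x : (\bigcap_(a0 in all_root V) halfspace V a0 (l a0)) x -> 0 <= evalf V a x + h%:~R.
  by move=> /(_ a aD); rewrite hl => /halfspace_fin.
rewrite hl; apply/halfspace_fin.
have [n [s s1 [aE n0 ni]]] := all_root_sign aD.
have signs : (-1) ^+ b * s%:~R = 1 :> R \/ (-1) ^+ b * s%:~R = -1 :> R.
  by case: (b) s1 => -[->|->]; rewrite ?expr0 ?expr1 ?mulN1r ?mul1r ?rmorphN1 ?opprK;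
    [right|left|left|right].
have bb : (-1) ^+ b * (-1) ^+ b = 1 :> R by rewrite -expr2 sqrr_sign.
have aform x : evalf V a x = \sum_j ((-1) ^+ b * (n j)%:~R) * sform b j x.
  rewrite aE evalf_suml; apply: eq_bigr => j _; rewrite evalfZl /sform.
  by rewrite mulrACA -mulrA mulrA bb mul1r.
have [supp|] := pselect (forall j, j != i -> n j = 0).
  have ax x : evalf V a x = (-1) ^+ b * s%:~R * sform b i x.
    rewrite aform (bigD1 i) //= ni// big1 ?addr0// => j /supp->.
    by rewrite mulr0z mulr0 mul0r.
  have azt := Qa _ ztQ; rewrite ax in azt *; have az := Qa _ zQ; rewrite ax in az.
  have zt : sform b i (z + t *: q) = k%:~R + t.
    by rewrite sformD zi sformZ sform_point finset.in_set0 mulr1.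
  rewrite zt in azt; rewrite zi in az; rewrite ax.
  case: signs => bs.
  - by move: az; rewrite bs !mul1r; lra.
  (* Here [a] is minus the i-th signed form. The point of [Q] at level k + t excludes h = k, and h
     is an integer, so the bound cannot cut the strip below level k + 1. *)
  - have : (k : int) < h.
      by rewrite -(ltr_int R); move: azt; rewrite bs; lra.
    rewrite bs mulN1r => kh; have : (k + 1)%:~R <= h%:~R :> R by rewrite ler_int addrC lez1D.
    by lra.
move=> /existsNP[j0 /not_implyP[j0i /eqP nj0]].
have ge0 v := enclosed_finite yQ Qa (v := v).
(* [a] is nonnegative on the facet and has a nonzero coefficient outside i, so its sign is that of
   the cone. It then increases with every signed form, and y dominates z. *)
have bs j : 0 <= (-1) ^+ b * (n j)%:~R :> R.
  have sn j' : 0 <= s%:~R * (n j')%:~R :> R by rewrite -intrM ler0z.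
  have s0 : s%:~R != 0 :> R by rewrite intr_eq0; case: s1 => ->.
  have ss : s%:~R * s%:~R = 1 :> R by rewrite -intrM; case: s1 => ->.
  have := ge0 p; rewrite aform => h0.
  have {h0} : 0 <= (-1) ^+ b * s%:~R * (\sum_(j | j != i) s%:~R * (n j)%:~R) :> R.
    rewrite mulr_sumr; apply: le_trans (h0 _ _) _.
    + by move=> j' ij'; rewrite sform_point ij'.
    + by move=> j' ij'; rewrite sform_point ler0n.
    rewrite (bigD1 i) //= sform_point finset.in_set1 eqxx mulr0 add0r.
    apply: ler_sum => j' ij'; rewrite sform_point finset.in_set1 ij' mulr1.
    by rewrite mulrACA -mulrA (mulrA s%:~R) ss mul1r.
  rewrite pmulr_lge0; last first.
    rewrite (bigD1 j0) //= ltr_pwDl// ?sumr_ge0// lt_def sn andbT.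
    by rewrite mulf_neq0// intr_eq0//; case: s1 => ->.
  case: signs => bs.
  - move=> _; have -> : (-1) ^+ b = s%:~R :> R by apply: (mulIf s0); rewrite bs ss.
    exact: sn.
  - by rewrite bs oppr_ge0 ler10.
apply: le_trans (Qa _ zQ) _; rewrite lerD2r !aform; apply: ler_sum => j _.
rewrite ler_wpM2l//; have [->|ji] := eqVneq j i; first by rewrite zi.
by apply: le_trans (zm j) _; exact: ym.
Qed.

End Chimneys.

(** * The chimneys above are splayed, and solid when based on a chamber *)

Section SolidSplayed.
Context {R : realType} (V : vectorial_data R).
Local Notation I := (vd_index V).
Local Notation AA := 'cV[R]_(vd_dim V).
Implicit Types (x y z v u : AA) (b : bool) (i j : I) (J : {set I}).

Lemma splayed_sector b (i : I) : splayed_chimney_germ V (sector_filter (V := V) b).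
Proof.
exists (face_at V 0 (signed_cone b finset.set0)), (signed_cone b finset.set0).
split; last by rewrite chimney_sector.
- by exists 0, (signed_cone b finset.set0); split=> //; exact: signed_cone_face.
- exact: signed_cone_face.
- by apply: (signed_cone_spherical _ (i := i)); rewrite finset.sub0set.
Qed.

Lemma splayed_strip b i k : splayed_chimney_germ V (strip_filter b i k).
Proof.
exists (face_at V (level_point b i k) (signed_cone b finset.set0)), (signed_cone b [set i]%SET).
split; last by rewrite chimney_strip.
- by do 2 eexists; split; last reflexivity; exact: signed_cone_face.
- exact: signed_cone_face.
- by apply: (signed_cone_spherical _ (i := i)).
Qed.

Lemma splayed_wall b i k : splayed_chimney_germ V (wall_filter b i k).
Proof.
exists (face_at V (level_point b i k) (signed_cone b [set i]%SET)), (signed_cone b [set i]%SET).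
split; last by rewrite chimney_wall.
- by do 2 eexists; split; last reflexivity; exact: signed_cone_face.
- exact: signed_cone_face.
- by apply: (signed_cone_spherical _ (i := i)).
Qed.

Lemma affine_subspace_open S (p q : AA) (U : set AA) : affine_subspace V S ->
  nbhs p U -> (forall y, U y -> S (y + q)) -> S = setT.
Proof.
move=> [_ aff] pU US; apply/seteqP; split=> // y _.
have [e e0 eU] := nbhs_line (y - q - p) pU.
have Sp : S (p + q) by apply: US; have := eU 0; rewrite normr0 scale0r addr0; exact.
have Sq : S (p + (e / 2) *: (y - q - p) + q) by apply/US/eU; rewrite gtr0_norm; lra.
have -> : y = p + q + (2 / e) *: (p + (e / 2) *: (y - q - p) + q - (p + q)).
  by apply/colP => l; rewrite !mxE; field; lra.
exact: aff.
Qed.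

(** Every set of the chimney contains a nonempty open set, so the support is all of [AA] and only
    the identity fixes its direction. *)
Lemma solid_chimney_cone x b J : solid V
  (chimney V (face_at V x (signed_cone b finset.set0)) (signed_cone b J)).
Proof.
exists setT; last first.
  apply: (@sub_finite_set _ _ [set 1%:M]); last exact: finite_set1.
  move=> w [_ /= wid]; apply/matrixP => i j.
  have := wid 0 (delta_mx j 0) Logic.I Logic.I; rewrite subr0 -colE => /colP/(_ i).
  by rewrite !mxE eqxx andbT.
split=> //; first by split; [exists 0|].
  exists setT => //; exists (fun=> +oo%E); split=> //; first by left.
  exists setT; last by move=> y _ a _; rewrite halfspace_infty.
  by exists (fun=> +oo%E), (fun=> +oo%E), setT; split=> //;
    [move=> a _; split; left|exact: filterT|move=> y _ a _; rewrite halfspace_infty;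
     split=> //; rewrite /open_halfspace /= addey ?ltey].
move=> S affS [E [k [_ [E0 [l [l' [Om [_ xOm OmB BE0]]]] sumQ] QE]] ES].
have E0S v v' : signed_cone b finset.set0 v -> Om (x + v) -> signed_cone b J v' -> S (x + v + v').
  move=> v0 Omv vJ; apply/ES/QE/sumQ; exists (x + v); last by exists v'.
  by apply/BE0/OmB; split=> //; exists x => //; exists v.
have [e e0 eOm] := nbhs_line (cone_point b finset.set0) (nbhs_interior xOm).
pose p := x + (e / 2) *: cone_point b finset.set0.
have pj j : evalf V (signed_root b j) x < evalf V (signed_root b j) p.
  by rewrite -!sformE sformD sformZ sform_point finset.in_set0 mulr1 ltrDl divr_gt0.
suff -> : S = setT by []; apply: (@affine_subspace_open _ p (cone_point b J) (interior Om `&`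
  [set y | forall j, evalf V (signed_root b j) x < evalf V (signed_root b j) y])) => //.
  apply: filterI.
    by apply: open_nbhs_nbhs; split; [exact: open_interior|apply: eOm; rewrite gtr0_norm; lra].
  apply: (@filter_forall _ I (fun j => [set y | evalf V (signed_root b j) x <
    evalf V (signed_root b j) y]) (nbhs p) (nbhs_filter p)) => j.
  exact: nbhs_form_gt.
move=> y [Omy yp]; rewrite -(subrKC x y); apply: E0S.
- apply/signed_coneE; split=> j; rewrite ?finset.in_set0 // => _.
  by rewrite sformB subr_gt0 !sformE.
- by rewrite subrKC; exact: interior_subset.
- exact: cone_point_in.
Qed.

End SolidSplayed.

(** * The affine Weyl group *)

Section AffineWeyl.
Context {R : realType} (V : vectorial_data R).
Local Notation I := (vd_index V).
Local Notation AA := 'cV[R]_(vd_dim V).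
Local Notation ro := (simple_root V).
Local Notation co := (simple_coroot V).
Local Notation r := (simple_refl V).
Local Notation c := (vd_cartan (v := V)).
Implicit Types (x y z v u : AA) (b : bool) (i j : I) (J : {set I}) (k : int).

Definition wall_refl b i k y : AA := r i *m y + k%:~R *: ((-1) ^+ b *: co i).

Lemma wall_reflE b i k y :
  wall_refl b i k y = y - (sform b i y - k%:~R) *: ((-1) ^+ b *: co i).
Proof.
rewrite /wall_refl refl_mul [in RHS]scalerBl opprB addrCA addrC; congr (_ + _ + _).
by rewrite scalerA /sform mulrAC -expr2 sqrr_sign mul1r.
Qed.

Lemma wall_refl_weyl b i k : affine_weyl V (wall_refl b i k).
Proof.
exists (r i), (k%:~R *: ((-1) ^+ b *: co i)); split=> //; first exact: weyl_refl.
exists (fun j => k * (-1) ^+ b * (j == i)%:R).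
rewrite (bigD1 i) //= big1 => [|j /negPf->]; last by rewrite mulr0 scale0r.
by rewrite addr0 eqxx mulr1 scalerA intrM rmorphXn /= rmorphN1.
Qed.

Lemma sform_coroot b i j : sform b j ((-1) ^+ b *: co i) = (c i j)%:~R.
Proof. by rewrite sformZ /sform mulrA -expr2 sqrr_sign mul1r simple_root_coroot. Qed.

Lemma sform_wall_refl b i j k y :
  sform b j (wall_refl b i k y) = sform b j y - (sform b i y - k%:~R) * (c i j)%:~R.
Proof. by rewrite wall_reflE sformB sformZ sform_coroot. Qed.

Lemma sform_wall_refl_self b i k y : sform b i (wall_refl b i k y) = 2 * k%:~R - sform b i y.
Proof. by rewrite sform_wall_refl cartan_diag; ring. Qed.

Lemma wall_reflK b i k : involutive (wall_refl b i k).
Proof.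
move=> y; rewrite [LHS]wall_reflE sform_wall_refl_self.
have -> : 2 * k%:~R - sform b i y - k%:~R = - (sform b i y - k%:~R) by ring.
by rewrite scaleNr opprK wall_reflE subrK.
Qed.

(** From above the wall, the reflection subtracts a nonnegative multiple of the coroot, on which the
    other forms are nonpositive. *)
Lemma wall_refl_deep b i k l y : k%:~R <= sform b i y -> deep b i l y ->
  deep b i l (wall_refl b i k y).
Proof.
move=> ky yl j ji; rewrite sform_wall_refl; apply: le_trans (yl j ji) _.
rewrite lerDl oppr_ge0 mulr_ge0_le0 ?subr_ge0// lerz0.
by apply: cartan_le0; rewrite eq_sym.
Qed.

(* A deep point of the wall differs from a nearby one by a vector of the open
   facet, whose stabilizer in the Weyl group is {1, r_i}. *)
Lemma affine_weyl_fix_wall b i k w : affine_weyl V w ->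
  wall_filter b i k [set y | w y = y] -> w = id \/ w = wall_refl b i k.
Proof.
move=> [w0 [t [Ww0 _ wE]]] [l lE].
pose p := cone_point b [set i]%SET.
have lev m : l <= m -> w0 *m (level_point b i k + m *: p) + t = level_point b i k + m *: p.
  move=> lm; have := lE (level_point b i k + m *: p); rewrite /= wE; apply.
    by rewrite sformD sform_level_self sformZ sform_point finset.in_set1 eqxx mulr0 addr0.
  move=> j ji; rewrite sformD sform_level// sformZ sform_point finset.in_set1 ji.
  by rewrite add0r mulr1.
have w0p : w0 *m p = p.
  have := lev (l + 1); rewrite lerDl => /(_ ler01) h1.
  have h2 := lev l (lexx _); rewrite scalerDl scale1r !addrA mulmxDr [LHS]addrAC h2 in h1.
  exact: addrI h1.
pose q := cone_point false [set i]%SET.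
have w0q : w0 *m q = q.
  by move: w0p; rewrite /p /q /cone_point -scalemxAr expr0 scale1r => /(can_inj (signrZK b)).
have qj j : evalf V (ro j) q = (j != i)%:R.
  by have := sform_point false [set i]%SET j; rewrite /sform expr0 mul1r finset.in_set1.
have [||||w01|w0r] := @weyl_fix_facet _ V i w0 [set q] Ww0.
- by move=> _ ->; rewrite qj eqxx.
- by move=> _ j ->; rewrite qj ler0n.
- by move=> _ ->; exists q => // j; rewrite qj ler0n.
- by move=> j ji; exists q => //; rewrite qj ji oner_eq0.
- left; have := lev l (lexx _); rewrite w01 mul1mx -[RHS]addr0 => /addrI t0.
  by rewrite wE w01 t0; apply/funext => y; rewrite mul1mx addr0.
- right; have := lev l (lexx _); rewrite w0r refl_mul -[RHS]addr0 -addrA => /addrI /eqP.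
  rewrite addrC subr_eq0 => /eqP tE.
  have yk : sform b i (level_point b i k + l *: p) = k%:~R.
    by rewrite sformD sform_level_self sformZ sform_point finset.in_set1 eqxx mulr0 addr0.
  rewrite wE w0r tE; apply/funext => y.
  by rewrite /wall_refl -yk [in RHS]scalerA /sform mulrAC -expr2 sqrr_sign mul1r.
Qed.

(** Of the two maps fixing the lower wall at infinity, the reflection moves the points of level k +
    1. *)
Lemma affine_weyl_fix_strip b i k w : affine_weyl V w ->
  strip_filter b i k [set y | w y = y] -> w = id.
Proof.
move=> Ww [l lE]; have k1 : (k%:~R : R) <= (k + 1)%:~R by rewrite ler_int lerDl.
have [|//|wr] := affine_weyl_fix_wall (b := b) (i := i) (k := k) Ww.
  by exists l => y yk yl; apply: lE => //; rewrite yk lexx k1.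
pose y := level_point b i (k + 1) + l *: cone_point b [set i]%SET.
have yi : sform b i y = (k + 1)%:~R.
  by rewrite sformD sform_level_self sformZ sform_point finset.in_set1 eqxx mulr0 addr0.
have : w y = y.
  apply: lE; first by rewrite yi lexx k1.
  move=> j ji; rewrite sformD sform_level// sformZ sform_point finset.in_set1 ji.
  by rewrite add0r mulr1.
rewrite wr => /(congr1 (sform b i)); rewrite sform_wall_refl_self yi intrD.
rewrite mulr1z => h; have {h} : 2 * k%:~R - (k%:~R + 1) - (k%:~R + 1) = 0 :> R by rewrite h subrr.
have -> : 2 * k%:~R - (k%:~R + 1) - (k%:~R + 1) = - 2 :> R by ring.
by move/eqP; rewrite oppr_eq0 pnatr_eq0.
Qed.

Lemma real_root_coroot_self a av : real_root_coroot V a av -> evalf V a av = 2.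
Proof.
move=> [w [i [Ww -> ->]]]; rewrite /dual_act evalf_mul mulmxKV ?weyl_unit//.
by rewrite simple_root_coroot cartan_diag.
Qed.

Lemma weyl_root_coroot w a av : weyl V w -> real_root_coroot V a av ->
  real_root_coroot V (dual_act V w a) (w *m av).
Proof.
move=> Ww [u [i [Wu -> ->]]]; exists (w *m u), i; split; last by rewrite mulmxA.
  exact: weyl_mul.
rewrite /dual_act -mulmxA; congr (_ *m _).
have wu := weyl_unit Ww; have uu := weyl_unit Wu.
have wuu : w *m u \in unitmx by rewrite unitmx_mul wu.
have E : invmx u *m invmx w *m (w *m u) = 1%:M.
  by rewrite -mulmxA (mulmxA (invmx w)) mulVmx// mul1mx mulVmx.
by rewrite -[LHS](mulmxK wuu) E mul1mx.
Qed.

Lemma weyl_coroot_lattice w t : weyl V w -> coroot_lattice V t ->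
  coroot_lattice V (w *m t).
Proof.
move=> /weyl_word[s ->]; elim: s => [|i s IHs] in t * => tQ; first by rewrite mul1mx.
rewrite /= -mulmxA refl_mul; have [n ->] := IHs t tQ.
exists (fun j => n j - (\sum_l n l * c l i) * (j == i)%:R).
under [RHS]eq_bigr => j _ do rewrite intrD intrN scalerDl.
rewrite big_split; congr (_ + _) => /=.
rewrite [RHS](bigD1 i) //= [X in _ + X]big1 => [|j /negPf->]; last first.
  by rewrite mulr0 oppr0 scale0r.
rewrite addr0 eqxx mulr1 scaleNr; congr (- (_ *: _)).
rewrite evalf_sum rmorph_sum; apply: eq_bigr => j _.
by rewrite evalfZ simple_root_coroot /= intrM.
Qed.

Lemma coroot_lattice_root_int a : real_root V a -> forall t, coroot_lattice V t ->
  exists m : int, evalf V a t = m%:~R.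
Proof.
move=> [_ [w [i [Ww -> _]]]] t tQ; rewrite /dual_act -evalf_mul.
have [n ->] := weyl_coroot_lattice (weyl_inv V _ Ww) tQ.
exists (\sum_j n j * c j i); rewrite evalf_sum rmorph_sum; apply: eq_bigr => j _.
by rewrite evalfZ simple_root_coroot /= intrM.
Qed.

Lemma image_hyperplane w t a (k : R) : w \in unitmx ->
  (fun x => w *m x + t) @` hyperplane V a k =
  hyperplane V (dual_act V w a) (k - evalf V (dual_act V w a) t).
Proof.
move=> wu; apply/seteqP; split=> [_ [x xk <-]|y yk].
  by move: xk; rewrite /hyperplane /= => <-; rewrite evalfD evalf_mul /dual_act mulmxKV//; ring.
exists (invmx w *m (y - t)); last by rewrite mulKVmx// subrK.
move: yk; rewrite /hyperplane /dual_act /= evalf_mul evalfB => <-.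
by rewrite -addrA (addrC (- _)).
Qed.

Lemma image_halfspace w t a (k : R) : w \in unitmx ->
  (fun x => w *m x + t) @` halfspace V a k%:E =
  halfspace V (dual_act V w a) (k - evalf V (dual_act V w a) t)%:E.
Proof.
move=> wu; apply/seteqP; split=> [_ [x /halfspace_fin xk <-]|y /halfspace_fin yk].
  apply/halfspace_fin; move: xk; congr (_ <= _).
  by rewrite evalfD evalf_mul /dual_act mulmxKV//; ring.
exists (invmx w *m (y - t)); last by rewrite mulKVmx// subrK.
apply/halfspace_fin; move: yk; rewrite /dual_act evalf_mul evalfB.
by rewrite -addrA (addrC (- _)).
Qed.

Lemma affine_weyl_wall w t H av : weyl V w -> coroot_lattice V t ->
  wall_coroot V H av -> wall_coroot V ((fun x => w *m x + t) @` H) (w *m av).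
Proof.
move=> Ww tQ [a [k [aav ->]]].
have aav' := weyl_root_coroot Ww aav.
have [|m Em] := coroot_lattice_root_int (a := dual_act V w a) _ tQ.
  by exists (w *m av).
exists (dual_act V w a), (k - m); split=> //.
by rewrite image_hyperplane ?weyl_unit// Em intrB.
Qed.

Lemma affine_weyl_aut w : affine_weyl V w -> vectorially_weyl_aut V w.
Proof.
move=> [w0 [t [Ww tQ ->]]]; split; first by exists w0, t.
exists w0, t; split=> //; first exact: weyl_unit.
move=> H av; split; first exact: affine_weyl_wall.
move=> /(affine_weyl_wall (weyl_inv V _ Ww) (t := - (invmx w0 *m t))).
rewrite mulKmx ?weyl_unit// => h.
have <- : (fun x => invmx w0 *m x - invmx w0 *m t) @` ((fun x => w0 *m x + t) @` H) = H.
  rewrite image_comp -[RHS]image_id; congr (_ @` H); apply/funext => x /=.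
  by rewrite mulmxDr mulKmx ?weyl_unit// addrK.
apply: h; have [n ->] := weyl_coroot_lattice (weyl_inv V _ Ww) tQ.
exists (fun i => - n i); rewrite -sumrN; apply: eq_bigr => i _.
by rewrite intrN scaleNr.
Qed.

Lemma affine_weyl_refl i : affine_weyl V (fun y => r i *m y).
Proof.
have := wall_refl_weyl false i 0; congr (affine_weyl _ _); apply/funext => y.
by rewrite /wall_refl mulr0z scale0r addr0.
Qed.

(** The translation part is an arbitrary real vector, so the integrality of the new level is at
    stake. The image wall comes with its coroot, hence is also given by a root with that coroot at
    an integral level; two affine forms with the same zeros whose linear parts take the value 2 on
    the same vector are equal. *)
Lemma vectorially_weyl_aut_half w H : vectorially_weyl_aut V w ->
  half_apartment V H -> half_apartment V (w @` H).
Proof.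
move=> [[w0 [t [Ww _ ->]]] [m [t' [_ mE wall_iff]]]] [a [k [[av aav] ->]]].
have mav : m *m av = w0 *m av.
  have := congr1 (fun g : AA -> AA => g 0) mE; rewrite /= !mulmx0 !add0r => tt'.
  by have := congr1 (fun g : AA -> AA => g av) mE; rewrite /= tt' => /addIr.
have aw := weyl_root_coroot Ww aav.
set a' := dual_act V w0 a in aw; set k' := k%:~R - evalf V a' t.
have [a1 [l [a1av hyp]]] : wall_coroot V (hyperplane V a' k') (w0 *m av).
  rewrite -mav -image_hyperplane ?weyl_unit//; apply: (proj1 (wall_iff _ _)).
  by exists a, k.
have a1a' y : evalf V a1 y + l%:~R = evalf V a' y + k'.
  (* The projection of y onto the wall along the coroot. *)
  pose z := y - ((evalf V a' y + k') / 2) *: (w0 *m av).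
  have : hyperplane V a' k' z.
    by rewrite /hyperplane /= evalfB evalfZ (real_root_coroot_self aw) divfK ?pnatr_eq0//; ring.
  rewrite hyp /hyperplane /= evalfB evalfZ (real_root_coroot_self a1av) divfK//.
  by lra.
have lk : l%:~R = k' by have := a1a' 0; rewrite !evalf0 !add0r.
exists a', l; rewrite image_halfspace ?weyl_unit// lk; split=> //.
by exists (w0 *m av).
Qed.

Lemma vectorially_weyl_aut_comp w w' : vectorially_weyl_aut V w ->
  vectorially_weyl_aut V w' -> vectorially_weyl_aut V (w \o w').
Proof.
move=> [[u [t [Wu _ uE]]] [m [s [mu mE miff]]]] [[u' [t' [Wu' _ uE']]] [m' [s' [mu' mE' miff']]]].
split.
  exists (u *m u'), (u *m t' + t); split=> //; first exact: weyl_mul.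
  by rewrite uE uE'; apply/funext => x /=; rewrite mulmxDr mulmxA addrA.
exists (m *m m'), (m *m s' + s); split.
- by rewrite unitmx_mul mu.
- by rewrite mE mE'; apply/funext => x /=; rewrite mulmxDr mulmxA addrA.
- by move=> H av; rewrite miff' miff image_comp mulmxA.
Qed.

End AffineWeyl.

(** * Relations between the germs of sectors, strips and walls *)

Section ChimneyFilters.
Context {R : realType} (V : vectorial_data R).
Local Notation I := (vd_index V).
Local Notation AA := 'cV[R]_(vd_dim V).
Local Notation c := (vd_cartan (v := V)).
Local Notation r := (simple_refl V).
Implicit Types (x y z v u : AA) (b : bool) (i j : I) (k : int) (E Q : set AA).

Definition filter_laws (F : set_system AA) : Prop :=
  (forall E E', F E -> F E' -> F (E `&` E')) /\
  (forall E E', E `<=` E' -> F E -> F E').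

Lemma sector_laws b : filter_laws (sector_filter (V := V) b).
Proof.
split=> [E E' [l lE] [l' lE']|E E' EE' [l lE]]; last by exists l => y /lE/EE'.
exists (Num.max l l') => y ly.
by split; [apply: lE|apply: lE'] => j; apply: le_trans (ly j); rewrite le_max lexx ?orbT.
Qed.

Lemma strip_laws b i k : filter_laws (strip_filter b i k).
Proof.
split=> [E E' [l lE] [l' lE']|E E' EE' [l lE]]; last by exists l => y h1 h2; apply/EE'/lE.
exists (Num.max l l') => y ky ly.
by split; [apply: lE|apply: lE'] => // j ji; apply: le_trans (ly j ji); rewrite le_max lexx ?orbT.
Qed.

Lemma wall_laws b i k : filter_laws (wall_filter b i k).
Proof.
split=> [E E' [l lE] [l' lE']|E E' EE' [l lE]]; last by exists l => y h1 h2; apply/EE'/lE.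
exists (Num.max l l') => y ky ly.
by split; [apply: lE|apply: lE'] => // j ji; apply: le_trans (ly j ji); rewrite le_max lexx ?orbT.
Qed.

Lemma solid_sector b (i : I) : solid_chimney_germ V (sector_filter (V := V) b).
Proof.
exists (face_at V 0 (signed_cone b finset.set0)), (signed_cone b finset.set0).
split; last by rewrite chimney_sector.
- by do 2 eexists; split; last reflexivity; exact: signed_cone_face.
- exact: signed_cone_face.
- exact: solid_chimney_cone.
Qed.

Lemma solid_strip b i k : solid_chimney_germ V (strip_filter b i k).
Proof.
exists (face_at V (level_point b i k) (signed_cone b finset.set0)), (signed_cone b [set i]%SET).
split; last by rewrite chimney_strip.
- by do 2 eexists; split; last reflexivity; exact: signed_cone_face.
- exact: signed_cone_face.
- exact: solid_chimney_cone.
Qed.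

Lemma sector_translate b v E : sector_filter b E ->
  sector_filter b [set y | E (y + v)].
Proof.
move=> [l lE]; have [m mv] := finite_upper_bound (fun j => - sform b j v).
exists (l + m) => y ly; apply: lE => j; rewrite sformD.
by have := ly j; have := mv j; lra.
Qed.

Lemma sector_opp_le b i k : sector_filter (~~ b) [set y | sform b i y <= k%:~R].
Proof. by exists (- k%:~R) => y /(_ i); rewrite sform_negb lerN2. Qed.

Lemma sector_strip b i E : sector_filter b E ->
  exists k0 : int, forall k, k0 <= k -> strip_filter b i k E.
Proof.
move=> [l lE]; have [k0 lk0] := int_above l; exists k0 => k k0k; exists l => y /andP[ky _] ly.
apply: lE => j; have [->|/ly//] := eqVneq j i.
by apply: le_trans lk0 (le_trans _ ky); rewrite ler_int.
Qed.

(** A point z of the wall that is deep enough dominates y in all forms, so y - z lies in the closed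
    opposite cone, a recession direction of [Q]. Hence agreement on a wall and on an opposite sector
    spreads to a whole half-space. *)
Lemma wall_sector_enclosed b i k Q : enclosed Q -> wall_filter b i k Q ->
  sector_filter (~~ b) Q -> forall y, sform b i y <= k%:~R -> Q y.
Proof.
move=> encQ [l lQ] [l' lQ'] y yk.
have [m ym] := finite_upper_bound (fun j => sform b j y).
pose z := level_point b i k + Num.max l m *: cone_point b [set i]%SET.
have zi : sform b i z = k%:~R.
  by rewrite sformD sform_level_self sformZ sform_point finset.in_set1 eqxx mulr0 addr0.
have zj j : j != i -> sform b j z = Num.max l m.
  by move=> ji; rewrite sformD sform_level// sformZ sform_point finset.in_set1 ji mulr1 add0r.
have zQ : Q z by apply: lQ => // j ji; rewrite zj// le_max lexx.
have yQ v : signed_cone (~~ b) finset.set0 v -> Q (l' *: cone_point (~~ b) finset.set0 + v).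
  move=> /signed_coneE[_ vp]; apply: lQ' => j.
  rewrite sformD sformZ sform_point finset.in_set0 mulr1 lerDl ltW// vp//.
  by rewrite finset.in_set0.
rewrite -(subrKC z y); apply: (enclosed_recession encQ yQ zQ) => j.
  by rewrite finset.in_set0.
move=> _; rewrite sform_negb -sformN opprB sformB subr_ge0.
have [->|ji] := eqVneq j i; first by rewrite zi.
by rewrite zj// le_max ym orbT.
Qed.

Lemma deep_refl b i l (m : R) : exists l', forall y, `|sform b i y| <= m ->
  deep b i l' y -> deep b i l (r i *m y).
Proof.
have [M Mc] := finite_upper_bound (fun j => `|(c i j)%:~R| * m).
exists (l + M) => y ym yl' j ji; rewrite sform_refl.
have : (c i j)%:~R * sform b i y <= M.
  apply: le_trans (ler_norm _) (le_trans _ (Mc j)).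
  by rewrite normrM ler_wpM2l.
by have := yl' j ji; lra.
Qed.

End ChimneyFilters.

Lemma int_threshold (P : int -> Prop) k k' : P k -> ~ P k' ->
  (forall m, P m -> P (m + 1)) -> exists2 m, P m & ~ P (m - 1).
Proof.
move=> Pk nPk' up.
have Pn m (n : nat) : P m -> P (m + n%:Z).
  by elim: n => [|n IHn] Pm; rewrite ?addr0// -addn1 PoszD addrA; apply/up/IHn.
have [kk'|k'k] := leP k k'.
  by case: nPk'; have := Pn k `|k' - k|%N Pk; rewrite gez0_abs ?subr_ge0// subrKC.
have [n kE] : exists n : nat, k = k' + n%:Z by exists `|k - k'|%N; lia.
elim: n => [|n IHn] in k Pk k'k kE *; first by rewrite kE addr0 in Pk.
have [Pn'|nPn] := pselect (P (k' + n%:Z)); last first.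
  by exists k => //; have <- : k' + n%:Z = k - 1 by lia.
apply: (IHn (k' + n%:Z)) => //; rewrite ltNge; apply/negP => h; apply: nPk'.
by have <- : k' + n%:Z = k' by lia.
Qed.

(** * Apartments sharing a facet at infinity *)

Section Charts.
Context {R : realType} (V : vectorial_data R) (T : Type) (M : premasure V T).
Hypothesis masureM : is_masure M.
Local Notation I := (vd_index V).
Local Notation AA := 'cV[R]_(vd_dim V).
Implicit Types (A B L N : set T) (f e h : AA -> T) (b : bool) (i j : I) (k l m : int).

Lemma chart_exists A : apt M A -> exists f, charts M A f.
Proof. by case: masureM => _ MA1 _ _ _ /MA1[]. Qed.

Lemma chartP A f : apt M A -> charts M A f ->
  [/\ injective f, range f = A & charts M A = [set f \o w | w in affine_weyl V]].
Proof. by case: masureM => _ MA1 _ _ _ /MA1[_ +]; exact. Qed.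

Lemma chart_inj A f : apt M A -> charts M A f -> injective f.
Proof. by move=> aA /(chartP aA)[]. Qed.

Lemma chart_in A f y : apt M A -> charts M A f -> A (f y).
Proof. by move=> aA /(chartP aA)[_ <- _]; exists y. Qed.

Lemma chart_comp A f w : apt M A -> charts M A f -> affine_weyl V w ->
  charts M A (f \o w).
Proof. by move=> aA /(chartP aA)[_ _ ->] Ww; exists w. Qed.

Lemma chart_eq A f f' : apt M A -> charts M A f -> charts M A f' ->
  exists2 w, affine_weyl V w & f' = f \o w.
Proof. by move=> aA /(chartP aA)[_ _ ->] [w Ww <-]; exists w. Qed.

Lemma contains_fmap B f (F : set_system AA) : filter_laws F ->
  contains B (fmap f F) <-> F (f @^-1` B).
Proof.
move=> [_ up]; split=> [[E FE EB]|FB].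
  by apply: up FE => y; exact: EB.
by exists (f @` (f @^-1` B)); [apply: up FB => y By; exists y|move=> _ [y By <-]].
Qed.

Lemma common_apartment L e A f (R0 F0 : set_system AA) :
  apt M L -> charts M L e -> apt M A -> charts M A f ->
  splayed_chimney_germ V R0 -> solid_chimney_germ V F0 ->
  filter_laws R0 -> filter_laws F0 ->
  exists B, [/\ apt M B, R0 (e @^-1` B) & F0 (f @^-1` B)].
Proof.
move=> aL ce aA cf sR sF lR lF; case: masureM => _ _ _ MA3 _.
have [|B [aB /contains_fmap BR /contains_fmap BF]] := MA3 (fmap e R0) (fmap f F0).
  split; first by exists L, e, R0.
  by right; exists A, f, F0.
by exists B; split=> //; [exact: BR|exact: BF].
Qed.

(** The form in which (MA4) is applied: composing the isomorphism with a chart turns the fixing of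
    an enclosure into an equality of two charts on an enclosed set. *)
Lemma common_chart L e B (R0 F0 : set_system AA) :
  apt M L -> charts M L e -> apt M B ->
  splayed_chimney_germ V R0 -> solid_chimney_germ V F0 ->
  filter_laws R0 -> filter_laws F0 ->
  R0 (e @^-1` B) -> F0 (e @^-1` B) ->
  exists h Q, [/\ charts M B h, enclosed Q, R0 Q, F0 Q & forall y, Q y -> h y = e y].
Proof.
move=> aL ce aB sR sF lR lF RB FB; case: masureM => _ _ _ _ [MA4 _].
have preT F : filter_laws F -> F (e @^-1` B) -> F (e @^-1` L).
  by move=> [_ up]; apply: up => y _; exact: chart_in aL ce.
have [|||||phi [_ iso [S encS fixS]]] :=
  MA4 (fmap e R0) (fmap e F0) L B _ aL aB _ _ _ _ e ce.
- by split; [exists L, e, R0|right; exists L, e, F0].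
- by apply/contains_fmap => //; exact: preT lR RB.
- by apply/contains_fmap => //; exact: preT lF FB.
- exact/contains_fmap.
- exact/contains_fmap.
move: encS => [k [kz [E1 RE1 [E2 FE2 E12]] QS]].
set Q := \bigcap_(a in _) _ in E12 QS.
have [h0 ch0] := chart_exists aB.
have [w Ww hw] := iso e h0 ce ch0.
have einj := chart_inj aL ce.
exists (h0 \o w), Q; split; first exact: chart_comp ch0 Ww.
- by exists k.
- apply: (proj2 lR) RE1 => y E1y; have : (e @` Q) (e y) by rewrite -E12; left.
  by move=> [y' Qy' /einj <-].
- apply: (proj2 lF) FE2 => y E2y; have : (e @` Q) (e y) by rewrite -E12; right.
  by move=> [y' Qy' /einj <-].
- by move=> y Qy; rewrite /= -hw fixS//; exact: QS.
Qed.

(* Otherwise N and N' would be folded along the wall of level l, and kap would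
   not be injective. *)
Lemma no_fold b i A f L kap N nu N' nu' m l : m <= l ->
  apt M A -> charts M A f -> apt M L -> charts M L kap ->
  apt M N -> charts M N nu -> apt M N' -> charts M N' nu' ->
  sector_filter (~~ b) (f @^-1` N') ->
  (forall y, sform b i y <= m%:~R -> nu y = f y) ->
  strip_filter b i (l - 1) [set y | nu y = kap y] ->
  strip_filter b i l [set y | nu' y = kap y] ->
  forall y, sform b i y <= l%:~R -> nu' y = nu y.
Proof.
move=> ml aA cf aL ck aN cn aN' cn' sN' nuf [d1 nuk] [d2 nu'k].
have lR : (l%:~R : R) <= (l + 1)%:~R by rewrite ler_int lerDl.
have lR' : ((l - 1)%:~R : R) <= l%:~R by rewrite ler_int gerBl.
pose d := Num.max d1 d2.
have deep12 y : deep b i d y -> deep b i d1 y /\ deep b i d2 y.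
  by move=> dy; split=> j /dy; apply: le_trans; rewrite le_max lexx ?orbT.
have nu_wall y : sform b i y = l%:~R -> deep b i d y -> nu' y = kap y /\ nu y = kap y.
  move=> yl /deep12[y1 y2]; split; [apply: nu'k|apply: nuk] => //.
    by rewrite yl lexx lR.
  by rewrite yl subrK lexx lR'.
have [||nu1 [Q [cn1 encQ wQ sQ nu1E]]] := common_chart aN cn aN'
  (splayed_wall b i l) (solid_sector (~~ b) i) (wall_laws b i l) (sector_laws V (~~ b)).
- exists d => y yl dy; have [E nuy] := nu_wall y yl dy; rewrite /= nuy -E; exact: chart_in aN' cn'.
- apply: (proj2 (sector_laws V _)) ((proj1 (sector_laws V _)) _ _ sN' (sector_opp_le b i m)).
  by move=> y [/= fy ym]; rewrite /= nuf.
have Ql := wall_sector_enclosed encQ wQ sQ.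
have [w Ww nu'w] := chart_eq aN' cn1 cn'.
have inj1 := chart_inj aN' cn1.
have [||wr] := affine_weyl_fix_wall (b := b) (i := i) (k := l) Ww.
- exists d => y yl dy; apply: inj1; have [E1 E2] := nu_wall y yl dy.
  have -> : nu1 (w y) = nu' y by rewrite nu'w.
  by rewrite E1 -E2 nu1E//; apply: Ql; rewrite yl.
- by move=> w1 y yl; rewrite nu'w w1 /= nu1E//; exact: Ql.
(* If w is the reflection, y at level l + 1 and w y at level l - 1 lie in the strips where [nu'] and
   [nu] are known to equal [kap], and both get the same image. *)
pose y := level_point b i (l + 1) + d *: cone_point b [set i]%SET.
have yi : sform b i y = (l + 1)%:~R.
  by rewrite sformD sform_level_self sformZ sform_point finset.in_set1 eqxx mulr0 addr0.
have dy : deep b i d y.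
  move=> j ji; rewrite sformD sform_level// sformZ sform_point finset.in_set1 ji.
  by rewrite add0r mulr1.
have wyi : sform b i (w y) = (l - 1)%:~R.
  by rewrite wr sform_wall_refl_self yi intrD intrB; ring.
have dwy : deep b i d (w y) by rewrite wr; apply: wall_refl_deep => //; rewrite yi.
suff : kap y = kap (w y).
  move=> /(chart_inj aL ck) /(congr1 (sform b i)); rewrite wyi yi => /intr_inj; lia.
have <- : nu' y = kap y.
  by apply: nu'k; [rewrite /= yi lexx lR|have [] := deep12 y dy].
have <- : nu (w y) = kap (w y).
  by apply: nuk; [rewrite /= wyi subrK lexx lR'|have [] := deep12 _ dwy].
by rewrite nu'w /= nu1E//; apply: Ql; rewrite wyi.
Qed.

(** Strips alone never reach infinity. But a chart that agrees with [kap] on a sector also agrees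
    with it on all strips of sufficiently high level, so after finitely many strips an apartment
    containing the sector-germ can be glued by the same argument. *)
Lemma extend_half b i A f L kap m l N nu : m <= l ->
  apt M A -> charts M A f -> apt M L -> charts M L kap ->
  apt M N -> charts M N nu ->
  (forall y, sform b i y <= m%:~R -> nu y = f y) ->
  strip_filter b i (l - 1) [set y | nu y = kap y] ->
  exists N' nu', [/\ apt M N', charts M N' nu', sector_filter b (kap @^-1` N')
    & forall y, sform b i y <= m%:~R -> nu' y = f y].
Proof.
move=> ml aA cf aL ck aN0 cn0 nu0f nu0k.
have step (n : nat) : exists N nu, [/\ apt M N, charts M N nu,
    forall y, sform b i y <= m%:~R -> nu y = f y
  & strip_filter b i (l + n%:Z - 1) [set y | nu y = kap y]].
  elim: n => [|n [N1 [nu1 [aN cn nuf nuk]]]]; first by exists N, nu; rewrite addr0.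
  set l' := l + n%:Z in nuk; have ml' : m <= l' by rewrite /l' ler_wpDr.
  have [N' [aN' kN' fN']] := common_apartment aL ck aA cf (splayed_strip b i l')
    (solid_sector (~~ b) i) (strip_laws b i l') (sector_laws V (~~ b)).
  have [nu' [Q [cn' _ sQ _ nu'k]]] := common_chart aL ck aN' (splayed_strip b i l')
    (solid_strip b i l') (strip_laws b i l') (strip_laws b i l') kN' kN'.
  have nu'kap : strip_filter b i l' [set y | nu' y = kap y].
    by apply: (proj2 (strip_laws b i l')) sQ; exact: nu'k.
  have nu'nu := no_fold ml' aA cf aL ck aN cn aN' cn' fN' nuf nuk nu'kap.
  exists N', nu'; split=> //.
    by move=> y ym; rewrite nu'nu ?nuf// (le_trans ym)// ler_int.
  by have -> : l + n.+1%:Z - 1 = l' by rewrite /l'; lia.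
have [N' [aN' kN' fN']] := common_apartment aL ck aA cf (splayed_sector b i)
  (solid_sector (~~ b) i) (sector_laws V b) (sector_laws V (~~ b)).
have [nu' [Q [cn' _ sQ _ nu'k]]] := common_chart aL ck aN' (splayed_sector b i)
  (solid_sector b i) (sector_laws V b) (sector_laws V b) kN' kN'.
have [k0 Qk0] := sector_strip i sQ.
pose n := `|k0 - l|%N.
have k0n : k0 <= l + n%:Z by rewrite /n; lia.
have [N1 [nu1 [aN cn nuf nuk]]] := step n.
have ml' : m <= l + n%:Z by lia.
have nu'kap : strip_filter b i (l + n%:Z) [set y | nu' y = kap y].
  by apply: (proj2 (strip_laws b i _)) (Qk0 _ k0n); exact: nu'k.
have nu'nu := no_fold ml' aA cf aL ck aN cn aN' cn' fN' nuf nuk nu'kap.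
exists N', nu'; split=> // y ym.
by rewrite nu'nu ?nuf// (le_trans ym)// ler_int.
Qed.

End Charts.

(** * Splitting an apartment at its branching level *)

Section Halves.
Context {R : realType} (V : vectorial_data R) (T : Type) (M : premasure V T).
Hypothesis masureM : is_masure M.
Local Notation I := (vd_index V).
Local Notation AA := 'cV[R]_(vd_dim V).
Local Notation r := (simple_refl V).
Implicit Types (A B L N : set T) (f e h : AA -> T) (b : bool) (i j : I) (k l m : int).

Lemma reflK i (y : AA) : r i *m (r i *m y) = y.
Proof. by rewrite mulmxA refl_mul_self mul1mx. Qed.

Definition agree b i f e k : Prop :=
  exists d : R, forall y, k%:~R <= sform b i y -> deep b i d y -> f y = e y.

(** If the charts agreed from every level on, take an apartment B containing t, the germ of e r_i,
    and the corresponding germ of f r_i. The charts of B extending these two would agree on a strip,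
    hence coincide, and [A] would contain t. *)
Lemma agree_not_all b i E e A f : apt M E -> charts M E e -> apt M A -> charts M A f ->
  ~ sector_filter b ((fun y => e (r i *m y)) @^-1` A) -> exists k, ~ agree b i f e k.
Proof.
move=> aE ce aA cf tA; apply: contrapT => noJ; apply: tA.
have J k : agree b i f e k by apply: contrapT => nJ; apply: noJ; exists k.
pose k0 := fun y => e (r i *m y); pose fr := fun y => f (r i *m y).
have ck0 : charts M E k0 := chart_comp masureM aE ce (affine_weyl_refl i).
have cfr : charts M A fr := chart_comp masureM aA cf (affine_weyl_refl i).
have [B [aB eB fB]] := common_apartment masureM aE ck0 aA cfr (splayed_sector b i)
  (solid_sector b i) (sector_laws V b) (sector_laws V b).
have [h [Q [ch _ sQ _ hk]]] := common_chart masureM aE ck0 aB (splayed_sector b i)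
  (solid_sector b i) (sector_laws V b) (sector_laws V b) eB eB.
have [h' [Q' [ch' _ sQ' _ hf]]] := common_chart masureM aA cfr aB (splayed_sector b i)
  (solid_sector b i) (sector_laws V b) (sector_laws V b) fB fB.
have sQQ : sector_filter b (Q `&` Q') := proj1 (sector_laws V b) _ _ sQ sQ'.
have [w Ww h'w] := chart_eq masureM aB ch ch'.
have [m0 Qm] := sector_strip i sQQ.
(* On levels m >= 0 the reflection r_i preserves depth; it sends the strip to levels between - (m +
   1) and - m, whence the level at which the hypothesis is used. *)
pose m := Num.max m0 0; have [d QQd] : strip_filter b i m (Q `&` Q').
  by apply: Qm; rewrite le_max lexx.
have m_ge0 : 0 <= m by rewrite le_max lexx orbT.
have [d' fe] := J (- (m + 1)).
have w1 : w = id.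
  apply: (affine_weyl_fix_strip (b := b) (i := i) (k := m) Ww).
  exists (Num.max d d') => y ym dy.
  have dy1 : deep b i d y by move=> j /dy; apply: le_trans; rewrite le_max lexx.
  have dy2 : deep b i d' y by move=> j /dy; apply: le_trans; rewrite le_max lexx orbT.
  have [Qy Q'y] := QQd y ym dy1; move/andP: ym => [my ym1].
  apply: (chart_inj masureM aB ch); have -> : h (w y) = h' y by rewrite h'w.
  rewrite hk// hf// /fr /k0; apply: fe.
    by rewrite sform_refl_self intrN lerN2.
  move=> j ji; rewrite sform_refl; apply: le_trans (dy2 j ji) _.
  rewrite lerDl oppr_ge0 mulr_le0_ge0 ?lerz0 ?cartan_le0//; first by rewrite eq_sym.
  by apply: le_trans my; rewrite ler0z.
apply: (proj2 (sector_laws V b)) sQQ => y [Qy Q'y].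
change (A (k0 y)); rewrite -hk//; have -> : h y = h' y by rewrite h'w w1.
by rewrite hf//; exact: (chart_in masureM _ aA cfr).
Qed.

Lemma half_split b i E e A : apt M E -> charts M E e -> apt M A ->
  sector_filter b (e @^-1` A) ->
  ~ sector_filter b ((fun y => e (r i *m y)) @^-1` A) ->
  exists f k, [/\ charts M A f,
    exists N nu, [/\ apt M N, charts M N nu,
      sector_filter b ((fun y => e (r i *m y)) @^-1` N)
      & forall y, k%:~R <= sform b i y -> nu y = f y]
    & exists N nu, [/\ apt M N, charts M N nu,
      sector_filter b ((fun y => e (r i *m y)) @^-1` N)
      & forall y, sform b i y <= k%:~R -> nu y = f y]].
Proof.
move=> aE ce aA sA tA.
have [f [Q [cf _ [d Qd] _ fe]]] := common_chart masureM aE ce aA (splayed_sector b i)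
  (solid_sector b i) (sector_laws V b) (sector_laws V b) sA sA.
have [k1 dk1] := int_above d.
have J1 : agree b i f e k1.
  exists d => y ky dy; apply/fe/Qd => j; have [->|/dy//] := eqVneq j i.
  exact: le_trans dk1 ky.
have [k2 J2] := agree_not_all aE ce aA cf tA.
have [|k [dk Jk] nJk] := int_threshold J1 J2.
  move=> m [d' Jm]; exists d' => y ym; apply: Jm.
  by apply: le_trans ym; rewrite ler_int lerDl.
exists f, k; split=> //.
(* Upper half: composed with r_i it becomes the half below level - k, [A] itself is the starting
   apartment, and t is the sector-germ of [er]. *)
- pose fr := fun y => f (r i *m y); pose er := fun y => e (r i *m y).
  have cer : charts M E er := chart_comp masureM aE ce (affine_weyl_refl i).
  have cfr : charts M A fr := chart_comp masureM aA cf (affine_weyl_refl i).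
  have [|||N [nu [aN cn sN nuf]]] := @extend_half _ V _ _ masureM b i A fr E er
    (- k) (- k) A fr _ aA cfr aE cer aA cfr.
  + by [].
  + by [].
  (* The levels of y lie between - k - 1 and - k, hence the bound |k| + 1. *)
  + have [d' dd'] := deep_refl b i dk (`|k%:~R| + 1).
    exists d' => y /andP[yk yk1] dy; apply: Jk.
      by rewrite sform_refl_self lerNr -intrN; move: yk1; rewrite subrK.
    apply: dd' => //; rewrite ler_norml; move: yk yk1; rewrite subrK intrB intrN.
    have := ler_norm (k%:~R : R); have := ler_norm (- k%:~R : R); rewrite normrN mulr1z.
    by move=> h1 h2 h3 h4; apply/andP; split; lra.
  exists N, (fun y => nu (r i *m y)); split=> //.
    exact: (chart_comp masureM aN cn (affine_weyl_refl i)).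
  move=> y ky; rewrite nuf /fr ?reflK// sform_refl_self intrN lerN2//.
(* Lower half: [N] joins the strip of [E] just below level k, where [A] no longer follows [E], to
   the opposite sector of [A]. *)
have [N [aN eN fN]] := common_apartment masureM aE ce aA cf (splayed_strip b i (k - 1))
  (solid_sector (~~ b) i) (strip_laws b i (k - 1)) (sector_laws V (~~ b)).
have [d1 eN1] := eN.
have kk1 : ((k - 1)%:~R : R) <= k%:~R by rewrite ler_int gerBl.
have [||nu [Q' [cn encQ' wQ' sQ' nuf]]] := common_chart masureM aA cf aN (splayed_wall b i k)
  (solid_sector (~~ b) i) (wall_laws b i k) (sector_laws V (~~ b)).
- exists (Num.max d1 dk) => y yk dy.
  rewrite /= Jk ?yk//; last by move=> j /dy; apply: le_trans; rewrite le_max lexx orbT.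
  apply: eN1; first by rewrite subrK yk lexx kk1.
  by move=> j /dy; apply: le_trans; rewrite le_max lexx.
- exact: fN.
have {}nuf y : sform b i y <= k%:~R -> nu y = f y.
  by move=> yk; apply: nuf; exact: (wall_sector_enclosed encQ' wQ' sQ').
have [nu' [Q'' [cn' _ [d2 Q''d] _ nu'e]]] := common_chart masureM aE ce aN
  (splayed_strip b i (k - 1)) (solid_strip b i (k - 1)) (strip_laws b i (k - 1))
  (strip_laws b i (k - 1)) eN eN.
have [w Ww nu'w] := chart_eq masureM aN cn cn'.
have max1 y : deep b i (Num.max d2 dk) y -> deep b i d2 y.
  by move=> dy j /dy; apply: le_trans; rewrite le_max lexx.
have max2 y : deep b i (Num.max d2 dk) y -> deep b i dk y.
  by move=> dy j /dy; apply: le_trans; rewrite le_max lexx orbT.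
have strip_e y : (k - 1)%:~R <= sform b i y <= k%:~R -> deep b i (Num.max d2 dk) y ->
    nu' y = e y.
  by move=> yk /max1 dy; apply/nu'e/Q''d => //; rewrite subrK.
have [||wr] := affine_weyl_fix_wall (b := b) (i := i) (k := k) Ww.
- exists (Num.max d2 dk) => y yk dy; apply: (chart_inj masureM aN cn).
  have -> : nu (w y) = nu' y by rewrite nu'w.
  rewrite strip_e//; last by rewrite yk lexx kk1.
  by rewrite nuf ?yk// Jk ?yk//; exact: max2.
(* The identity would make f and e agree from level k - 1 on, contrary to the choice of k. *)
- move=> w1; case: nJk; exists (Num.max d2 dk) => y yk dy.
  have [yk'|yk'] := leP k%:~R (sform b i y); first by apply: Jk => //; exact: max2.
  rewrite -nuf; last exact: ltW.
  by rewrite -strip_e ?yk ?ltW// nu'w w1.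
(* So w is the reflection, and above level k the apartment [N] follows [E] reflected in that wall.
   The linear part of the reflection is r_i, so up to a translation the sector-germ of [kap] is
   t. *)
pose kap := fun y => e (wall_refl b i k y).
have ckap : charts M E kap := chart_comp masureM aE ce (wall_refl_weyl b i k).
have kk : k <= k + 1 by rewrite lerDl.
have [|N' [nu1 [aN' cn1 sN' nu1f]]] := extend_half masureM kk aA cf aE ckap aN cn nuf.
  rewrite addrK; exists (Num.max d2 dk) => y /andP[yk yk1] dy.
  rewrite /= /kap -strip_e; first by rewrite nu'w wr /= wall_reflK.
    rewrite sform_wall_refl_self intrB; move: yk1; rewrite intrD mulr1z => yk1.
    by apply/andP; split; lra.
  exact: wall_refl_deep.
exists N', nu1; split=> //.
pose v := k%:~R *: ((-1) ^+ b *: simple_coroot V i).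
apply: (proj2 (sector_laws V b)) (sector_translate v sN') => y.
rewrite /= /kap /wall_refl -/v mulmxDr -addrA.
have -> : r i *m v = - v.
  rewrite /v -!scalemxAr refl_mul simple_root_coroot cartan_diag.
  by apply/colP => l; rewrite !mxE; ring.
by rewrite addNr addr0.
Qed.

End Halves.

(** * Sector-germs and the induction on the distance *)

Section SectorGerms.
Context {R : realType} (V : vectorial_data R).
Local Notation I := (vd_index V).
Local Notation AA := 'cV[R]_(vd_dim V).
Local Notation ro := (simple_root V).
Local Notation r := (simple_refl V).
Implicit Types (x y z v u : AA) (b : bool) (i j : I).

Lemma std_chamber_face : std_chamber V = std_face V finset.set0.
Proof.
apply/seteqP; split=> v /= h.
  by split=> i; rewrite finset.in_set0// => _; exact: h.
by move=> i; apply: (proj2 h); rewrite finset.in_set0.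
Qed.

(** The base point and the shifts along the cone change each form by a constant only, which the germ
    does not see. *)
Lemma sector_face_germE b w x : weyl V w ->
  sector_face_germ V x (signed_image V b w (std_chamber V)) =
  fmap (fun y => w *m y) (sector_filter (V := V) b).
Proof.
move=> Ww; have wu := weyl_unit Ww.
have imgE v : signed_image V b w (std_chamber V) (w *m v) <-> signed_cone b finset.set0 v.
  rewrite std_chamber_face; split=> -[z zC zv]; exists z => //.
    by apply: (can_inj (mulKmx wu)); rewrite -zv mul1mx scalemxAr.
  by rewrite -zv mul1mx scalemxAr.
apply/seteqP; split=> E.
  move=> [u _ uE]; pose y := invmx w *m (x + u).
  have [m ym] := finite_upper_bound (fun j => sform b j y).
  exists (m + 1) => z zm; apply: uE; exists (x + u) => //.
  exists (w *m (z - y)); last by rewrite mulmxBr [w *m y]mulKVmx// subrKC.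
  apply/imgE/signed_coneE; split=> j; first by rewrite finset.in_set0.
  by move=> _; rewrite sformB; have := zm j; have := ym j; lra.
move=> [l lE]; pose y := invmx w *m x.
have [m ym] := finite_upper_bound (fun j => - sform b j y).
pose n := `|l + m| + 1.
have n0 : 0 < n by rewrite ltr_wpDl.
have un : signed_image V b w (std_chamber V) (w *m (n *: cone_point b finset.set0)).
  by apply/imgE; apply: signed_coneZ => //; exact: cone_point_in.
exists (w *m (n *: cone_point b finset.set0)); first exact: subset_closure.
move=> _ [_ -> [v vC <-]].
have [v' Ev] : exists v', v = w *m v' by exists (invmx w *m v); rewrite mulKVmx.
rewrite Ev in vC *; move/imgE/signed_coneE: vC => [_ vp].
have -> : x = w *m y by rewrite mulKVmx.
rewrite -!mulmxDr; apply: lE => j; rewrite !sformD sformZ sform_point finset.in_set0 mulr1.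
have := vp j; rewrite finset.in_set0 => /(_ isT); have := ym j.
by have := ler_norm (l + m); rewrite /n; lra.
Qed.

Lemma closure_chamber b w y : weyl V w ->
  closure (signed_image V b w (std_chamber V)) y ->
  forall j, 0 <= evalf V (ro j) ((-1) ^+ b *: (invmx w *m y)).
Proof.
move=> Ww cy j; rewrite evalfZ evalf_mul -evalfZl.
apply: evalf_closure cy => _ [v vC <-].
rewrite evalfZl evalfZ mulrA -expr2 sqrr_sign mul1r -evalf_mul mulKmx ?weyl_unit//.
exact/ltW/vC.
Qed.

(** The kernel of the root of [H] meets the plane of v1 and v2 in a nonzero vector, whereas the two
    forms vanish together only at 0 on that plane. *)
Lemma wall_not_codim2 w i j H : weyl V w -> wall V H -> H !=set0 -> i != j ->
  ~ (forall y, H y -> evalf V (ro i) (w *m y) = 0 /\ evalf V (ro j) (w *m y) = 0).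
Proof.
move=> Ww [a [k [_ ->]]] [y0 Hy0] ij sub; have wu := weyl_unit Ww.
pose v1 : AA := invmx w *m fund i; pose v2 : AA := invmx w *m fund j.
have shift v : evalf V a v = 0 -> evalf V (ro i) (w *m v) = 0 /\ evalf V (ro j) (w *m v) = 0.
  move=> av; have [i0 j0] := sub _ Hy0.
  have [|i1 j1] := sub (y0 + v); first by rewrite /hyperplane /= evalfD av addr0.
  by move: i1 j1; rewrite mulmxDr !evalfD i0 j0 !add0r.
have a1 : evalf V a v1 = 0.
  have [|_] := shift (evalf V a v2 *: v1 - evalf V a v1 *: v2).
    by rewrite evalfB !evalfZ mulrC subrr.
  rewrite mulmxBr -!scalemxAr !mulKVmx// evalfB !evalfZ !fundE eqxx (negPf ij).
  by rewrite mulr0 mulr1 sub0r => /eqP; rewrite oppr_eq0 => /eqP.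
have [/eqP + _] := shift v1 a1; rewrite mulKVmx// fundE eqxx.
by rewrite oner_eq0.
Qed.

(** Seen from the second chamber, the panel lies on the simple wall of a descent of w. It lies on no
    other simple wall, since it spans a wall and two simple walls meet in codimension two. *)
Lemma sector_panel_chambers b w1 w2 P : weyl V w1 -> weyl V w2 -> sector_panel V P ->
  P `<=` closure (signed_image V b w1 (std_chamber V)) `&`
         closure (signed_image V b w2 (std_chamber V)) ->
  w1 = w2 \/ exists i, w1 = w2 *m r i.
Proof.
move=> W1 W2 [x0 [Fv [H [_ _ wallH [[H0 _] _ Hmin]]]]] Psub.
have u1 := weyl_unit W1; have u2 := weyl_unit W2.
pose w := invmx w2 *m w1.
have Ww : weyl V w by apply: weyl_mul => //; exact: weyl_inv.
have [w1E|/eqP wn1] := eqVneq w 1%:M.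
  by left; rewrite -[RHS]mulmx1 -w1E mulKVmx.
right; have [i ni] := weyl_descent Ww wn1; exists i.
pose S := [set p | exists2 y, P y & p = (-1) ^+ b *: (invmx w2 *m y)].
have S0 p j : S p -> 0 <= evalf V (ro j) p.
  by move=> [y Py ->]; apply: closure_chamber => //; have [] := Psub y Py.
have Sw p : S p -> exists2 q, p = w *m q & forall j, 0 <= evalf V (ro j) q.
  move=> [y Py ->]; exists ((-1) ^+ b *: (invmx w1 *m y)).
    by rewrite -scalemxAr /w -mulmxA mulKVmx.
  by apply: closure_chamber => //; have [] := Psub y Py.
have Si p : S p -> evalf V (ro i) p = 0.
  move=> Sp; apply/eqP; rewrite eq_le S0// andbT.
  have [q -> q0] := Sw p Sp; rewrite evalf_mul.
  by have := evalf_nonneg_comb ni q0; rewrite evalfNl oppr_ge0.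
have [|//|wr] := weyl_fix_facet Ww Si S0 Sw.
  move=> j ji; apply: contrapT => nS.
  have Sj p : S p -> evalf V (ro j) p = 0.
    by move=> Sp; apply: contrapT => /eqP pj; apply: nS; exists p.
  apply: (wall_not_codim2 (weyl_inv V _ W2) wallH H0 (_ : i != j)).
    by rewrite eq_sym.
  have zero l : (forall p, S p -> evalf V (ro l) p = 0) ->
      forall y, P y -> evalf V (ro l) (invmx w2 *m y) = 0.
    move=> Sl y Py; have := Sl _ (ex_intro2 _ _ y Py erefl).
    by rewrite evalfZ => /eqP; rewrite mulf_eq0 signr_eq0 => /eqP.
  move=> y Hy; apply: (Hmin [set y | evalf V (ro i) (invmx w2 *m y) = 0 /\
    evalf V (ro j) (invmx w2 *m y) = 0]) => //.
    split; first by exists 0; rewrite /= mulmx0 !evalf0.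
    move=> z z' t /= [zi zj] [zi' zj']; rewrite mulmxDr -scalemxAr mulmxBr.
    by rewrite !evalfD !evalfZ !evalfB zi zj zi' zj' subrr mulr0 addr0.
  by exists P => // z Pz; split; exact: zero Pz.
by rewrite -wr mulKVmx.
Qed.

End SectorGerms.

(** * Transport of pieces by isomorphisms, and the induction *)

Section Isomorphisms.
Context {R : realType} (V : vectorial_data R) (T : Type) (M : premasure V T).
Hypothesis masureM : is_masure M.
Local Notation I := (vd_index V).
Local Notation AA := 'cV[R]_(vd_dim V).
Local Notation r := (simple_refl V).
Implicit Types (A B E L N D : set T) (f e h nu : AA -> T) (b : bool) (k l m n : nat)
  (s t : set_system T).

Lemma chart_isomorphism A f N nu : apt M A -> charts M A f -> apt M N -> charts M N nu ->
  exists2 phi, apt_isomorphism M N A phi & forall y, phi (nu y) = f y.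
Proof.
move=> aA cf aN cn.
have [phi phiE] : exists phi : T -> T, forall y, phi (nu y) = f y.
  exists (fun x => if pselect (exists y, nu y = x) is left ex then f (projT1 (cid ex)) else x).
  move=> y; case: pselect => [ex|]; last by case; exists y.
  by case: cid => y' /= /(chart_inj masureM aN cn) ->.
exists phi => // nu1 f1 cn1 cf1.
have [w Ww ->] := chart_eq masureM aN cn cn1.
have [w' Ww' fE] := chart_eq masureM aA cf1 cf.
exists (w' \o w); last by move=> x; rewrite /= phiE fE.
by apply: vectorially_weyl_aut_comp; exact: affine_weyl_aut.
Qed.

Lemma isomorphism_id A : apt M A -> apt_isomorphism M A A id.
Proof.
move=> aA f f' cf cf'; have [w Ww fE] := chart_eq masureM aA cf' cf.
by exists w; [exact: affine_weyl_aut|move=> x; rewrite fE].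
Qed.

Lemma isomorphism_comp A B E phi psi : apt M B -> apt_isomorphism M A B phi ->
  apt_isomorphism M B E psi -> apt_isomorphism M A E (psi \o phi).
Proof.
move=> aB iphi ipsi f f' cf cf'; have [g cg] := chart_exists masureM aB.
have [w Ww wE] := iphi f g cf cg; have [w' Ww' wE'] := ipsi g f' cg cf'.
exists (w' \o w); first exact: vectorially_weyl_aut_comp.
by move=> x; rewrite /= wE wE'.
Qed.

Lemma isomorphism_inj A B phi : apt M A -> apt M B -> apt_isomorphism M A B phi ->
  forall x y, A x -> A y -> phi x = phi y -> x = y.
Proof.
move=> aA aB iphi x y; have [f cf] := chart_exists masureM aA.
have [g cg] := chart_exists masureM aB; have [w Ww wE] := iphi f g cf cg.
have [_ <- _] := chartP masureM aA cf.
move=> [x' _ <-] [y' _ <-]; rewrite !wE => /(chart_inj masureM aB cg).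
case: Ww => -[w0 [u [Ww0 _ ->]]] _ /addIr /(congr1 (mulmx (invmx w0))).
by rewrite !mulKmx ?weyl_unit// => ->.
Qed.

Lemma isomorphism_half A B phi H : apt M A -> apt M B -> apt_isomorphism M A B phi ->
  half_apartment_of M A H -> half_apartment_of M B (phi @` H).
Proof.
move=> aA aB iphi [f [H0 [cf hH0 ->]]]; have [g cg] := chart_exists masureM aB.
have [w Ww wE] := iphi f g cf cg.
exists g, (w @` H0); split=> //; first exact: vectorially_weyl_aut_half.
by rewrite !image_comp; apply: eq_imagel => x _; rewrite /= wE.
Qed.

Lemma half_sub A H : apt M A -> half_apartment_of M A H -> H `<=` A.
Proof.
by move=> aA [f [H0 [cf _ ->]]] _ [y _ <-]; exact: (chart_in masureM _ aA cf).
Qed.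

Lemma half_apartment_inter_seq A n P : apt M A -> half_apartment_inter M A n P ->
  exists2 H : nat -> set T, forall l, (l < n)%N -> half_apartment_of M A (H l) &
    P = [set x | A x /\ forall l, (l < n)%N -> H l x].
Proof.
case: n => [|n] aA /=.
  move=> ->; exists (fun=> setT) => //.
  by apply/seteqP; split=> x // [].
move=> [H [hH ->]]; exists (fun l => H (inord l)) => //.
apply/seteqP; split=> x /=.
  move=> Hx; split; last by move=> l _; exact: Hx.
  exact: (half_sub aA (hH ord0) (Hx ord0 Logic.I)).
by move=> [_ Hx] i _; have := Hx i (ltn_ord i); rewrite inord_val.
Qed.

Lemma seq_half_apartment_inter A n (H : nat -> set T) :
  (forall l, (l <= n)%N -> half_apartment_of M A (H l)) ->
  half_apartment_inter M A n.+1 [set x | forall l, (l <= n)%N -> H l x].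
Proof.
move=> hH; exists (fun i : 'I_n.+1 => H i); split=> [i|].
  by apply: hH; rewrite -ltnS.
apply/seteqP; split=> x /= Hx; first by move=> i _; apply: Hx; rewrite -ltnS.
by move=> l ln; have := Hx (Ordinal (ln : (l < n.+1)%N)) Logic.I.
Qed.

(** The conclusion of the theorem, relative to a subset [D] of [A] and a bound [K], so that the two
    halves can be covered separately. *)
Definition sector_cover A s n D K : Prop := exists (k : nat) (P : 'I_k -> set T),
  [/\ (k <= K)%N, forall i, half_apartment_inter M A n (P i), D = \bigcup_i P i
    & forall i, exists Ai fi, [/\ apt M Ai, P i `<=` Ai, contains Ai s,
        apt_isomorphism M Ai A fi & forall x, P i x -> fi x = x]].

Lemma sector_coverU A s n D D' K K' : sector_cover A s n D K ->
  sector_cover A s n D' K' -> sector_cover A s n (D `|` D') (K + K').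
Proof.
move=> [k [P [kK hP -> iP]]] [k' [P' [kK' hP' -> iP']]].
pose Q (i : 'I_(k + k')) := match fintype.split i with inl j => P j | inr j => P' j end.
exists (k + k')%N, Q; split; first exact: leq_add.
- by move=> i; rewrite /Q; case: (fintype.split _).
- apply/seteqP; split=> x.
    move=> [[i _ Px]|[i _ Px]].
      by exists (lshift k' i) => //; rewrite /Q (unsplitK (inl i)).
    by exists (rshift k i) => //; rewrite /Q (unsplitK (inr i)).
  by move=> [i _]; rewrite /Q; case: (fintype.split _) => j Px; [left|right]; exists j.
- by move=> i; rewrite /Q; case: (fintype.split _).
Qed.

Lemma sector_cover_half A s N phi D m n : apt M A -> apt M N ->
  apt_isomorphism M N A phi -> half_apartment_of M A D -> D `<=` N ->
  (forall x, D x -> phi x = x) -> (m <= n)%N ->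
  sector_cover N s m N (2 ^ m) -> sector_cover A s n.+1 D (2 ^ n).
Proof.
move=> aA aN iphi hD DN Dphi mn [k [P [kK hP NE iP]]].
exists k, (fun i => D `&` P i); split.
- by apply: leq_trans kK _; rewrite leq_exp2l.
- move=> i; have [H hH PE] := half_apartment_inter_seq aN (hP i).
  (* Index 0 is [D], the next m are images of half-apartments of [N], and [D] is repeated up to n +
     1 terms. *)
  pose H' l := if l is l'.+1 then if (l' < m)%N then phi @` H l' else D else D.
  have -> : D `&` P i = [set x | forall l, (l <= n)%N -> H' l x].
    rewrite PE; apply/seteqP; split=> x /=.
      move=> [Dx [_ Hx]] [|l] ln //=; case: ifP => lm //.
      by exists x; [exact: Hx|exact: Dphi].
    move=> Hx; have Dx : D x := Hx 0%N isT.
    split=> //; split=> [|l lm]; first exact: DN.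
    have := Hx l.+1 (leq_trans lm mn); rewrite /= lm => -[z Hz zx].
    (* [phi] is injective on [N] and fixes x, so on [D] the image of a half-apartment cuts out the
       same points as the half-apartment. *)
    suff <- : z = x by [].
    apply: (isomorphism_inj aN aA iphi); first exact: half_sub (hH l lm) _ Hz.
      exact: DN.
    by rewrite zx Dphi.
  apply: seq_half_apartment_inter => -[|l] _ //=; case: ifP => lm //.
  by apply: (isomorphism_half aN aA iphi); exact: hH.
- rewrite -setI_bigcupr -NE; apply/seteqP; split=> x; last by case.
  by move=> Dx; split=> //; exact: DN.
- move=> i; have [Ai [g [aAi PAi sAi ig Pg]]] := iP i.
  exists Ai, (phi \o g); split=> //.
  + by move=> x [_ /PAi].
  + exact: (isomorphism_comp aN ig iphi).
  + by move=> x [Dx Px]; rewrite /= Pg// Dphi.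
Qed.

Lemma sector_germ_ofP A b s : apt M A ->
  sector_germ_of M A b s <-> exists2 f, charts M A f & s = fmap f (sector_filter (V := V) b).
Proof.
move=> aA; split=> [[f [x [Cv [cf [w [Ww ->]] ->]]]]|[f cf ->]].
  exists (f \o mulmx w); last by rewrite sector_face_germE.
  apply: (chart_comp masureM aA cf); exists w, 0; split=> //.
    by exists (fun=> 0); rewrite big1// => i _; rewrite scale0r.
  by apply/funext => y; rewrite addr0.
exists f, 0, (signed_image V b 1%:M (std_chamber V)); split=> //.
  by exists 1%:M; split=> //; exact: weyl_one.
rewrite sector_face_germE; last exact: weyl_one.
by apply/seteqP; split=> S; rewrite /fmap /=; congr (sector_filter b _);
  apply/funext => y; rewrite /preimage /= mul1mx.
Qed.

Lemma sector_germ_in (i : I) E e B b : apt M E -> charts M E e -> apt M B ->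
  sector_filter b (e @^-1` B) -> sector_germ_of M B b (fmap e (sector_filter (V := V) b)).
Proof.
move=> aE ce aB eB; apply/sector_germ_ofP => //.
have [h [Q [ch _ sQ _ he]]] := common_chart masureM aE ce aB (splayed_sector b i)
  (solid_sector b i) (sector_laws V b) (sector_laws V b) eB eB.
exists h => //; have [lI lS] := sector_laws V b.
apply/seteqP; split=> S SE; rewrite /fmap /=.
  by apply: (lS _ _ _ (lI _ _ SE sQ)) => y [Sy /he hy]; rewrite /preimage /= hy.
by apply: (lS _ _ _ (lI _ _ SE sQ)) => y [Sy /he hy]; rewrite /preimage /= -hy.
Qed.

Lemma adjacent_refl E b s t : apt M E -> adjacent M E b t s -> t = s \/
  exists i e, [/\ charts M E e, s = fmap e (sector_filter (V := V) b)
    & t = fmap (fun y => e (r i *m y)) (sector_filter (V := V) b)].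
Proof.
move=> aE [f [x [x' [_ [_ [cf [[w1 [W1 ->]] [w2 [W2 ->]]] -> -> [P panelP Psub]]]]]]].
rewrite !sector_face_germE//.
have [->|[i ->]] := sector_panel_chambers W1 W2 panelP Psub; [by left|right].
exists i, (f \o mulmx w2); split=> //.
  apply: (chart_comp masureM aE cf); exists w2, 0; split=> //.
    by exists (fun=> 0); rewrite big1// => j _; rewrite scale0r.
  by apply/funext => y; rewrite addr0.
apply/seteqP; split=> S; rewrite /fmap /=; congr (sector_filter b _);
  by apply/funext => y; rewrite /preimage /= mulmxA.
Qed.

Lemma least_exists (S : set nat) n : S n -> exists2 m, (m <= n)%N & least S m.
Proof.
move=> Sn; have ex : exists m, `[< S m >] by exists n; apply/asboolP.
case: (ex_minnP ex) => m /asboolP Sm minm; exists m; first exact/minm/asboolP.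
by split=> // m' Sm'; exact/minm/asboolP.
Qed.

Lemma apt_dist_le n t A b s m : sector_germ_of M A b t -> germ_dist M b s t m ->
  (m <= n)%N -> exists2 m', (m' <= n)%N & apt_dist M b s A m'.
Proof.
move=> tA dm mn; have [|m' m'm lm'] := @least_exists
  [set m | exists2 s', sector_germ_of M A b s' & germ_dist M b s s' m] m.
  by exists t.
by exists m' => //; exact: leq_trans mn.
Qed.

Lemma sector_germ_of_contains A b s : apt M A -> sector_germ_of M A b s -> contains A s.
Proof.
move=> aA /(sector_germ_ofP b s aA)[f cf ->]; apply/contains_fmap; first exact: sector_laws.
by exists 0 => y _; exact: (chart_in masureM _ aA cf).
Qed.

Lemma half_apartment_ge A f b i (k : int) : charts M A f ->
  half_apartment_of M A (f @` [set y | k%:~R <= sform b i y]).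
Proof.
move=> cf; exists f, [set y | k%:~R <= sform b i y]; split=> //.
exists (signed_root b i), (- k); split; first exact: signed_root_real.
apply/seteqP; split=> y; first by move=> /= yk; apply/halfspace_fin; rewrite -sformE intrN subr_ge0.
by move=> /halfspace_fin; rewrite -sformE intrN subr_ge0.
Qed.

Lemma half_apartment_le A f b i (k : int) : charts M A f ->
  half_apartment_of M A (f @` [set y | sform b i y <= k%:~R]).
Proof.
move=> cf; have := half_apartment_ge (~~ b) i (- k) cf; congr (half_apartment_of M A (f @` _)).
by apply/seteqP; split=> y /=; rewrite sform_negb intrN lerN2.
Qed.

Lemma germ_dist_gallery E b m s t : apt M E -> sector_germ_of M E b s ->
  sector_germ_of M E b t -> gallery M E b m s t ->
  exists2 m', (m' <= m)%N & germ_dist M b s t m'.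
Proof.
move=> aE sE tE gal; have [m' m'm lm'] := @least_exists [set m | gallery M E b m s t] m gal.
by exists m' => //; exists E.
Qed.

Lemma sector_cover_exists n A b s : apt M A -> apt_dist M b s A n ->
  sector_cover A s n A (2 ^ n).
Proof.
elim/ltn_ind: n A => -[|n] IHn A aA.
  move=> [[s' s'A [E [_ _ _ [[q [q0 qs' _ _]] _]]]] _].
  exists 1%N, (fun=> A); split=> //.
    by apply/seteqP; split=> x; [exists ord0|case].
  move=> _; exists A, id; split=> //; last exact: isomorphism_id.
  by apply: (sector_germ_of_contains (b := b)) => //; rewrite -q0 qs'.
move=> [[s' s'A [E [aE sE _ [[q [q0 qn qE qadj]] _]]]] minn].
pose t := q n; have tE : sector_germ_of M E b t by apply: qE.
have [m' m'n dt] : exists2 m', (m' <= n)%N & germ_dist M b s t m'.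
  apply: germ_dist_gallery aE sE tE _; exists q; split=> // j jn.
    by apply: qE; exact: leqW.
  by apply: qadj; exact: ltnW.
(* The germ t is at distance at most n from s, so if it lay in [A] it would make the distance of [A]
   smaller than n + 1. *)
have tA : ~ sector_germ_of M A b t.
  by move=> tA; have := minn m'; rewrite leqNgt ltnS m'n => /(_ (ex_intro2 _ _ t tA dt)).
have [ts'|[i [e [ce s'e te]]]] := adjacent_refl aE (qadj n (ltnSn n)).
  by case: tA; rewrite /t ts' qn.
rewrite -/t in te; rewrite qn in s'e.
have eA : sector_filter b (e @^-1` A).
  have := sector_germ_of_contains aA s'A; rewrite s'e.
  by move/contains_fmap; apply; exact: sector_laws.
have cer : charts M E (fun y => e (r i *m y)) := chart_comp masureM aE ce (affine_weyl_refl i).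
have germ_t B : apt M B -> sector_filter b ((fun y => e (r i *m y)) @^-1` B) ->
    sector_germ_of M B b t.
  by move=> aB /(sector_germ_in i aE cer aB); rewrite te.
have [|f [k [cf [N1 [nu1 [aN1 cn1 tN1 nu1f]]] [N2 [nu2 [aN2 cn2 tN2 nu2f]]]]]] :=
  half_split masureM aE ce aA eA (i := i).
  by move=> /(germ_t _ aA).
have cover N nu (D0 : set AA) : apt M N -> charts M N nu ->
    sector_filter b ((fun y => e (r i *m y)) @^-1` N) -> (forall y, D0 y -> nu y = f y) ->
    half_apartment_of M A (f @` D0) -> sector_cover A s n.+1 (f @` D0) (2 ^ n).
  (* The distance m from s to [N] is at most n and may be smaller; the strong induction hypothesis
     covers all such m. *)
  move=> aN cn tN nuf hD; have [m mn dN] := apt_dist_le (germ_t _ aN tN) dt m'n.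
  have [phi iphi phiE] := chart_isomorphism aA cf aN cn.
  apply: (sector_cover_half aA aN iphi hD _ _ mn); last exact: IHn.
    by move=> _ [y /nuf <- <-]; exact: (chart_in masureM _ aN cn).
  by move=> _ [y Dy <-]; rewrite -{1}nuf.
have -> : sector_cover A s n.+1 A (2 ^ n.+1) = sector_cover A s n.+1
    (f @` [set y | k%:~R <= sform b i y] `|` f @` [set y | sform b i y <= k%:~R]) (2 ^ n + 2 ^ n).
  rewrite addnn -mul2n -expnS; congr (sector_cover A s n.+1 _ _).
  have [_ fA _] := chartP masureM aA cf; rewrite -{1}fA -image_setU; congr (f @` _).
  by apply/seteqP; split=> y //= _; have /orP := le_total k%:~R (sform b i y).
apply: sector_coverU.
  by apply: cover aN1 cn1 tN1 nu1f _; exact: half_apartment_ge.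
by apply: cover aN2 cn2 tN2 nu2f _; exact: half_apartment_le.
Qed.

End Isomorphisms.

Theorem proposition9 (R : realType) (V : vectorial_data R) (T : Type)
  (M : premasure V T) (masureM : is_masure M) (thickM : thick_finite M)
  (G : groupType) (act : G -> T -> T) (actG : strongly_transitive M act)
  (A0 : set T) (f0 : 'cV[R]_(vd_dim V) -> T)
  (aptA0 : apt M A0) (chart_f0 : charts M A0 f0)
  (stabA0 : induced_on act A0 f0 = semidirect_weyl V (cochar_lattice V))
  (A : set T) (aptA : apt M A)
  (b : bool) (s : set_system T) (germ_s : sector_germ M b s)
  (n : nat) (dist_n : apt_dist M b s A n) :
  exists (k : nat) (P : 'I_k -> set T),
    [/\ (k <= 2 ^ n)%N,
        forall i, half_apartment_inter M A n (P i),
        A = \bigcup_i P i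
      & forall i, exists Ai fi,
          [/\ apt M Ai, P i `<=` Ai, contains Ai s,
              apt_isomorphism M Ai A fi & forall x, P i x -> fi x = x]].
Proof. exact: (sector_cover_exists masureM aptA dist_n). Qed.
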